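(* Let $\alpha\in(0,1]$, $m\ge2$ and $R\ge10$. Then $$\mathcal P_{q,m}^{\alpha,M}(R)\lesssim R^{-\frac{2Q\alpha}{Q+2\alpha-3+\mathbf 1\{m=2\}}},$$ where the implicit constant depends only on $q,m,\alpha,M,L$.
   Context: Let $q\ge2$, $m\ge1$ be integers. $\mathbb G(q,m)$ denotes a (non-abelian) step-two nilpotent Lie group realized as $\mathbb R^q\times\mathbb R^m$ with group law $(x,t)\circ(x',t')=(x+x',\,t+t'+\frac12\langle\mathbb Ux,x'\rangle)$, where $\langle\mathbb Ux,x'\rangle:=(\langle U^{(1)}x,x'\rangle,\dots,\langle U^{(m)}x,x'\rangle)$, the $U^{(j)}$ are real $q\times q$ matrices (not all symmetric), and $\langle\cdot,\cdot\rangle$ is the Euclidean inner product. Its Haar measure $\mathrm{vol}$ is Lebesgue measure on $\mathbb R^{q+m}$. Put $Q:=q+2m$. For $\alpha>0$ and $M=\mathrm{diag}(M_1,M_2)$ with $M_1,M_2$ real invertible matrices of order $q$ and $m$, let $\mathcal N_{\alpha,M}(x,t)=(|M_1x|^\alpha+|M_2t|^{\alpha/2})^{1/\alpha}$ and $B_R^{\alpha,M}=\{(x,t):\mathcal N_{\alpha,M}(x,t)\le R\}$. Let $L=\mathrm{diag}(L_1,L_2)$ with $L_1,L_2$ real invertible matrices of order $q$ and $m$ such that $\Gamma_L:=L\mathbb Z^{q+m}=\{(L_1k',L_2k''):(k',k'')\in\mathbb Z^q\times\mathbb Z^m\}$ is a subgroup (hence a lattice) of $\mathbb G(q,m)$.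 The relative discrepancy is $$\mathcal P_{q,m}^{\alpha,M}(R):=\frac{|\det L|}{\mathrm{vol}(B_1^{\alpha,M})R^Q}\left|\#(\Gamma_L\cap B_R^{\alpha,M})-\frac{\mathrm{vol}(B_1^{\alpha,M})R^Q}{|\det L|}\right|.$$ $\mathbf 1\{E\}$ equals $1$ if condition $E$ holds and $0$ otherwise. *)

(* Defs.v *)
From HB Require Import structures.
From mathcomp Require Import all_boot all_order all_algebra finmap ring.
From mathcomp Require Import all_classical all_reals all_analysis.

Set Implicit Arguments.
Unset Strict Implicit.
Unset Printing Implicit Defensive.

Import Order.TTheory GRing.Theory Num.Theory.

Local Open Scope classical_set_scope.
Local Open Scope ring_scope.

(* The norm that MathComp-Analysis puts on matrices is the sup norm, hence the
   explicit Euclidean structure. *)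
Definition dotv (R : realType) (n : nat) (u v : 'cV[R]_n) : R :=
  \sum_(i < n) u i 0 * v i 0.

Definition enorm (R : realType) (n : nat) (u : 'cV[R]_n) : R :=
  Num.sqrt (dotv u u).

Section DotTheory.
Context {R : realType} {n : nat}.
Implicit Types u v w : 'cV[R]_n.

Lemma dotvDl u v w : dotv (u + v) w = dotv u w + dotv v w.
Proof.
by rewrite /dotv -big_split; apply: eq_bigr => i _; rewrite mxE mulrDl.
Qed.

Lemma dotvDr u v w : dotv w (u + v) = dotv w u + dotv w v.
Proof.
by rewrite /dotv -big_split; apply: eq_bigr => i _; rewrite mxE mulrDr.
Qed.

Lemma dotvNl u v : dotv (- u) v = - dotv u v.
Proof. by rewrite /dotv -sumrN; apply: eq_bigr => i _; rewrite mxE mulNr. Qed.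

Lemma dotvNr u v : dotv u (- v) = - dotv u v.
Proof. by rewrite /dotv -sumrN; apply: eq_bigr => i _; rewrite mxE mulrN. Qed.

Lemma dot0v u : dotv 0 u = 0.
Proof. by rewrite /dotv big1// => i _; rewrite mxE mul0r. Qed.

Lemma dotv0 u : dotv u 0 = 0.
Proof. by rewrite /dotv big1// => i _; rewrite mxE mulr0. Qed.

End DotTheory.

Definition vspaces (R : realType) (q m : nat) : Type :=
  ('cV[R]_q * 'cV[R]_m)%type.

Definition bracket (R : realType) (q m : nat) (U : 'I_m -> 'M[R]_q)
    (x x' : 'cV[R]_q) : 'cV[R]_m :=
  \col_j dotv (U j *m x) x'.

(* Alias carrying the group structure determined by U. *)
Definition step2 (R : realType) (q m : nat) (U : 'I_m -> 'M[R]_q) : Type :=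
  vspaces R q m.

Section Step2Group.
Context {R : realType} {q m : nat} (U : 'I_m -> 'M[R]_q).
Local Notation G := (step2 U).

HB.instance Definition _ := Choice.on G.

Definition step2_one : G := (0, 0).

Definition step2_mul (g h : G) : G :=
  (g.1 + h.1, g.2 + h.2 + 2^-1 *: bracket U g.1 h.1).

Definition step2_inv (g : G) : G :=
  (- g.1, - g.2 + 2^-1 *: bracket U g.1 g.1).

Lemma step2_mulA : associative step2_mul.
Proof.
move=> [x t] [y s] [z r]; rewrite /step2_mul /=; congr pair.
  by rewrite addrA.
apply/matrixP => i j; rewrite !mxE mulmxDr dotvDl dotvDr; ring.
Qed.

Lemma step2_mul1 : left_id step2_one step2_mul.
Proof.
move=> [x t]; rewrite /step2_mul /= !add0r; congr pair.
by apply/matrixP => i j; rewrite !mxE mulmx0 dot0v mulr0 addr0.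
Qed.

Lemma step2_1mul : right_id step2_one step2_mul.
Proof.
move=> [x t]; rewrite /step2_mul /= !addr0; congr pair.
by apply/matrixP => i j; rewrite !mxE dotv0 mulr0 addr0.
Qed.

Lemma step2_mulV : left_inverse step2_one step2_inv step2_mul.
Proof.
move=> [x t]; rewrite /step2_mul /= addNr; congr pair.
apply/matrixP => i j; rewrite !mxE mulmxN dotvNl mulrN.
by rewrite addrAC addrK addNr.
Qed.

Lemma step2_Vmul : right_inverse step2_one step2_inv step2_mul.
Proof.
move=> [x t]; rewrite /step2_mul /= addrN; congr pair.
apply/matrixP => i j; rewrite !mxE dotvNr mulrN.
by rewrite addrA addrN add0r addrN.
Qed.

HB.instance Definition _ := isGroup.Build G
  step2_mulA step2_mul1 step2_1mul step2_mulV step2_Vmul.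

Lemma step2E (g h : G) : [/\ 1%g = (0, 0) :> G,
  (g * h)%g = (g.1 + h.1, g.2 + h.2 + 2^-1 *: bracket U g.1 h.1) &
  (g^-1)%g = (- g.1, - g.2 + 2^-1 *: bracket U g.1 g.1)].
Proof. by []. Qed.

End Step2Group.

(* n-dimensional Lebesgue measure, as the n-fold product of the one-dimensional
   one; [lebesgue_tuple_measure] shows that it is a sigma-finite measure. *)
Fixpoint lebesgue_tuple (R : realType) (n : nat) :
    set (n.-tuple (measurableTypeR R)) -> \bar R :=
  match n with
  | 0 => \d_[tuple]
  | n'.+1 => pushforward (lebesgue_measure \x @lebesgue_tuple R n')%E
      (fun p : measurableTypeR R * n'.-tuple (measurableTypeR R) =>
         [tuple of p.1 :: p.2])
  end.

Lemma sigma_finite_pushforward_prod d1 d2 d3 (T1 : measurableType d1)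
    (T2 : measurableType d2) (T3 : measurableType d3) (R : realType)
    (m1 : {sigma_finite_measure set T1 -> \bar R})
    (m2 : {sigma_finite_measure set T2 -> \bar R})
    (f : T1 * T2 -> T3) (g : T3 -> T1 * T2) :
  measurable_fun setT f -> measurable_fun setT g -> cancel f g ->
  exists nu : {sigma_finite_measure set T3 -> \bar R},
    nu = pushforward (m1 \x m2)%E f :> (set _ -> \bar R).
Proof.
move=> mf mg fK.
pose nu : {measure set T3 -> \bar R} :=
  measure_function_pushforward__canonical__measure_function_Measure
    (m1 \x m2)%E mf.
have sf : sigma_finite setT nu.
  have /sigma_finiteP[F [FT ndF Foo]] := sigma_finiteT m1.
  have /sigma_finiteP[G [GT ndG Goo]] := sigma_finiteT m2.
  exists (fun n => g @^-1` (F n `*` G n)) => [|n].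
    rewrite -preimage_bigcup -[LHS](preimage_setT g); congr (_ @^-1` _).
    rewrite -setXTT FT GT predeqE => -[x y]; split.
      move=> [/= [n _ Fnx] [k _ Gky]]; exists (maxn n k) => //; split.
      - by move: x Fnx; exact/subsetPset/ndF/leq_maxl.
      - by move: y Gky; exact/subsetPset/ndG/leq_maxr.
    by move=> [n _ []/= ? ?]; split; exists n.
  have [? ?] := Foo n; have [? ?] := Goo n; split.
    by rewrite -[X in measurable X]setTI; apply: mg => //; exact: measurableX.
  rewrite /= /pushforward -comp_preimage (funext fK : g \o f = id) preimage_id.
  by rewrite product_measure1E// lte_mul_pinfty// ge0_fin_numE.
pose H := Measure_isSigmaFinite.Build _ _ _ nu sf.
by exists (HB.pack_for {sigma_finite_measure set T3 -> \bar R}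
  (nu : set T3 -> \bar R) (Measure.class nu) H).
Qed.

Lemma lebesgue_tuple_measure (R : realType) (n : nat) :
  exists mu : {sigma_finite_measure set (n.-tuple (measurableTypeR R)) -> \bar R},
    mu = @lebesgue_tuple R n :> (set _ -> \bar R).
Proof.
pose T := measurableTypeR R; elim: n => [|n [mu muE]].
  by exists (\d_([tuple] : 0.-tuple T) : {sigma_finite_measure set _ -> \bar R}).
pose f (p : T * n.-tuple T) := [tuple of p.1 :: p.2] : n.+1.-tuple T.
pose g (u : n.+1.-tuple T) := (thead u, [tuple of behead u] : n.-tuple T).
have mf : measurable_fun setT f by exact: measurable_cons.
have mg : measurable_fun setT g.
  by apply/measurable_fun_pairP; split; [exact: measurable_tnth|exact: measurable_behead].
have fK : cancel f g.
  by move=> [x u]; rewrite /f /g theadE; congr pair; exact: val_inj.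
have [nu nuE] := sigma_finite_pushforward_prod lebesgue_measure mu mf mg fK.
by exists nu; rewrite nuE /= -muE.
Qed.

Definition volume (R : realType) (q m : nat) (A : set (vspaces R q m)) : \bar R :=
  lebesgue_tuple [set u : (q + m).-tuple (measurableTypeR R) |
    A (\col_i tnth u (lshift m i), \col_j tnth u (rshift q j))].

(* Homogeneous dimension Q. *)
Definition hdim (q m : nat) : nat := (q + 2 * m)%N.

Definition Nnorm (R : realType) (q m : nat) (alpha : R)
    (M1 : 'M[R]_q) (M2 : 'M[R]_m) (g : vspaces R q m) : R :=
  (enorm (M1 *m g.1) `^ alpha + enorm (M2 *m g.2) `^ (alpha / 2)) `^ alpha^-1.

Definition Nball (R : realType) (q m : nat) (alpha : R)
    (M1 : 'M[R]_q) (M2 : 'M[R]_m) (r : R) : set (vspaces R q m) :=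
  [set g | Nnorm alpha M1 M2 g <= r].

Definition lattice (R : realType) (q m : nat)
    (L1 : 'M[R]_q) (L2 : 'M[R]_m) : set (vspaces R q m) :=
  [set g | exists (k : 'cV[int]_q) (l : 'cV[int]_m),
    g = (L1 *m map_mx intr k, L2 *m map_mx intr l)].

(* [fset_set] is the actual finite set because, for alpha > 0 and invertible
   matrices, a lattice meets a ball in finitely many points. *)
Definition lattice_count (R : realType) (q m : nat) (alpha : R)
    (M1 : 'M[R]_q) (M2 : 'M[R]_m) (L1 : 'M[R]_q) (L2 : 'M[R]_m) (r : R) : nat :=
  #|` fset_set (lattice L1 L2 `&` Nball alpha M1 M2 r)|.

Definition discrepancy (R : realType) (q m : nat) (alpha : R)
    (M1 : 'M[R]_q) (M2 : 'M[R]_m) (L1 : 'M[R]_q) (L2 : 'M[R]_m) (r : R) : R :=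
  let detL := `|\det (block_mx L1 0 0 L2)| in
  let main := fine (volume (Nball alpha M1 M2 1)) * r ^+ hdim q m in
  detL / main *
    `|(lattice_count alpha M1 M2 L1 L2 r)%:R - main / detL|.

(* Main.v *)
Require Import Defs.
From mathcomp Require Import finmap.
From mathcomp Require Import all_boot all_order all_algebra.
From mathcomp Require Import all_classical all_reals all_analysis.
From mathcomp Require Import measurable_realfun ring lra zify.
Import Order.TTheory GRing.Theory Num.Theory.
Import numFieldNormedType.Exports.
Local Open Scope classical_set_scope.
Local Open Scope ring_scope.

Set Implicit Arguments.
Unset Strict Implicit.
Unset Printing Implicit Defensive.

(** Slice the ball along the first layer. With [A = M1 L1] and [B = M2 L2], the lattice point
    indexed by (k, l) lies in the ball of radius r exactly when |Ak| <= r and |Bl| <= T(k), where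
    T(k) = (r^alpha - |Ak|^alpha)^(2/alpha) <= r^2 ([quasi_ball], [lattice_countE]). The count is
    thus a sum over k of ellipsoid counts in dimension m. Replacing each count by its volume costs
    O((1+T)^(m-1-g)) with g = [gain m] ([fiber_count]), hence O(r^(Q-2-2g)) after summation over k.
    What is left is a constant times the sum over k of the radial profile (r^alpha -
    |Ak|^alpha)^(2m/alpha), cut off at |Ak| = r. Its integral is the main term, and sum and integral
    differ by O(r^(Q-3/2-alpha)) ([prof_riemann]). For alpha <= 1 both savings, 2+2g and 3/2+alpha,
    reach the required exponent ([exponent_bounds]).

    Sums are compared with integrals without Fourier analysis ([riemann_sum]): the average over y in
    the unit cube of the normalized fourth difference of f at k with step y, summed over k, equals
    the sum of f minus its integral. Pointwise bounds on fourth differences therefore suffice. For a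
    radial function mu(|Az|^2) these come from the second and third derivatives of mu
    ([radial_diff]); in both applications mu' is a constant times t^a (X - t^e)^b.

    The ellipsoid count in dimension n+1 >= 3 ([ellipsoid_count]) is a second moment argument. Over
    translations y in the unit cube, the variance of the number of lattice points in the translated
    ellipsoid is at most the lattice sum of the autocorrelation [psi] minus its integral
    ([second_moment]). Since [psi] is an explicit lens volume, [psi_riemann] bounds this by
    O(T^(2n-1)). A large discrepancy at radius T persists, at a slightly changed radius, for all
    translations in a box of side 2h, so Chebyshev bounds it; 2h = T^(-1/(n+3)) balances the two
    losses and gives O(T^(n-1/(n+3))). *)

(** * Lebesgue integration on column vectors and the affine change of variables *)

Section LebesgueIntegral.
Context {R : realType}.
Local Notation tR n := (n.-tuple (measurableTypeR R)).
Local Notation leb := (@lebesgue_measure R).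

(** [lebesgue_tuple] is a bare set function; [mu] picks a sigma-finite measure equal to it, so that
    integrals and Tonelli apply. *)
Definition mu n : {sigma_finite_measure set (tR n) -> \bar R} :=
  sval (cid (lebesgue_tuple_measure R n)).

Lemma muE n : mu n = @lebesgue_tuple R n :> (set _ -> \bar R).
Proof. exact: (svalP (cid (lebesgue_tuple_measure R n))). Qed.

Definition vec n (u : tR n) : 'cV[R]_n := \col_i tnth u i.
Definition tup n (x : 'cV[R]_n) : tR n := [tuple x i 0 | i < n].

Lemma tupK n : cancel (@tup n) (@vec n).
Proof. by move=> x; apply/colP => i; rewrite mxE tnth_mktuple. Qed.

Lemma vecK n : cancel (@vec n) (@tup n).
Proof. by move=> u; apply: eq_from_tnth => i; rewrite tnth_mktuple mxE. Qed.

(** The measure lives on tuples, so measurability into column vectors is stated coordinatewise, and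
    out of them ([mfv]) after transport by [vec]. *)
Definition mcv d (T : measurableType d) p (g : T -> 'cV[R]_p) :=
  forall i, measurable_fun setT (fun t => g t i 0).

Definition mfv p d' (T' : measurableType d') (f : 'cV[R]_p -> T') :=
  measurable_fun setT (f \o @vec p).

Lemma mfv_comp d (T : measurableType d) p d' (T' : measurableType d')
    (f : 'cV[R]_p -> T') (g : T -> 'cV[R]_p) :
  mfv f -> mcv g -> measurable_fun setT (f \o g).
Proof.
move=> mf mg.
rewrite (_ : f \o g = (f \o @vec p) \o (@tup p \o g)); last first.
  by apply/funext => t /=; rewrite tupK.
apply: measurableT_comp => //; apply/measurable_fun_tnthP => i.
rewrite (_ : _ \o _ = fun t => g t i 0); first exact: mg.
by apply/funext => t /=; rewrite tnth_mktuple.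
Qed.

Lemma mcv_vec n : mcv (@vec n).
Proof.
move=> i; rewrite (_ : (fun _ => _) = @tnth _ _ ^~ i); first exact: measurable_tnth.
by apply/funext => u; rewrite mxE.
Qed.

Lemma mcv_cst d (T : measurableType d) p (c : 'cV[R]_p) : mcv (fun _ : T => c).
Proof. by move=> i; exact: measurable_cst. Qed.

Lemma mcvD d (T : measurableType d) p (g h : T -> 'cV[R]_p) :
  mcv g -> mcv h -> mcv (fun t => g t + h t).
Proof.
move=> mg mh i; rewrite (_ : (fun _ => _) = (fun t => g t i 0) \+ (fun t => h t i 0)).
  exact: measurable_funD (mg i) (mh i).
by apply/funext => t; rewrite mxE.
Qed.

Lemma mcvM d (T : measurableType d) p p' (S : 'M[R]_(p, p')) (g : T -> 'cV[R]_p') :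
  mcv g -> mcv (fun t => S *m g t).
Proof.
move=> mg i; under eq_fun do rewrite mxE.
by apply: measurable_sum => j; apply: measurable_funM => //; exact: measurable_cst.
Qed.

Lemma mcv_comp d (T : measurableType d) d' (T' : measurableType d') p
    (g : T -> 'cV[R]_p) (h : T' -> T) :
  mcv g -> measurable_fun setT h -> mcv (g \o h).
Proof. by move=> mg mh i; exact: (measurableT_comp (mg i)). Qed.

Lemma mcv_col d (T : measurableType d) p p' (g : T -> 'cV[R]_p) (h : T -> 'cV[R]_p') :
  mcv g -> mcv h -> mcv (fun t => col_mx (g t) (h t)).
Proof.
move=> mg mh i; under eq_fun do rewrite mxE.
by case: (fintype.split i) => j; [exact: mg | exact: mh].
Qed.

Lemma mcv_scalar d (T : measurableType d) (g : T -> R) :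
  measurable_fun setT g -> mcv (fun t => (g t)%:M : 'cV[R]_1).
Proof. by move=> mg i; under eq_fun do rewrite !ord1 mxE eqxx mulr1n. Qed.

Lemma mfv_affine p p' d' (T' : measurableType d') (f : 'cV[R]_p -> T')
    (S : 'M[R]_(p, p')) (c : 'cV[R]_p) :
  mfv f -> mfv (fun v => f (S *m v + c)).
Proof.
move=> mf; apply: (mfv_comp mf (g := fun u => S *m vec u + c)).
by apply: mcvD; [apply: mcvM; exact: mcv_vec | exact: mcv_cst].
Qed.

Definition Int n (f : 'cV[R]_n -> \bar R) : \bar R := \int[mu n]_u f (vec u).

Lemma vec_cons n x (u : tR n) :
  vec [tuple of x :: u] = col_mx (x%:M) (vec u) :> 'cV[R]_(1 + n).
Proof.
apply/colP => i; rewrite !mxE; case: splitP => j.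
  by rewrite ord1 mxE eqxx mulr1n => i0; rewrite (_ : i = ord0) //; exact: val_inj.
move=> ij; rewrite mxE (_ : i = lift ord0 j) ?tnthS //.
by apply: val_inj; rewrite /= ij.
Qed.

Lemma mfv_consr n (f : 'cV[R]_(1 + n) -> \bar R) x :
  mfv f -> mfv (fun v : 'cV[R]_n => f (col_mx x%:M v)).
Proof.
move=> mf; apply: (mfv_comp mf (g := fun u : tR n => col_mx x%:M (vec u))).
by apply: mcv_col; [exact: mcv_cst | exact: mcv_vec].
Qed.

Lemma mfv_consl n (f : 'cV[R]_(1 + n) -> \bar R) v :
  mfv f -> measurable_fun setT (fun x : measurableTypeR R => f (col_mx x%:M v)).
Proof.
move=> mf; apply: (mfv_comp mf (g := fun x : measurableTypeR R => col_mx x%:M v)).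
by apply: mcv_col; [apply: mcv_scalar; exact: measurable_id | exact: mcv_cst].
Qed.

(** Tonelli for the product measure from which [lebesgue_tuple] is built recursively. It allows
    inductions on the dimension. *)
Lemma Int_cons n (f : 'cV[R]_(1 + n) -> \bar R) :
  mfv f -> (forall x, 0 <= f x)%E ->
  Int f = (\int[leb]_x Int (fun v => f (col_mx x%:M v)))%E.
Proof.
move=> mf f0; rewrite /Int.
pose phi (p : measurableTypeR R * tR n) : tR n.+1 := [tuple of p.1 :: p.2].
have mphi : measurable_fun setT phi by exact: measurable_cons.
transitivity (\int[pushforward (leb \x mu n)%E phi]_u f (vec u))%E.
  apply: eq_measure_integral => A mA _.
  transitivity (@lebesgue_tuple R n.+1 A); first exact: (f_equal (@^~ A) (muE n.+1)).
  by rewrite /= -muE.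
rewrite ge0_integral_pushforward //= preimage_setT.
have mfphi := measurableT_comp mf mphi.
have h := @fubini_tonelli1 _ _ _ _ R leb (mu n) _ mfphi (fun p => f0 _).
apply: (etrans h).
apply: eq_integral => x _; apply: eq_integral => u _.
by rewrite /phi /= vec_cons.
Qed.

Lemma Int_cons_swap n (f : 'cV[R]_(1 + n) -> \bar R) :
  mfv f -> (forall x, 0 <= f x)%E ->
  Int f = Int (fun v => \int[leb]_x f (col_mx x%:M v))%E.
Proof.
move=> mf f0; rewrite Int_cons //.
apply: (fubini_tonelli (fun z : measurableTypeR R * tR n => f (col_mx z.1%:M (vec z.2)))) => //.
apply: (mfv_comp mf (g := fun z : measurableTypeR R * tR n => col_mx z.1%:M (vec z.2))).
apply: mcv_col; first by apply: mcv_scalar.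
exact: (mcv_comp (@mcv_vec n)).
Qed.

Lemma mInt_cons n (f : 'cV[R]_(1 + n) -> \bar R) :
  mfv f -> (forall x, 0 <= f x)%E ->
  measurable_fun setT (fun x : measurableTypeR R => Int (fun v => f (col_mx x%:M v))).
Proof.
move=> mf f0.
apply: (measurable_fun_fubini_tonelli_F
  (fun z : measurableTypeR R * tR n => f (col_mx z.1%:M (vec z.2)))) => //.
apply: (mfv_comp mf (g := fun z : measurableTypeR R * tR n => col_mx z.1%:M (vec z.2))).
apply: mcv_col; first by apply: mcv_scalar.
exact: (mcv_comp (@mcv_vec n)).
Qed.

Lemma mInt_cons_swap n (f : 'cV[R]_(1 + n) -> \bar R) :
  mfv f -> (forall x, 0 <= f x)%E ->
  mfv (fun v : 'cV[R]_n => \int[leb]_x f (col_mx x%:M v))%E.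
Proof.
move=> mf f0.
apply: (measurable_fun_fubini_tonelli_G
  (fun z : measurableTypeR R * tR n => f (col_mx z.1%:M (vec z.2)))) => //.
apply: (mfv_comp mf (g := fun z : measurableTypeR R * tR n => col_mx z.1%:M (vec z.2))).
apply: mcv_col; first by apply: mcv_scalar.
exact: (mcv_comp (@mcv_vec n)).
Qed.

Lemma Int_ge0 n (f : 'cV[R]_n -> \bar R) : (forall x, 0 <= f x)%E -> (0 <= Int f)%E.
Proof. by move=> f0; exact: integral_ge0. Qed.

Lemma Int0dim (f : 'cV[R]_0 -> \bar R) : mfv f -> (forall x, 0 <= f x)%E -> Int f = f 0.
Proof.
move=> mf f0; rewrite /Int.
transitivity (\int[\d_([tuple] : tR 0)]_u f (vec u))%E.
  apply: eq_measure_integral => A mA _; exact: (f_equal (@^~ A) (muE 0)).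
rewrite integral_dirac //; last first.
rewrite diracT mul1e; congr f; apply/colP; by case.
Qed.

(** |a| times the image of Lebesgue measure under x -> a x + c agrees with Lebesgue measure on
    half-open intervals, hence everywhere. A negative a moves the closed end to the other side,
    hence the two cases. *)
Lemma leb_affine (f : R -> \bar R) (a c : R) : a != 0 ->
  measurable_fun setT f -> (forall x, 0 <= f x)%E ->
  (\int[leb]_x f (a * x + c)%R = (`|a|^-1)%:E * \int[leb]_x f x)%E.
Proof.
move=> a0 mf f0.
pose phi (x : measurableTypeR R) : measurableTypeR R := a * x + c.
have mphi : measurable_fun setT phi.
  apply: (@measurable_funD _ _ _ setT (fun x => a * x) (fun=> c)); last exact: measurable_cst.
  exact: (@measurable_funM _ _ _ setT (fun=> a) id).
have ge0a : 0 <= `|a| by [].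
pose pf : {measure set (measurableTypeR R) -> \bar R} :=
  measure_function_pushforward__canonical__measure_function_Measure leb mphi.
pose nu : {measure set (measurableTypeR R) -> \bar R} := mscale (NngNum ge0a) pf.
have nuE A : measurable A -> leb A = nu A.
  apply: lebesgue_measure_unique => _ [[x y]] _ <-.
  rewrite /nu /= /mscale /= /pushforward.
  have [agt|alt|aeq] := ltgtP a 0; last by rewrite aeq eqxx in a0.
    rewrite (_ : phi @^-1` _ = `[(y - c) / a, (x - c) / a[%classic); last first.
      apply/seteqP; split => z /=; rewrite !in_itv /= /phi.
        move=> /andP[h1 h2]; apply/andP; split.
          by rewrite ler_ndivrMr // mulrC lerBrDr.
        by rewrite ltr_ndivlMr // mulrC ltrBlDr.
      rewrite ler_ndivrMr // ltr_ndivlMr // => /andP[h1 h2]; apply/andP; split.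
        by rewrite mulrC -ltrBlDr.
      by rewrite mulrC -lerBrDr.
    rewrite !lebesgue_measure_itv /= !lte_fin.
    rewrite ltr_ndivrMr // divfK // ltrD2r; case: ifP => _; last by rewrite mule0.
    rewrite -!EFinB -EFinM; congr EFin; rewrite ltr0_norm //; field.
    exact: a0.
  rewrite (_ : phi @^-1` _ = `](x - c) / a, (y - c) / a]%classic); last first.
    apply/seteqP; split => z /=; rewrite !in_itv /= /phi.
      move=> /andP[h1 h2]; apply/andP; split.
        by rewrite ltr_pdivrMr // mulrC ltrBlDr.
      by rewrite ler_pdivlMr // mulrC lerBrDr.
    rewrite ltr_pdivrMr // ler_pdivlMr // => /andP[h1 h2]; apply/andP; split.
      by rewrite mulrC -ltrBlDr.
    by rewrite mulrC -lerBrDr.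
  rewrite !lebesgue_measure_itv /= !lte_fin.
  rewrite ltr_pdivrMr // divfK // ltrD2r; case: ifP => _; last by rewrite mule0.
  rewrite -!EFinB -EFinM; congr EFin; rewrite gtr0_norm //; field.
  exact: a0.
have -> : (\int[leb]_x f x = \int[nu]_x f x)%E.
  by apply: eq_measure_integral => A mA _; exact: nuE.
rewrite ge0_integral_mscale //= /pf ge0_integral_pushforward //= preimage_setT.
by rewrite muleA -EFinM mulVf ?normr_eq0 // mul1e.
Qed.

(** For an upper triangular block matrix the first coordinate is integrated first: with v fixed it
    undergoes x -> a x + constant. The lower triangular case below uses the opposite order. *)
Lemma Int_cons_affine_r n (f : 'cV[R]_(1 + n) -> \bar R) (a : R) (b : 'rV[R]_n) c c' D :
  a != 0 ->
  (forall g : 'cV[R]_n -> \bar R, mfv g -> (forall x, 0 <= g x)%E ->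
     Int (fun v => g (D *m v + c')%R) = ((`|\det D|^-1)%:E * Int g)%E) ->
  mfv f -> (forall x, 0 <= f x)%E ->
  Int (fun v : 'cV[R]_(1 + n) => f (block_mx a%:M b 0 D *m v + col_mx c%:M c')%R) =
  ((`|a * \det D|^-1)%:E * Int f)%E.
Proof.
move=> a0 HD mf f0.
have E x v : block_mx a%:M b 0 D *m col_mx x%:M v + col_mx c%:M c' =
   col_mx (a * x + ((b *m v) 0 0 + c))%:M (D *m v + c').
  rewrite mul_block_col mul0mx add0r add_col_mx; congr col_mx.
  by rewrite {1}[b *m v]mx11_scalar -scalar_mxM -!raddfD /= addrA.
rewrite Int_cons_swap //; last exact: mfv_affine.
under [X in Int X]funext => v.
  under eq_integral do rewrite E.
  rewrite (leb_affine (f := fun y => f (col_mx y%:M (D *m v + c')))) //; last exact: mfv_consl.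
  over.
pose h (v : 'cV[R]_n) := ((`|a|^-1)%:E * \int[leb]_x f (col_mx x%:M v))%E.
rewrite (HD h); last 2 first.
- by apply: measurable_funeM; exact: mInt_cons_swap.
- move=> x; apply: mule_ge0; first by rewrite lee_fin invr_ge0.
  by apply: integral_ge0 => y _.
rewrite /h /Int ge0_integralZl //; last 2 first.
- exact: mInt_cons_swap.
- by move=> x _; apply: integral_ge0 => y _.
rewrite muleA -EFinM normrM invfM mulrC; congr (_ * _)%E.
by rewrite -/(Int f) Int_cons_swap.
Qed.

Lemma Int_cons_affine_l n (f : 'cV[R]_(1 + n) -> \bar R) (a : R) (b : 'cV[R]_n) c c' D :
  a != 0 ->
  (forall (g : 'cV[R]_n -> \bar R) d, mfv g -> (forall x, 0 <= g x)%E ->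
     Int (fun v => g (D *m v + d)%R) = ((`|\det D|^-1)%:E * Int g)%E) ->
  mfv f -> (forall x, 0 <= f x)%E ->
  Int (fun v : 'cV[R]_(1 + n) => f (block_mx a%:M 0 b D *m v + col_mx c%:M c')%R) =
  ((`|a * \det D|^-1)%:E * Int f)%E.
Proof.
move=> a0 HD mf f0.
have E x v : block_mx a%:M 0 b D *m col_mx x%:M v + col_mx c%:M c' =
   col_mx (a * x + c)%:M (D *m v + (b *m x%:M + c')).
  rewrite mul_block_col mul0mx addr0 add_col_mx; congr col_mx.
    by rewrite -scalar_mxM -!raddfD.
  by rewrite addrA (addrC (b *m _)).
rewrite Int_cons //; last exact: mfv_affine.
under eq_integral => x _.
  under [X in Int X]funext => v do rewrite E.
  rewrite (HD (fun w => f (col_mx (a * x + c)%:M w))) //; last exact: mfv_consr.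
  over.
rewrite ge0_integralZl //=; last 2 first.
- apply: (@measurableT_comp _ _ _ _ _ _ (fun y : measurableTypeR R => Int (fun v => f (col_mx y%:M v))) _ (fun x => a * x + c)).
    exact: mInt_cons.
  apply: (@measurable_funD _ _ _ setT (fun x => a * x) (fun=> c)); last exact: measurable_cst.
  exact: (@measurable_funM _ _ _ setT (fun=> a) id).
- by move=> x _; exact: Int_ge0.
rewrite (leb_affine (f := fun y => Int (fun v => f (col_mx y%:M v)))) //; last 2 first.
- exact: mInt_cons.
- by move=> x; exact: Int_ge0.
by rewrite muleA -EFinM normrM invfM mulrC -Int_cons.
Qed.

Lemma Int_scal n (f : 'cV[R]_n -> \bar R) k : mfv f -> (forall x, 0 <= f x)%E -> 0 <= k ->
  Int (fun v => k%:E * f v)%E = (k%:E * Int f)%E.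
Proof. by move=> mf f0 k0; rewrite /Int ge0_integralZl. Qed.

Definition affine_cov n (S : 'M[R]_n) :=
  forall (g : 'cV[R]_n -> \bar R) d, mfv g -> (forall x, 0 <= g x)%E ->
     Int (fun v => g (S *m v + d)%R) = ((`|\det S|^-1)%:E * Int g)%E.

Lemma affine_covM n (S S' : 'M[R]_n) :
  affine_cov S -> affine_cov S' -> affine_cov (S *m S').
Proof.
move=> HS HS' g d mg g0.
under [X in Int X]funext => v do rewrite -mulmxA -[_ *m v]addr0.
rewrite (HS' (fun w => g (S *m w + d))) //; last exact: mfv_affine.
by rewrite HS // muleA -EFinM det_mulmx normrM invfM mulrC.
Qed.

Lemma col_mx_scalarE n (c : 'cV[R]_(1 + n)) : c = col_mx (c 0 0)%:M (dsubmx c).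
Proof.
rewrite -[LHS]vsubmxK; congr col_mx; rewrite [usubmx c]mx11_scalar mxE.
by congr ((c _ _)%:M); apply: val_inj.
Qed.

Lemma affine_cov_u n (a : R) (b : 'rV[R]_n) D : a != 0 -> affine_cov D ->
  affine_cov (block_mx a%:M b 0 D : 'M[R]_(1 + n)).
Proof.
move=> a0 HD g d mg g0; rewrite (col_mx_scalarE d) Int_cons_affine_r //.
  by rewrite det_ublock det_scalar1.
by move=> h mh h0; exact: HD.
Qed.

Lemma affine_cov_l n (a : R) (b : 'cV[R]_n) D : a != 0 -> affine_cov D ->
  affine_cov (block_mx a%:M 0 b D : 'M[R]_(1 + n)).
Proof.
move=> a0 HD g d mg g0; rewrite (col_mx_scalarE d) Int_cons_affine_l //.
by rewrite det_lblock det_scalar1.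
Qed.

Lemma affine_cov1 n : affine_cov (1%:M : 'M[R]_n).
Proof.
elim: n => [|n IHn].
  move=> g d mg g0; rewrite det1 normr1 invr1 mul1e; congr Int.
  by apply/funext => v; congr g; apply/colP; case.
rewrite (@scalar_mx_block _ 1 n 1); apply: affine_cov_l => //; exact: oner_neq0.
Qed.

(** Gaussian elimination: with a nonzero corner entry the matrix is a product of block triangular
    factors, handled by induction on the dimension; otherwise a row operation first produces such an
    entry. *)
Lemma affine_cov_unit n (S : 'M[R]_n) : S \in unitmx -> affine_cov S.
Proof.
elim: n S => [|n IHn] S uS.
  have -> : S = 1%:M by apply/matrixP; case.
  exact: affine_cov1.
have pivot (T : 'M[R]_(1 + n)) : T 0 0 != 0 -> T \in unitmx -> affine_cov T.
  move=> a0 uT; set a := T 0 0 in a0 *.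
  have Ea : ulsubmx T = a%:M.
    by rewrite [LHS]mx11_scalar !mxE; congr ((T _ _)%:M); apply: val_inj.
  (* The Schur complement of the pivot. *)
  pose D := drsubmx T - a^-1 *: (dlsubmx T *m ursubmx T).
  have ET : T = block_mx 1%:M 0 (a^-1 *: dlsubmx T) 1%:M *m
                block_mx a%:M (ursubmx T) 0 D.
    rewrite mulmx_block !mul1mx !mul0mx !addr0.
    rewrite -[LHS]submxK Ea; congr block_mx.
      by rewrite mul_mx_scalar scalerA divff // scale1r.
    by rewrite /D -scalemxAl addrC subrK.
  have uD : D \in unitmx.
    have: T \in unitmx by [].
    rewrite {1}ET unitmx_mul => /andP[_].
    by rewrite !unitmxE det_ublock det_scalar1 unitrM => /andP[].
  rewrite ET; apply: affine_covM; last by apply: affine_cov_u => //; exact: IHn.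
  by apply: affine_cov_l; [exact: oner_neq0 | exact: affine_cov1].
have [i Si0] : exists i, S i 0 != 0.
  apply/existsP; apply: contraLR uS => /existsPn S0.
  rewrite unitmxE unitfE negbK; apply/eqP.
  rewrite (expand_det_col _ 0) big1 // => i _.
  by have := S0 i; rewrite negbK => /eqP ->; rewrite mul0r.
have [S00|S00] := eqVneq (S 0 0) 0; last exact: pivot.
have i0 : i != 0 by apply: contraNneq Si0 => ->; rewrite S00.
(* [E s] adds s times row i to row 0. [E 1] makes the corner entry nonzero and [E (-1)] undoes
   it. *)
pose e (s : R) : 'rV[R]_n := \row_j (if lift 0 j == i then s else 0).
pose E s : 'M[R]_(1 + n) := block_mx 1%:M (e s) 0 1%:M.
have EE : S = E (-1) *m (E 1 *m S).
  rewrite mulmxA mulmx_block !mul1mx !mul0mx !addr0 !mulmx1 add0r mulmx0 addr0.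
  rewrite (_ : e 1 + e (-1) = 0); first by rewrite -scalar_mx_block mul1mx.
  apply/rowP => j; rewrite !mxE; case: ifP => _; rewrite ?addr0 //.
  by rewrite subrr.
have covE s : affine_cov (E s).
  by apply: affine_cov_u; [exact: oner_neq0 | exact: affine_cov1].
have uE s : E s \in unitmx by rewrite unitmxE det_ublock !det1 mulr1 unitr1.
rewrite EE; apply: affine_covM => //; apply: pivot; last by rewrite unitmx_mul uE.
rewrite mxE big_ord_recl /= S00 mulr0 add0r.
have [j ij] : exists j, i = lift 0 j.
  by case: (unliftP 0 i) => [j ->|ei]; [exists j | rewrite ei eqxx in i0].
have Ej (k : 'I_n) : E 1 0 (lift 0 k) = (k == j)%:R.
  rewrite /E (_ : lift 0 k = rshift 1 k); last exact: val_inj.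
  rewrite (_ : (0 : 'I_n.+1) = lshift n (0 : 'I_1)); last exact: val_inj.
  rewrite block_mxEur mxE ij.
  by rewrite (inj_eq (@lift_inj _ _)); case: eqP.
rewrite (bigD1 j) //= Ej eqxx mul1r big1 ?addr0 -?ij // => k kj.
by rewrite Ej (negbTE kj) mul0r.
Qed.

Lemma Int_affine n (S : 'M[R]_n) (f : 'cV[R]_n -> \bar R) c : S \in unitmx ->
  mfv f -> (forall x, 0 <= f x)%E ->
  Int (fun v => f (S *m v + c)%R) = ((`|\det S|^-1)%:E * Int f)%E.
Proof. by move=> uS mf f0; exact: affine_cov_unit. Qed.

Lemma Int_translate n (f : 'cV[R]_n -> \bar R) c :
  mfv f -> (forall x, 0 <= f x)%E -> Int (fun v => f (v + c)%R) = Int f.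
Proof.
move=> mf f0; rewrite -[RHS]mul1e -[X in (X%:E * _)%E]invr1 -[X in (X^-1)%R]normr1.
rewrite -(det1 R n) -(affine_cov1 c) //; congr Int.
by apply/funext => v; rewrite mul1mx.
Qed.

Lemma Int_linear n (S : 'M[R]_n) (f : 'cV[R]_n -> \bar R) : S \in unitmx ->
  mfv f -> (forall x, 0 <= f x)%E ->
  Int (fun v => f (S *m v)%R) = ((`|\det S|^-1)%:E * Int f)%E.
Proof.
move=> uS mf f0; rewrite -(Int_affine 0 uS mf f0) //; congr Int.
by apply/funext => v; rewrite addr0.
Qed.

End LebesgueIntegral.

(** * The Euclidean norm and its comparison with coordinates *)

Section Euclid.
Context {R : realType}.

Lemma dotv_ge0 n (u : 'cV[R]_n) : 0 <= dotv u u.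
Proof. by apply: sumr_ge0 => i _; rewrite -expr2 sqr_ge0. Qed.

Lemma dotvC n (u v : 'cV[R]_n) : dotv u v = dotv v u.
Proof. by apply: eq_bigr => i _; rewrite mulrC. Qed.

Lemma dotvZl n c (u v : 'cV[R]_n) : dotv (c *: u) v = c * dotv u v.
Proof. by rewrite /dotv mulr_sumr; apply: eq_bigr => i _; rewrite mxE mulrA. Qed.

Lemma dotvZr n c (u v : 'cV[R]_n) : dotv u (c *: v) = c * dotv u v.
Proof. by rewrite dotvC dotvZl dotvC. Qed.

Lemma enorm_ge0 n (u : 'cV[R]_n) : 0 <= enorm u.
Proof. exact: sqrtr_ge0. Qed.

Lemma enorm_sqr n (u : 'cV[R]_n) : enorm u ^+ 2 = dotv u u.
Proof. by rewrite sqr_sqrtr // dotv_ge0. Qed.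

Lemma enorm0 n : enorm (0 : 'cV[R]_n) = 0.
Proof. by rewrite /enorm dot0v sqrtr0. Qed.

Lemma dotv_eq0 n (u : 'cV[R]_n) : dotv u u = 0 -> u = 0.
Proof.
move/eqP; rewrite psumr_eq0 => [/allP h|i _]; last by rewrite -expr2 sqr_ge0.
apply/colP => i; have := h i (mem_index_enum _).
by rewrite mulf_eq0 orbb mxE => /eqP.
Qed.

Lemma dotv_CS n (u v : 'cV[R]_n) : `|dotv u v| <= enorm u * enorm v.
Proof.
have h : (dotv u v) ^+ 2 <= dotv u u * dotv v v.
  have [v0|v0] := eqVneq (dotv v v) 0.
    by rewrite (dotv_eq0 v0) !dotv0 mulr0 expr0n.
  have vp : 0 < dotv v v by rewrite lt0r v0 dotv_ge0.
  have := dotv_ge0 (dotv v v *: u - dotv u v *: v).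
  rewrite dotvDl !dotvDr !dotvNl !dotvNr !dotvZl !dotvZr (dotvC v u) => h.
  rewrite -subr_ge0 -(pmulr_rge0 _ vp); apply: le_trans h _.
  by rewrite le_eqVlt; apply/orP; left; apply/eqP; ring.
rewrite -(@ler_pXn2r _ 2) ?nnegrE ?mulr_ge0 ?enorm_ge0 //.
by rewrite exprMn !enorm_sqr real_normK ?num_real.
Qed.

Lemma enormD n (u v : 'cV[R]_n) : enorm (u + v) <= enorm u + enorm v.
Proof.
rewrite -(@ler_pXn2r _ 2) ?nnegrE ?addr_ge0 ?enorm_ge0 //.
rewrite sqrrD !enorm_sqr dotvDl !dotvDr (dotvC v u).
have := le_trans (ler_norm _) (dotv_CS u v); lra.
Qed.

Lemma enormN n (u : 'cV[R]_n) : enorm (- u) = enorm u.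
Proof. by rewrite /enorm dotvNl dotvNr opprK. Qed.

Lemma enormB n (u v : 'cV[R]_n) : enorm (u - v) <= enorm u + enorm v.
Proof. by rewrite -(enormN v) enormD. Qed.

Lemma enorm_revB n (u v : 'cV[R]_n) : enorm u - enorm v <= enorm (u + v).
Proof. by rewrite lerBlDr -{1}(addrK v u); exact: enormB. Qed.

Lemma enormZ n c (u : 'cV[R]_n) : enorm (c *: u) = `|c| * enorm u.
Proof. by rewrite /enorm dotvZl dotvZr mulrA -expr2 sqrtrM ?sqr_ge0 // sqrtr_sqr. Qed.

Lemma coord_le_enorm n (u : 'cV[R]_n) i : `|u i 0| <= enorm u.
Proof.
rewrite -sqrtr_sqr ler_wsqrtr // /dotv (bigD1 i) //= expr2 lerDl.
by apply: sumr_ge0 => j _; rewrite -expr2 sqr_ge0.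
Qed.

Lemma enorm_le_coord n (u : 'cV[R]_n) (a : R) : 0 <= a -> (forall i, `|u i 0| <= a) ->
  enorm u <= n%:R * a.
Proof.
move=> a0 h; rewrite -(@ler_pXn2r _ 2) ?nnegrE ?mulr_ge0 ?enorm_ge0 //.
rewrite enorm_sqr /dotv.
apply: (@le_trans _ _ (\sum_(i < n) a ^+ 2)).
  by apply: ler_sum => i _; rewrite -expr2 -real_normK ?num_real // ler_pXn2r ?nnegrE.
rewrite sumr_const card_ord -[_ *+ n]mulr_natl exprMn ler_wpM2r ?sqr_ge0 //.
by rewrite -natrX ler_nat; case: (n) => // k; rewrite expnS leq_pmulr.
Qed.

Lemma mulmx_bound p n (A : 'M[R]_(p, n)) :
  exists2 C : R, 0 < C & forall (u : 'cV[R]_n) (a : R), 0 <= a -> (forall i, `|u i 0| <= a) -> enorm (A *m u) <= C * a.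
Proof.
exists (1 + p%:R * \sum_i \sum_j `|A i j|).
  by rewrite ltr_pwDl // mulr_ge0 // !sumr_ge0 // => i _; rewrite sumr_ge0.
move=> u a a0 h.
have S0 : 0 <= \sum_i \sum_j `|A i j| by rewrite sumr_ge0 // => i _; rewrite sumr_ge0.
apply: (@le_trans _ _ (p%:R * ((\sum_i \sum_j `|A i j|) * a))); last first.
  by rewrite mulrDl mul1r mulrA lerDr.
apply: enorm_le_coord => [|i]; first by rewrite mulr_ge0.
rewrite mxE; apply: le_trans (ler_norm_sum _ _ _) _.
apply: (@le_trans _ _ ((\sum_j `|A i j|) * a)).
  rewrite mulr_suml; apply: ler_sum => j _; rewrite normrM; exact: ler_wpM2l.
apply: ler_wpM2r => //; rewrite (bigD1 i) //= lerDl.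
by rewrite sumr_ge0 // => k _; rewrite sumr_ge0.
Qed.

(** This confines the integer points with |Au| <= t to a box, so that all lattice sums can be taken
    over finite lists. *)
Lemma unitmx_bound n (A : 'M[R]_n) : A \in unitmx ->
  exists2 C : R, 0 < C & forall (u : 'cV[R]_n) i, `|u i 0| <= C * enorm (A *m u).
Proof.
move=> uA; have [C C0 h] := mulmx_bound (invmx A).
exists C => // u i; apply: le_trans (coord_le_enorm _ _) _.
rewrite -{1}(mulKmx uA u); apply: h (enorm_ge0 _) _ => j.
exact: coord_le_enorm.
Qed.

End Euclid.

(** * Integrals of nonnegative real functions and Fubini for blocks of coordinates *)

Section RealInt.
Context {R : realType}.
Local Notation tR n := (n.-tuple (measurableTypeR R)).
Local Notation leb := (@lebesgue_measure R).

Definition I n (f : 'cV[R]_n -> R) : \bar R := Int (fun x => (f x)%:E).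

Lemma mfvE n (f : 'cV[R]_n -> R) : mfv f -> mfv (fun x => (f x)%:E).
Proof. by move=> mf; apply/measurable_EFinP. Qed.

Lemma mfv_cst n (c : R) : mfv (fun _ : 'cV[R]_n => c).
Proof. exact: measurable_cst. Qed.

Lemma mfvD n (f g : 'cV[R]_n -> R) : mfv f -> mfv g -> mfv (fun x => f x + g x).
Proof. by move=> mf mg; exact: measurable_funD mf mg. Qed.

Lemma mfvB n (f g : 'cV[R]_n -> R) : mfv f -> mfv g -> mfv (fun x => f x - g x).
Proof. by move=> mf mg; exact: measurable_funB mf mg. Qed.

Lemma mfvM n (f g : 'cV[R]_n -> R) : mfv f -> mfv g -> mfv (fun x => f x * g x).
Proof. by move=> mf mg; exact: measurable_funM mf mg. Qed.

Lemma mfv_sum n (J : Type) (s : seq J) (f : J -> 'cV[R]_n -> R) :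
  (forall j, mfv (f j)) -> mfv (fun x => \sum_(j <- s) f j x).
Proof. by move=> mf; apply: measurable_sum => j; exact: mf. Qed.

Lemma mfv_natb n (b : 'cV[R]_n -> bool) : mfv b -> mfv (fun x => (b x)%:R : R).
Proof.
by move=> mb; apply: (@measurableT_comp _ _ _ _ _ _ (fun c : bool => c%:R : R) _ (b \o @vec R n)).
Qed.

Lemma mfv_le n (f g : 'cV[R]_n -> R) : mfv f -> mfv g -> mfv (fun x => f x <= g x).
Proof. by move=> mf mg; exact: measurable_fun_ler mf mg. Qed.

Lemma mfv_lt n (f g : 'cV[R]_n -> R) : mfv f -> mfv g -> mfv (fun x => f x < g x).
Proof. by move=> mf mg; exact: measurable_fun_ltr mf mg. Qed.

Lemma mfv_and n (f g : 'cV[R]_n -> bool) : mfv f -> mfv g -> mfv (fun x => f x && g x).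
Proof. by move=> mf mg; exact: measurable_and mf mg. Qed.

Lemma mfv_fun n (f : 'cV[R]_n -> R) (h : R -> R) :
  measurable_fun setT h -> mfv f -> mfv (fun x => h (f x)).
Proof. by move=> mh mf; exact: measurableT_comp mh mf. Qed.

Lemma mfv_coord n (i : 'I_n) : mfv (fun x : 'cV[R]_n => x i 0).
Proof. exact: mcv_vec. Qed.

Lemma mfv_enorm n : mfv (@enorm R n).
Proof.
apply: (@mfv_fun _ (fun x => dotv x x)).
  by apply: continuous_measurable_fun; exact: sqrt_continuous.
by apply: mfv_sum => i; apply: mfvM; exact: mfv_coord.
Qed.

Lemma mfv_enorm_aff n p (A : 'M[R]_(p, n)) c : mfv (fun x => enorm (A *m x + c)).
Proof. exact: (mfv_affine A c (@mfv_enorm p)). Qed.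

Lemma mfv_enorm_mul n p (A : 'M[R]_(p, n)) : mfv (fun x => enorm (A *m x)).
Proof.
rewrite (_ : (fun _ => _) = fun x => enorm (A *m x + 0)); first exact: mfv_enorm_aff.
by apply/funext => x; rewrite addr0.
Qed.

Lemma mfv_shift n d (T : measurableType d) (f : 'cV[R]_n -> T) c :
  mfv f -> mfv (fun x => f (c + x)).
Proof.
move=> mf; rewrite (_ : (fun _ => _) = fun x => f (1%:M *m x + c)).
  exact: mfv_affine.
by apply/funext => x; rewrite mul1mx addrC.
Qed.

Lemma I_ge0 n (f : 'cV[R]_n -> R) : (forall x, 0 <= f x) -> (0 <= I f)%E.
Proof. by move=> f0; apply: Int_ge0 => x; rewrite lee_fin. Qed.

Lemma I_D n (f g : 'cV[R]_n -> R) : mfv f -> mfv g -> (forall x, 0 <= f x) ->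
  (forall x, 0 <= g x) -> I (fun x => f x + g x) = (I f + I g)%E.
Proof.
move=> mf mg f0 g0; rewrite /I /Int; under eq_integral do rewrite EFinD.
rewrite ge0_integralD //; solve [by move=> x _; rewrite lee_fin | exact: mfvE].
Qed.

Lemma I_Z n (f : 'cV[R]_n -> R) k : mfv f -> (forall x, 0 <= f x) -> 0 <= k ->
  I (fun x => k * f x) = (k%:E * I f)%E.
Proof.
by move=> mf f0 k0; rewrite -Int_scal //; exact: mfvE.
Qed.

Lemma I_le n (f g : 'cV[R]_n -> R) : mfv f -> mfv g -> (forall x, 0 <= f x) ->
  (forall x, f x <= g x) -> (I f <= I g)%E.
Proof.
move=> mf mg f0 fg.
by apply: ge0_le_integral => //; solve [by move=> x _; rewrite lee_fin | exact: mfvE].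
Qed.

Lemma I_sum n (J : Type) (s : seq J) (f : J -> 'cV[R]_n -> R) :
  (forall j, mfv (f j)) -> (forall j x, 0 <= f j x) ->
  I (fun x => \sum_(j <- s) f j x) = (\sum_(j <- s) I (f j))%E.
Proof.
move=> mf f0; rewrite /I /Int; under eq_integral do rewrite -sumEFin.
rewrite ge0_integral_sum //; first by move=> j; exact: mfvE.
by move=> j x _; rewrite lee_fin.
Qed.

Lemma I_ext n (f g : 'cV[R]_n -> R) : f =1 g -> I f = I g.
Proof. by move=> /funext ->. Qed.

Lemma I_affine n (S : 'M[R]_n) (f : 'cV[R]_n -> R) c : S \in unitmx ->
  mfv f -> (forall x, 0 <= f x) ->
  I (fun v => f (S *m v + c)) = ((`|\det S|^-1)%:E * I f)%E.
Proof.
move=> uS mf f0; rewrite -(Int_affine c uS) //; exact: mfvE.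
Qed.

Lemma I_linear n (S : 'M[R]_n) (f : 'cV[R]_n -> R) : S \in unitmx ->
  mfv f -> (forall x, 0 <= f x) ->
  I (fun v => f (S *m v)) = ((`|\det S|^-1)%:E * I f)%E.
Proof.
move=> uS mf f0; rewrite -(Int_linear uS) //; exact: mfvE.
Qed.

Lemma I_shift n (f : 'cV[R]_n -> R) c : mfv f -> (forall x, 0 <= f x) ->
  I (fun v => f (c + v)) = I f.
Proof.
move=> mf f0; rewrite -[RHS](Int_translate c) //.
- by congr Int; apply/funext => v; rewrite addrC.
- exact: mfvE.
Qed.

Lemma Int_swap p n (F : 'cV[R]_p -> 'cV[R]_n -> \bar R) :
  measurable_fun setT (fun z : tR p * tR n => F (vec z.1) (vec z.2)) ->
  (forall x y, 0 <= F x y)%E ->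
  Int (fun x => Int (F x)) = Int (fun y => Int (F ^~ y)).
Proof.
move=> mF F0.
exact: (fubini_tonelli (fun z : tR p * tR n => F (vec z.1) (vec z.2))).
Qed.

Lemma mInt_col p n (f : 'cV[R]_(p + n) -> \bar R) :
  mfv f -> (forall x, 0 <= f x)%E ->
  mfv (fun z : 'cV[R]_p => Int (fun v => f (col_mx z v))).
Proof.
move=> mf f0.
apply: (measurable_fun_fubini_tonelli_F
  (fun z : tR p * tR n => f (col_mx (vec z.1) (vec z.2)))) => //.
apply: (mfv_comp mf (g := fun z : tR p * tR n => col_mx (vec z.1) (vec z.2))).
apply: mcv_col; exact: (mcv_comp (@mcv_vec R _)).
Qed.

(** Reassociation of nested columns, which lets the induction for [Int_cat] peel off one coordinate
    of the first block. *)
Lemma col_mxA_cons p n x (y : 'cV[R]_p) (t : 'cV[R]_n) :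
  col_mx (col_mx (x%:M : 'cV[R]_1) y) t = col_mx x%:M (col_mx y t) :> 'cV[R]_(1 + p + n).
Proof.
apply/colP => i.
have [i0|] := eqVneq (val i) 0%N.
  have E : i = lshift n (lshift p (0 : 'I_1)) by apply: val_inj.
  have E' : i = lshift (p + n) (0 : 'I_1) by apply: val_inj.
  by rewrite {1}E !col_mxEu E' (@col_mxEu _ 1 (p + n)).
move=> i0.
have [ip|ip] := ltnP (val i) (1 + p).
  have jp : ((val i).-1 < p)%N by move: i0 ip; rewrite -lt0n; case: (val i).
  have [j [E E']] : exists j : 'I_p,
      i = lshift n (rshift 1 j) /\ i = rshift 1 (lshift n j) :> 'I_(1 + (p + n)).
    have hi : nat_of_ord i = (1 + (nat_of_ord i).-1)%N by move: i0 => /=; lia.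
    by exists (Ordinal jp); split; apply: val_inj; exact: hi.
  by rewrite {1}E col_mxEu col_mxEd E' (@col_mxEd _ 1 (p + n)) col_mxEu.
have jp : (val i - (1 + p) < n)%N by move: ip (ltn_ord i) => /=; lia.
have [j [E E']] : exists j : 'I_n,
    i = rshift (1 + p) j /\ i = rshift 1 (rshift p j) :> 'I_(1 + (p + n)).
  have hi : nat_of_ord i = (1 + p + (nat_of_ord i - (1 + p)))%N by move: ip => /=; lia.
  by exists (Ordinal jp); split; apply: val_inj; exact: hi.
by rewrite {1}E col_mxEd E' (@col_mxEd _ 1 (p + n)) col_mxEd.
Qed.

Lemma Int_cat p n (f : 'cV[R]_(p + n) -> \bar R) :
  mfv f -> (forall x, 0 <= f x)%E ->
  Int f = Int (fun z : 'cV[R]_p => Int (fun v => f (col_mx z v))).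
Proof.
elim: p f => [|p IHp] f mf f0.
  rewrite Int0dim; last by move=> x; exact: Int_ge0.
    congr Int; apply/funext => v; congr f; apply/colP => i.
    by rewrite -[i in RHS](_ : rshift 0 i = i) ?col_mxEd //; exact: val_inj.
  exact: mInt_col.
rewrite (Int_cons (n := p + n)) //.
rewrite (Int_cons (n := p) (f := fun z => Int (fun v => f (col_mx z v)))).
- apply: eq_integral => x _.
  have mfx : mfv (fun v : 'cV[R]_(p + n) => f (col_mx x%:M v)).
    exact: (mfv_consr (n := p + n)).
  apply: etrans (IHp _ mfx (fun v => f0 _)) _.
  congr Int; apply/funext => y; congr Int; apply/funext => t.
  by congr f; rewrite -col_mxA_cons.
- exact: (@mInt_col (1 + p)).
- by move=> x; exact: Int_ge0.
Qed.

End RealInt.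

(** * Integer points in boxes and tilings by cubes *)

Lemma eq_supp_sum (T : eqType) (V : nmodType) (s1 s2 : seq T) (g : T -> V) :
  uniq s1 -> uniq s2 -> (forall x, g x != 0 -> (x \in s1) = (x \in s2)) ->
  \sum_(x <- s1) g x = \sum_(x <- s2) g x.
Proof.
move=> u1 u2 h.
have E s : \sum_(x <- s) g x = \sum_(x <- [seq x <- s | g x != 0]) g x.
  by rewrite big_filter [RHS]big_mkcond /=; apply: eq_bigr => x _; case: eqP.
rewrite E [RHS]E; apply: perm_big; apply: uniq_perm; rewrite ?filter_uniq // => x.
by rewrite !mem_filter; case: eqP => //= /eqP /h.
Qed.

(** The integer points with coordinates in [-N, N], as a duplicate-free list. Lattice sums run over
    [bxs n N] with N large enough to contain the support, so they are finite sums. *)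
Definition bxs n (N : nat) : seq 'cV[int]_n :=
  [seq \col_i ((f i : nat)%:Z - N%:Z) | f : {ffun 'I_n -> 'I_(N.*2.+1)}].

Fact shift_bound (a N : nat) : (a < N.*2.+1)%N -> `|a%:Z - N%:Z| <= N%:Z.
Proof. lia. Qed.

Fact shift_inv (z : int) (N : nat) : `|z| <= N%:Z ->
  (absz (z + N%:Z)%R < N.*2.+1)%N /\ (absz (z + N%:Z)%R)%:Z - N%:Z = z.
Proof. lia. Qed.

Lemma mem_bxs n N (k : 'cV[int]_n) : (k \in bxs n N) = [forall i, `|k i 0| <= N%:Z].
Proof.
apply/mapP/forallP => [[f _ ->] i|h]; first by rewrite mxE; exact: shift_bound.
exists [ffun i => Ordinal (proj1 (shift_inv (h i)))]; rewrite ?mem_enum //.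
by apply/colP => i; rewrite mxE ffunE /= (proj2 (shift_inv (h i))).
Qed.

Lemma bxs_uniq n N : uniq (bxs n N).
Proof.
rewrite /bxs map_inj_uniq ?enum_uniq // => f g fg; apply/ffunP => i.
by move/colP/(_ i): fg; rewrite !mxE => /addIr [] h; exact: val_inj.
Qed.

Lemma sum_bxsN n N (V : nmodType) (g : 'cV[int]_n -> V) :
  \sum_(k <- bxs n N) g (- k) = \sum_(k <- bxs n N) g k.
Proof.
transitivity (\sum_(k <- [seq - k | k <- bxs n N]) g k); first by rewrite [RHS]big_map.
have oinj : injective (-%R : 'cV[int]_n -> 'cV[int]_n) := @oppr_inj _.
apply: perm_big; apply: uniq_perm; rewrite ?(map_inj_uniq oinj) ?bxs_uniq //.
move=> k; rewrite -{1}(opprK k) (mem_map oinj).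
by rewrite !mem_bxs; apply: eq_forallb => i; rewrite mxE normrN.
Qed.

Section Tiling.
Context {R : realType}.

Definition zpt n (k : 'cV[int]_n) : 'cV[R]_n := map_mx intr k.

Definition inbox n (a b : R) (x : 'cV[R]_n) : bool := [forall i, a <= x i 0 < b].
Definition cube n : 'cV[R]_n -> bool := inbox (- 2^-1) 2^-1.

Lemma natb_forall (J : finType) (P : pred J) :
  ([forall i, P i])%:R = \prod_i (P i)%:R :> R.
Proof.
case: (boolP [forall i, P i]) => [/forallP h|/forallPn [i Pi]].
  by rewrite big1 // => i _; rewrite h.
by rewrite (bigD1 i) //= (negbTE Pi) mul0r.
Qed.

Lemma mfv_inbox n a b : mfv (fun x : 'cV[R]_n => (inbox a b x)%:R : R).
Proof.
rewrite (_ : (fun _ => _) = fun x : 'cV[R]_n => \prod_i (a <= x i 0 < b)%R%:R); last first.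
  by apply/funext => x; rewrite natb_forall.
apply: measurable_prod => i _.
apply: (@mfv_natb _ _ (fun x : 'cV[R]_n => a <= x i 0 < b)).
by apply: mfv_and; [apply: mfv_le | apply: mfv_lt]; first [exact: mfv_coord | exact: mfv_cst].
Qed.

Lemma inbox_cons n a b x (v : 'cV[R]_n) :
  inbox a b (col_mx x%:M v : 'cV[R]_(1 + n)) = (a <= x < b) && inbox a b v.
Proof.
apply/forallP/andP => [h|[hx /forallP h] i].
  split; first by have := h (lshift n 0); rewrite col_mxEu mxE eqxx mulr1n.
  by apply/forallP => i; have := h (rshift 1 i); rewrite col_mxEd.
by rewrite mxE; case: (fintype.split i) => j //; rewrite ord1 mxE eqxx mulr1n.
Qed.

Lemma I_inbox n a b : a <= b -> I (fun x : 'cV[R]_n => (inbox a b x)%:R) = ((b - a) ^+ n)%:E.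
Proof.
move=> ab; elim: n => [|n IHn].
  rewrite /I Int0dim; last by move=> x; rewrite lee_fin.
    rewrite expr0 /inbox (_ : [forall _, _]) //; apply/forallP; by case.
  exact: (mfvE (mfv_inbox _ _)).
rewrite /I (Int_cons (n := n)); last by move=> x; rewrite lee_fin.
  transitivity (\int[@lebesgue_measure R]_x ((b - a) ^+ n * \1_(`[a, b[%classic) x)%:E)%E.
    apply: eq_integral => x _.
    rewrite (_ : \1_(`[a, b[%classic) x = (a <= x < b)%R%:R); last first.
      by rewrite indicE (_ : (x \in _) = (a <= x < b)) //; apply/idP/idP; rewrite inE /= in_itv.
    rewrite mulrC EFinM -IHn -I_Z //; last exact: mfv_inbox.
    by congr Int; apply/funext => v; rewrite inbox_cons; case: (a <= x < b); rewrite ?mul1r ?mul0r.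
  under eq_integral do rewrite EFinM.
  rewrite ge0_integralZl //; last 2 first.
  - by apply/measurable_EFinP; exact: measurable_indic.
  - by rewrite lee_fin exprn_ge0 // subr_ge0.
  rewrite integral_indic // setIT /= lebesgue_measure_itv /= lte_fin exprSr EFinM.
  congr (_ * _)%E; have [|ba|->] := ltgtP a b => //; last by rewrite subrr.
  by move: ab; rewrite leNgt ba.
exact: (mfvE (mfv_inbox _ _)).
Qed.

Lemma I_cube n : I (fun x : 'cV[R]_n => (cube x)%:R) = 1%E.
Proof.
rewrite I_inbox; last by lra.
by rewrite (_ : _ - _ = 1) ?expr1n //; field.
Qed.

(** The only contributing index is the integer part of y + 1/2 + N. *)
Lemma count_unit N (y : R) : - N%:R <= y + 2^-1 -> y + 2^-1 < N%:R + 1 ->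
  \sum_(j < N.*2.+1) (- 2^-1 <= y - ((j : nat)%:R - N%:R) < 2^-1)%R%:R = 1 :> R.
Proof.
move=> h1 h2; have h0 : 0 <= y + 2^-1 + N%:R by lra.
have /andP[] := truncn_itv h0; set k := Num.truncn _ => k1 k2.
have kN : (k < N.*2.+1)%N.
  rewrite -(ltr_nat R); apply: le_lt_trans k1 _.
  rewrite -[N.*2.+1]addn1 natrD -addnn natrD; lra.
rewrite (bigD1 (Ordinal kN)) //= big1 => [|j jk].
  rewrite addr0; move: k2; rewrite -[k.+1%:R]natr1 => k2.
  by have -> : - 2^-1 <= y - (k%:R - N%:R) < 2^-1 by apply/andP; split; lra.
case: (boolP (_ <= _ < _)) => // /andP[h3 h4]; exfalso; move/negP: jk; apply.
rewrite -val_eqE /= eqn_leq.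
have k2' : y + 2^-1 + N%:R < k%:R + 1 by rewrite natr1.
by apply/andP; split; rewrite -ltnS -(ltr_nat R) -[_.+1%:R]natr1; lra.
Qed.

(** For c = 2 the window of length 2 around x is the union of the unit windows around x - 1/2 and x
    + 1/2, each containing exactly one integer. *)
Lemma count_scaled N (c : nat) (x : R) : (0 < c <= 2)%N -> `|x| <= N%:R - 1 ->
  \sum_(j < N.*2.+1) (- 2^-1 <= c%:R^-1 * (x - ((j : nat)%:R - N%:R)) < 2^-1)%R%:R = c%:R :> R.
Proof.
move=> hc; rewrite ler_norml => /andP[x1 x2].
have [->|->] : c = 1%N \/ c = 2%N by lia.
  under eq_bigr do rewrite invr1 mul1r.
  by rewrite count_unit //; lra.
transitivity (\sum_(j < N.*2.+1) (- 2^-1 <= x + 2^-1 - ((j : nat)%:R - N%:R) < 2^-1)%R%:R +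
  \sum_(j < N.*2.+1) (- 2^-1 <= x - 2^-1 - ((j : nat)%:R - N%:R) < 2^-1)%R%:R : R); last first.
  by rewrite !count_unit //; lra.
rewrite -big_split /=; apply: eq_bigr => j _.
set t : R := j%:R - N%:R.
have E1 : (- 2^-1 <= 2^-1 * (x - t) < 2^-1) = (- 1 <= x - t < 1).
  by apply/andP/andP => -[]; split; lra.
have E2 : (- 2^-1 <= x + 2^-1 - t < 2^-1) = (- 1 <= x - t < 0).
  by apply/andP/andP => -[]; split; lra.
have E3 : (- 2^-1 <= x - 2^-1 - t < 2^-1) = (0 <= x - t < 1).
  by apply/andP/andP => -[]; split; lra.
rewrite E1 E2 E3; case: (ltP (x - t) 0) => h.
  by rewrite /= addr0 andbT (_ : x - t < 1) ?andbT //; lra.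
by rewrite /= andbF add0r (_ : -1 <= x - t) //; lra.
Qed.

Lemma count_cube n N (c : nat) (x : 'cV[R]_n) : (0 < c <= 2)%N ->
  (forall i, `|x i 0| <= N%:R - 1) ->
  \sum_(k <- bxs n N) (cube (c%:R^-1 *: (x - zpt k)))%:R = c%:R ^+ n :> R.
Proof.
move=> hc hx; rewrite /bxs big_image /=.
transitivity (\sum_(f : {ffun 'I_n -> 'I_(N.*2.+1)}) \prod_i
   (- 2^-1 <= c%:R^-1 * (x i 0 - ((f i : nat)%:R - N%:R)) < 2^-1)%R%:R : R).
  apply: eq_bigr => f _; rewrite /cube /inbox natb_forall; apply: eq_bigr => i _.
  by rewrite !mxE intrB -!pmulrn.
rewrite -(bigA_distr_bigA (fun i j => (- 2^-1 <= c%:R^-1 * (x i 0 - ((j : 'I_(N.*2.+1)) %:R - N%:R)) < 2^-1)%R%:R : R)).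
under eq_bigr do rewrite count_scaled //.
by rewrite prodr_const card_ord.
Qed.

(** Cubes of side c centred at the integer points cover space c^n times, and the substitution x = k
    + c y contributes the compensating factor c^(-n). The margin 1 in the support condition leaves
    room for cubes of side 2. *)
Lemma tiling n N (c : nat) (f : 'cV[R]_n -> R) : (0 < c <= 2)%N ->
  mfv f -> (forall x, 0 <= f x) -> (forall x, f x != 0 -> forall i, `|x i 0| <= N%:R - 1) ->
  (\sum_(k <- bxs n N) I (fun y => ((cube y)%:R * f (zpt k + c%:R *: y))%R) = I f)%E.
Proof.
move=> hc mf f0 fN.
have c0 : (c%:R : R) != 0 by rewrite pnatr_eq0; lia.
pose g k x := (cube (c%:R^-1 *: (x - zpt k)))%:R * f x.
have mg k : mfv (g k).
  apply: mfvM mf.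
  rewrite (_ : (fun _ => _) = fun x => (inbox (-2^-1) (2^-1) (c%:R^-1%:M *m x + - (c%:R^-1 *: zpt k)))%:R).
    exact: (mfv_affine _ _ (mfv_inbox _ _)).
  by apply/funext => x; rewrite mul_scalar_mx scalerBr.
have g0 k x : 0 <= g k x by rewrite mulr_ge0.
have E k : I (fun y => (cube y)%:R * f (zpt k + c%:R *: y)) = ((c%:R ^+ n)^-1%:E * I (g k))%E.
  rewrite -[(c%:R ^+ n)^-1]/((c%:R ^+ n)^-1) -[X in X^-1%:E](_ : `|\det (c%:R%:M : 'M[R]_n)| = _); last first.
    by rewrite det_scalar ger0_norm // exprn_ge0.
  rewrite -(I_affine (zpt k)) //; last by rewrite unitmxE det_scalar unitrX // unitfE.
  apply: I_ext => y; rewrite /g mul_scalar_mx addrK scalerA mulVf // scale1r.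
  by rewrite (addrC (zpt k)).
under eq_bigr do rewrite E.
rewrite -ge0_sume_distrr => [|k _]; last exact: I_ge0.
rewrite -I_sum //.
rewrite (@I_ext _ _ _ (fun x => c%:R ^+ n * f x)) => [|x].
  by rewrite I_Z // ?exprn_ge0 // muleA -EFinM mulVf ?mul1e // expf_neq0.
rewrite -mulr_suml; have [->|fx] := eqVneq (f x) 0; first by rewrite !mulr0.
by rewrite count_cube //; exact: fN.
Qed.

End Tiling.

(** * Lattice sums versus integrals through fourth differences *)

Section RiemannSum.
Context {R : realType}.

(** One sixth of the symmetric fourth difference with step y. It annihilates polynomials of degree
    at most 3 along the line, and the coefficient of f x is normalized to 1. *)
Definition fourth_diff n (f : 'cV[R]_n -> R) (x y : 'cV[R]_n) : R :=
  f x - 2 / 3 * (f (x + y) + f (x - y)) + 6^-1 * (f (x + 2 *: y) + f (x - 2 *: y)).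

Lemma mfv_aff1 n d (T : measurableType d) (f : 'cV[R]_n -> T) x c :
  mfv f -> mfv (fun y => f (x + c *: y)).
Proof.
move=> mf; rewrite (_ : (fun _ => _) = fun y => f (c%:M *m y + x)).
  exact: mfv_affine.
by apply/funext => y; rewrite mul_scalar_mx addrC.
Qed.

Lemma mfv_cube n : mfv (fun x : 'cV[R]_n => (cube x)%:R : R).
Proof. exact: mfv_inbox. Qed.

Lemma zptN n (k : 'cV[int]_n) : zpt (- k) = - zpt k :> 'cV[R]_n.
Proof. by apply/colP => i; rewrite !mxE mulrNz. Qed.

Lemma zptD n (k l : 'cV[int]_n) : zpt (k + l) = zpt k + zpt l :> 'cV[R]_n.
Proof. by apply/colP => i; rewrite !mxE mulrzDr. Qed.

(** Evenness of f and the symmetry k -> -k of the box reduce the backward translates to the forward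
    ones. *)
Lemma tilingN n N (c : nat) (f : 'cV[R]_n -> R) : (0 < c <= 2)%N ->
  mfv f -> (forall x, 0 <= f x) -> (forall x, f x != 0 -> forall i, `|x i 0| <= N%:R - 1) ->
  (forall x, f (- x) = f x) ->
  (\sum_(k <- bxs n N) I (fun y => ((cube y)%:R * f (zpt k - c%:R *: y))%R) = I f)%E.
Proof.
move=> hc mf f0 fN fe; rewrite -(@tiling _ n N c f) //.
rewrite -[RHS]sum_bxsN; apply: eq_bigr => k _; apply: I_ext => y.
by rewrite zptN -fe opprB addrC.
Qed.

(** Integrate the fourth difference at k over y in the unit cube and sum over k. By [tiling] with c
    = 1 and c = 2 each of the four translated terms contributes J, so the total is S - (4/3) J +
    (1/3) J = S - J, while the pointwise bound gives at most the sum of the weights. *)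
Lemma riemann_sum n N (f : 'cV[R]_n -> R) (w : 'cV[int]_n -> R) J :
  mfv f -> (forall x, 0 <= f x) -> (forall x, f (- x) = f x) ->
  (forall x, f x != 0 -> forall i, `|x i 0| <= N%:R - 1) ->
  (forall k, k \in bxs n N -> forall y, cube y -> `|fourth_diff f (zpt k) y| <= w k) ->
  I f = J%:E ->
  `| \sum_(k <- bxs n N) f (zpt k) - J | <= \sum_(k <- bxs n N) w k.
Proof.
move=> mf f0 fe fN hw fJ.
pose ch (y : 'cV[R]_n) : R := (cube y)%:R.
have mch : mfv ch by exact: mfv_cube.
have ch0 y : 0 <= ch y by [].
have mg x c : mfv (fun y => ch y * f (x + c *: y)) by apply: mfvM => //; exact: mfv_aff1.
have g0 x c y : 0 <= ch y * f (x + c *: y) by rewrite mulr_ge0.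
have mgs c : mfv (fun y => \sum_(k <- bxs n N) ch y * f (zpt k + c *: y)) by exact: mfv_sum.
have gs0 c y : 0 <= \sum_(k <- bxs n N) ch y * f (zpt k + c *: y) by rewrite sumr_ge0.
have T1 : I (fun y => \sum_(k <- bxs n N) ch y * f (zpt k + 1 *: y)) = J%:E.
  by rewrite I_sum // -fJ; exact: (@tiling _ n N 1).
have T2 : I (fun y => \sum_(k <- bxs n N) ch y * f (zpt k + 2 *: y)) = J%:E.
  by rewrite I_sum // -fJ; exact: (@tiling _ n N 2).
have T1' : I (fun y => \sum_(k <- bxs n N) ch y * f (zpt k + (-1) *: y)) = J%:E.
  rewrite I_sum // -fJ -(@tilingN n N 1) //; apply: eq_bigr => k _.
  by apply: I_ext => y; rewrite scaleNr.
have T2' : I (fun y => \sum_(k <- bxs n N) ch y * f (zpt k + (-2) *: y)) = J%:E.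
  rewrite I_sum // -fJ -(@tilingN n N 2) //; apply: eq_bigr => k _.
  by apply: I_ext => y; rewrite scaleNr.
set S := \sum_(k <- bxs n N) f (zpt k); set W := \sum_(k <- bxs n N) w k.
have S0 : 0 <= S by rewrite sumr_ge0.
have cube0 : cube (0 : 'cV[R]_n) by apply/forallP => i; rewrite mxE; apply/andP; split; lra.
have W0 : 0 <= W.
  by rewrite /W big_seq sumr_ge0 // => k kb; exact: le_trans (normr_ge0 _) (hw k kb 0 cube0).
have IS c : 0 <= c -> I (fun y => c * ch y) = c%:E.
  by move=> c0; rewrite I_Z // /ch I_cube mule1.
pose s c y := \sum_(k <- bxs n N) ch y * f (zpt k + c *: y).
have Ibig a b c c' : 0 <= a -> 0 <= b ->
    I (s c) = J%:E -> I (s c') = J%:E ->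
    I (fun y => a * ch y + b * (s c y + s c' y)) = (a + b * (J + J))%:E.
  move=> a0 b0 h h'.
  have E : I (fun y => s c y + s c' y) = (J + J)%:E.
    rewrite (I_D (f := s c) (g := s c')) ?h ?h' //; solve [exact: mgs | exact: gs0].
  rewrite I_D.
  - rewrite IS // I_Z //; first by rewrite E -EFinM -EFinD.
      by apply: mfvD; exact: mgs.
    by move=> y; rewrite addr_ge0 ?gs0.
  - by apply: mfvM => //; exact: mfv_cst.
  - by apply: mfvM; [exact: mfv_cst | apply: mfvD; exact: mgs].
  - by move=> y; rewrite mulr_ge0.
  - by move=> y; rewrite mulr_ge0 ?addr_ge0 ?gs0.
have mbig a b c c' : mfv (fun y => a * ch y + b * (s c y + s c' y)).
  apply: mfvD; first by apply: mfvM => //; exact: mfv_cst.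
  by apply: mfvM; [exact: mfv_cst | apply: mfvD; exact: mgs].
have key y : cube y -> `|S - 2 / 3 * (s 1 y + s (-1) y) + 6^-1 * (s 2 y + s (-2) y)| <= W.
  move=> cy; have -> : S - 2 / 3 * (s 1 y + s (-1) y) + 6^-1 * (s 2 y + s (-2) y) =
      \sum_(k <- bxs n N) fourth_diff f (zpt k) y.
    rewrite /s /ch cy -!big_split /= !mulr_sumr -sumrB -big_split /=.
    by apply: eq_bigr => k _; rewrite /fourth_diff !mul1r !scaleNr !scale1r.
  apply: le_trans (ler_norm_sum _ _ _) _.
  by rewrite /W big_seq [leRHS]big_seq; apply: ler_sum => k kb; exact: hw.
have pt (P : R -> Prop) y : (cube y -> P 1) -> (~~ cube y -> P 0) -> P (ch y).
  by rewrite /ch; case: (cube y) => h1 h2; [exact: h1 | exact: h2].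
have s0 c y : ~~ cube y -> s c y = 0.
  by move=> /negbTE cy; rewrite /s /ch cy big1 // => k _; rewrite mul0r.
(* [I] is handled for nonnegative functions only, so each one-sided estimate is stated with the
   negative terms moved to the other side. *)
have A1 : (S + 6^-1 * (J + J) <= W + 2 / 3 * (J + J)).
  rewrite -lee_fin -(@Ibig S 6^-1 2 (-2)) // -(@Ibig W (2 / 3) 1 (-1)) //.
  apply: I_le => // y; first by rewrite addr_ge0 ?mulr_ge0 ?addr_ge0 ?gs0.
  case: (boolP (cube y)) => cy.
    by have := key y cy; rewrite ler_norml /ch cy !mulr1 => /andP[h1 h2]; lra.
  by rewrite !s0 // /ch (negbTE cy) !mulr0; lra.
have A2 : (0 + 2 / 3 * (J + J) <= W + S + 6^-1 * (J + J)).
  rewrite -lee_fin -(@Ibig 0 (2 / 3) 1 (-1)) // -(@Ibig (W + S) 6^-1 2 (-2)) ?addr_ge0 //.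
  apply: I_le => // y; first by rewrite addr_ge0 ?mulr_ge0 ?addr_ge0 ?gs0.
  case: (boolP (cube y)) => cy.
    by have := key y cy; rewrite ler_norml /ch cy !mulr1 => /andP[h1 h2]; lra.
  by rewrite !s0 // /ch (negbTE cy) !mulr0; lra.
rewrite ler_norml; apply/andP; split; lra.
Qed.

(* comparison of a lattice sum with an integral *)
Lemma sum_le_I n N (f g : 'cV[R]_n -> R) :
  mfv g -> (forall x, 0 <= f x) -> (forall x, 0 <= g x) ->
  (forall x, g x != 0 -> forall i, `|x i 0| <= N%:R - 1) ->
  (forall k y, cube y -> f (zpt k) <= g (zpt k + y)) ->
  ((\sum_(k <- bxs n N) f (zpt k))%:E <= I g)%E.
Proof.
move=> mg f0 g0 gN h; rewrite -(@tiling _ n N 1 g) //.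
rewrite -sumEFin; apply: lee_sum => k _.
rewrite -[leLHS]mule1 -(I_cube n) -I_Z //; last exact: mfv_cube.
apply: I_le.
- by apply: mfvM; [exact: mfv_cst | exact: mfv_cube].
- by apply: mfvM; [exact: mfv_cube | exact: mfv_aff1].
- by move=> y; rewrite mulr_ge0.
- move=> y; rewrite scale1r mulrC; case: (boolP (cube y)) => cy; rewrite ?mul0r // !mul1r.
  exact: h.
Qed.

Lemma I_le_sum n N (f g : 'cV[R]_n -> R) :
  mfv g -> (forall x, 0 <= f x) -> (forall x, 0 <= g x) ->
  (forall x, g x != 0 -> forall i, `|x i 0| <= N%:R - 1) ->
  (forall k y, cube y -> g (zpt k + y) <= f (zpt k)) ->
  (I g <= (\sum_(k <- bxs n N) f (zpt k))%:E)%E.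
Proof.
move=> mg f0 g0 gN h; rewrite -(@tiling _ n N 1 g) //.
rewrite -sumEFin; apply: lee_sum => k _.
rewrite -[leRHS]mule1 -(I_cube n) -I_Z //; last exact: mfv_cube.
apply: I_le.
- by apply: mfvM; [exact: mfv_cube | exact: mfv_aff1].
- by apply: mfvM; [exact: mfv_cst | exact: mfv_cube].
- by move=> y; rewrite mulr_ge0.
- move=> y; rewrite scale1r mulrC; case: (boolP (cube y)) => cy; rewrite ?mulr0 // !mulr1.
  exact: h.
Qed.

End RiemannSum.

(** * Ellipsoid volumes and the lattice point count up to boundary order *)

Section Counting.
Context {R : realType}.

Lemma subXX_le (x y : R) n : 0 <= y -> y <= x ->
  x ^+ n.+1 - y ^+ n.+1 <= n.+1%:R * (x - y) * x ^+ n.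
Proof.
move=> y0 yx; elim: n => [|n IHn]; first by rewrite !expr1 expr0 mul1r mulr1.
rewrite exprS (exprS y).
have -> : x * x ^+ n.+1 - y * y ^+ n.+1 = x * (x ^+ n.+1 - y ^+ n.+1) + (x - y) * y ^+ n.+1 by ring.
have x0 := le_trans y0 yx.
have h1 : x * (x ^+ n.+1 - y ^+ n.+1) <= x * (n.+1%:R * (x - y) * x ^+ n) by rewrite ler_wpM2l.
have h2 : (x - y) * y ^+ n.+1 <= (x - y) * x ^+ n.+1.
  by rewrite ler_wpM2l ?subr_ge0 // lerXn2r.
apply: le_trans (lerD h1 h2) _; rewrite -[n.+2%:R]natr1 exprS.
by rewrite le_eqVlt; apply/orP; left; apply/eqP; ring.
Qed.

Definition ballf n p (A : 'M[R]_(p, n)) (T : R) (x : 'cV[R]_n) : R :=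
  (enorm (A *m x) <= T)%R%:R.

Lemma mfv_ballf n p (A : 'M[R]_(p, n)) T : mfv (ballf A T).
Proof. by apply: mfv_natb; apply: mfv_le; [exact: mfv_enorm_mul | exact: mfv_cst]. Qed.

Lemma ballf_ge0 n p (A : 'M[R]_(p, n)) T x : 0 <= ballf A T x.
Proof. by []. Qed.

Lemma ballf_le n p (A : 'M[R]_(p, n)) T T' x : T <= T' -> ballf A T x <= ballf A T' x.
Proof.
by rewrite /ballf ler_nat => TT'; case: (boolP (_ <= T)) => // /le_trans -> //.
Qed.

Definition bvol n (A : 'M[R]_n) : R := fine (I (ballf A 1)).

Lemma bvol_ge0 n (A : 'M[R]_n) : 0 <= bvol A.
Proof. by rewrite fine_ge0 // I_ge0. Qed.

Lemma bvolE n (A : 'M[R]_n) : A \in unitmx -> I (ballf A 1) = (bvol A)%:E.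
Proof.
move=> uA; rewrite fineK // ge0_fin_numE; last exact: I_ge0.
have [K K0 hK] := unitmx_bound uA.
have : (I (ballf A 1) <= I (fun x : 'cV[R]_n => (inbox (- K) (K + 1) x)%:R))%E.
  apply: I_le => [||//|x]; [exact: mfv_ballf | exact: mfv_inbox |].
  rewrite /ballf ler_nat; case: (boolP (_ <= 1)) => // h.
  rewrite (_ : inbox _ _ _) //; apply/forallP => i.
  have := le_trans (hK x i) (ler_wpM2l (ltW K0) h).
  by rewrite mulr1 ler_norml => /andP[h1 h2]; apply/andP; split; lra.
rewrite I_inbox; last by lra.
by move/le_lt_trans; apply; rewrite ltry.
Qed.

(** For T > 0 this is the dilation x -> x / T. Radius 0 is reached by monotonicity from small
    positive radii. *)
Lemma I_ball n (A : 'M[R]_n) T : (0 < n)%N -> A \in unitmx -> 0 <= T ->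
  I (ballf A T) = (bvol A * T ^+ n)%:E.
Proof.
move=> n0 uA; have pos (t : R) : 0 < t -> I (ballf A t) = (bvol A * t ^+ n)%:E.
  move=> t0; have tu : t \is a GRing.unit by rewrite unitfE gt_eqF.
  have ut : (t^-1%:M : 'M[R]_n) \in unitmx by rewrite unitmxE det_scalar unitrX // unitrV.
  rewrite (@I_ext _ _ _ (fun x => ballf A 1 (t^-1%:M *m x))) => [|x].
    rewrite I_linear //; last exact: mfv_ballf.
    rewrite bvolE // -EFinM det_scalar ger0_norm ?exprn_ge0 ?invr_ge0 ?(ltW t0) //.
    by rewrite -exprVn invrK mulrC.
  rewrite /ballf mul_scalar_mx -scalemxAr enormZ ger0_norm ?invr_ge0 ?(ltW t0) //.
  by rewrite ler_pdivrMl // mulr1.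
rewrite le_eqVlt => /orP[/eqP <-|]; last exact: pos.
rewrite expr0n (gtn_eqF n0) mulr0; apply/eqP; rewrite eq_le I_ge0 // andbT.
apply/lee_addgt0Pr => e e0; rewrite add0e.
(* With t <= 1 and t <= e / (bvol A + 1), the volume [bvol A * t ^+ n] is at most e; the added 1
   avoids dividing by zero. *)
pose t := Num.min 1 (e / (bvol A + 1)).
have v0 := bvol_ge0 A.
have t0 : 0 < t by rewrite lt_min ltr01 divr_gt0 //; lra.
apply: (@le_trans _ _ (I (ballf A t))).
  apply: I_le => [||//|x]; [exact: mfv_ballf | exact: mfv_ballf |].
  by apply: ballf_le; exact: ltW.
rewrite pos // lee_fin.
have tn : t ^+ n <= t.
  rewrite -[leRHS]expr1 -(prednK n0); apply: ler_wiXn2l => //; first exact: ltW.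
  by rewrite ge_min lexx.
apply: (@le_trans _ _ (bvol A * t)); first by rewrite ler_wpM2l.
have : t <= e / (bvol A + 1) by rewrite ge_min lexx orbT.
move=> ht; apply: le_trans (ler_wpM2l v0 ht) _.
rewrite mulrCA -[leRHS]mulr1 ler_wpM2l ?(ltW e0) // ler_pdivrMr; lra.
Qed.

Definition cnt n N (A : 'M[R]_n) (T : R) : R := \sum_(k <- bxs n N) ballf A T (zpt k).

Lemma cube_coord n (y : 'cV[R]_n) i : cube y -> `|y i 0| <= 1.
Proof. by move=> /forallP /(_ i) /andP[h1 h2]; rewrite ler_norml; apply/andP; split; lra. Qed.

(** Attach to each lattice point its unit cube, on which |Ay| <= c. The count then lies between the
    volumes at radii T - c and T + c. *)
Lemma cnt_trivial n (A : 'M[R]_n.+1) : A \in unitmx ->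
  exists C K : R, [/\ 0 < C, 0 < K & forall N T, 0 <= T -> K * (T + 1) <= N%:R ->
    `|cnt N A T - bvol A * T ^+ n.+1| <= C * (1 + T) ^+ n].
Proof.
move=> uA; have [K K0 hK] := unitmx_bound uA; have [c c0 hc] := mulmx_bound A.
have v0 := bvol_ge0 A.
have hcube (y : 'cV[R]_n.+1) : cube y -> enorm (A *m y) <= c.
  by move=> cy; rewrite -[leRHS]mulr1; apply: hc => // i; exact: cube_coord.
exists (bvol A * n.+1%:R * c * (1 + c) ^+ n + bvol A * (1 + c) + 1), (1 + K * (1 + c)).
split=> [||N T T0 hN].
- by rewrite ltr_wpDl // addr_ge0 // !mulr_ge0 // ?exprn_ge0; lra.
- by rewrite ltr_wpDr // mulr_ge0; lra.
have supp t x : t <= T + c -> ballf A t x != 0 -> forall i, `|x i 0| <= N%:R - 1.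
  rewrite /ballf pnatr_eq0 eqb0 negbK => tT h i; apply: le_trans (hK x i) _.
  apply: le_trans (ler_wpM2l (ltW K0) (le_trans h tT)) _.
  have : K * (T + c) <= K * ((1 + c) * (T + 1)) by rewrite ler_pM2l //; nra.
  move: hN; nra.
have T1 : 1 <= (1 + T) ^+ n by rewrite exprn_ege1 // lerDl.
have up : cnt N A T <= bvol A * (T + c) ^+ n.+1.
  rewrite -lee_fin -I_ball //; last by lra.
  apply: sum_le_I => //; first exact: mfv_ballf.
    by move=> x; apply: supp.
  move=> k y cy; rewrite /ballf ler_nat; case: (boolP (_ <= T)) => // h.
  rewrite mulmxDr (_ : enorm _ <= _) //.
  exact: le_trans (enormD _ _) (lerD h (hcube y cy)).
have up2 : cnt N A T <= bvol A * T ^+ n.+1 + bvol A * n.+1%:R * c * (1 + c) ^+ n * (1 + T) ^+ n.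
  apply: le_trans up _; rewrite -lerBlDl -mulrBr -!mulrA ler_wpM2l //.
  apply: le_trans (subXX_le _ T0 _) _; first by lra.
  rewrite addrC addKr addrC -mulrA ler_wpM2l // ler_wpM2l ?(ltW c0) //.
  rewrite -exprMn lerXn2r ?nnegrE; nra.
have dn : bvol A * T ^+ n.+1 - bvol A * (n.+1%:R * c + c) * (1 + T) ^+ n <= cnt N A T.
  (* For T < c there is no inner ball of radius T - c, but the main term itself is below the allowed
     error. *)
  have [Tc|Tc] := leP c T.
    have : bvol A * (T - c) ^+ n.+1 <= cnt N A T.
      rewrite -lee_fin -I_ball //; last by lra.
      apply: I_le_sum => //; first exact: mfv_ballf.
        by move=> x; apply: supp; lra.
      move=> k y cy; rewrite /ballf ler_nat; case: (boolP (_ <= T - c)) => // h.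
      rewrite (_ : enorm _ <= T) //.
      have := enorm_revB (A *m zpt k) (A *m y); rewrite -mulmxDr.
      by have := hcube y cy; lra.
    apply: le_trans; rewrite lerBlDr -lerBlDl -mulrBr -mulrA ler_wpM2l //.
    apply: le_trans (subXX_le _ _ _) _; [by lra|by lra|].
    rewrite opprB addrC subrK.
    have TT : T ^+ n <= (1 + T) ^+ n by rewrite lerXn2r ?nnegrE; lra.
    apply: le_trans (ler_wpM2l _ TT) _; first by rewrite mulr_ge0 // ltW.
    by rewrite ler_wpM2r //; lra.
  have : 0 <= cnt N A T by rewrite sumr_ge0.
  apply: le_trans; rewrite subr_le0 -mulrA ler_wpM2l // exprS.
  have TT : T ^+ n <= (1 + T) ^+ n by rewrite lerXn2r ?nnegrE; lra.
  apply: ler_pM => //; first exact: exprn_ge0.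
  by rewrite ler_wpDl ?(ltW Tc) // mulr_ge0 // ltW.
have cn : 1 <= (1 + c) ^+ n by rewrite exprn_ege1 // lerDl ltW.
have P1 : bvol A * n.+1%:R * c <= bvol A * n.+1%:R * c * (1 + c) ^+ n.
  by rewrite ler_peMr // !mulr_ge0 // ltW.
rewrite ler_norml; apply/andP; split.
  rewrite -subr_ge0; move: dn; rewrite -subr_ge0 => dn.
  have := @ler_wpM2r _ ((1 + T) ^+ n) _ _ _ P1; nra.
have vv : 0 <= bvol A * (1 + c) + 1 by nra.
have := mulr_ge0 vv (le_trans ler01 T1); move: up2; lra.
Qed.

End Counting.

(** * Summation over unit shells *)

Section Shells.
Context {R : realType}.

Definition nrad n (A : 'M[R]_n) (k : 'cV[int]_n) : nat := Num.truncn (enorm (A *m zpt k)).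

Lemma nrad_itv n (A : 'M[R]_n) k :
  (nrad A k)%:R <= enorm (A *m zpt k) < (nrad A k)%:R + 1.
Proof. by have := truncn_itv (enorm_ge0 (A *m zpt k)); rewrite natr1. Qed.

(** The shell lies in the ball of radius j + 1 and outside the closed ball of radius j - 1; radius j
    would already catch its inner boundary. The two volumes and the two errors of [cnt_trivial]
    differ by the order j^n. The shell j = 0 is bounded by the ball of radius 1. *)
Lemma shell_count n (A : 'M[R]_n.+1) : A \in unitmx ->
  exists C K : R, [/\ 0 < C, 0 < K & forall N (j : nat), K * (j%:R + 2) <= N%:R ->
    \sum_(k <- bxs n.+1 N) (nrad A k == j)%:R <= C * (1 + j%:R) ^+ n].
Proof.
move=> uA; have [C [K [C0 K0 hC]]] := cnt_trivial uA.
have v0 := bvol_ge0 A.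
exists (bvol A * n.+1%:R * 2 + bvol A + 2 * C * 2 ^+ n), K; split => [||N j hN] //.
  by rewrite ltr_wpDl ?mulr_gt0 ?exprn_gt0 // addr_ge0 // !mulr_ge0.
have j0 : 0 <= (j%:R : R) by [].
have h1 : cnt N A (j%:R + 1) <= bvol A * (j%:R + 1) ^+ n.+1 + C * 2 ^+ n * (1 + j%:R) ^+ n.
  have := hC N (j%:R + 1); rewrite ler_norml => /(_ _ _)/andP[||_ h]; [lra|lra|].
  rewrite -lerBlDl; apply: le_trans h _; rewrite -mulrA ler_pM2l // -exprMn.
  by rewrite lerXn2r ?nnegrE; lra.
have cn : 1 <= (1 + j%:R : R) ^+ n by rewrite exprn_ege1 // lerDl.
have e2 : 1 <= 2 ^+ n :> R by rewrite exprn_ege1 // ler1n.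
have [jz|jz] := posnP j.
  apply: (@le_trans _ _ (cnt N A (j%:R + 1))).
    apply: ler_sum => k _; rewrite /ballf ler_nat; case: eqP => // kj.
    have /andP[_] := nrad_itv A k; rewrite kj => /ltW h.
    by rewrite (_ : _ <= _).
  apply: le_trans h1 _; rewrite jz add0r !addr0 !expr1n !mulr1.
  have : 0 <= bvol A * n.+1%:R by rewrite mulr_ge0.
  have : 0 < C * 2 ^+ n by rewrite mulr_gt0 // exprn_gt0.
  by rewrite -!mulrA; nra.
have j1 : 0 <= (j%:R - 1 : R) by rewrite subr_ge0 ler1n.
have h2 : bvol A * (j%:R - 1) ^+ n.+1 - C * 2 ^+ n * (1 + j%:R) ^+ n <= cnt N A (j%:R - 1).
  have := hC N (j%:R - 1) j1; rewrite ler_norml => /(_ _)/andP[|h _]; first by nra.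
  have : C * (1 + (j%:R - 1)) ^+ n <= C * 2 ^+ n * (1 + j%:R) ^+ n.
    by rewrite -mulrA ler_pM2l // -exprMn lerXn2r ?nnegrE; lra.
  by move: h; lra.
apply: (@le_trans _ _ (cnt N A (j%:R + 1) - cnt N A (j%:R - 1))).
  rewrite /cnt -sumrB; apply: ler_sum => k _.
  have jj : (j%:R - 1 : R) <= j%:R + 1 by lra.
  case: eqP => [kj|_]; last by rewrite subr_ge0 ballf_le.
  have /andP[h3 h4] := nrad_itv A k; rewrite kj in h3 h4.
  have e1 : (enorm (A *m zpt k) <= j%:R + 1) = true by rewrite ltW.
  have e2' : (enorm (A *m zpt k) <= j%:R - 1) = false by apply/negbTE; rewrite -ltNge; lra.
  by rewrite /ballf e1 e2' subr0.
have h3 : (j%:R + 1) ^+ n.+1 - (j%:R - 1) ^+ n.+1 <= n.+1%:R * 2 * (1 + j%:R : R) ^+ n.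
  apply: le_trans (subXX_le _ j1 _) _; first by lra.
  by rewrite (addrC 1) (_ : j%:R + 1 - (j%:R - 1) = 2) //; ring.
have := ler_wpM2l v0 h3.
have : 0 <= bvol A * (1 + j%:R) ^+ n by rewrite mulr_ge0 // (le_trans ler01).
move: h1 h2; set X := (1 + j%:R) ^+ n; set Y := 2 ^+ n.
have -> : (j%:R + 1 : R) ^+ n.+1 = (j%:R + 1) ^+ n.+1 by [].
set a := (j%:R + 1) ^+ n.+1; set b := (j%:R - 1) ^+ n.+1.
move=> h1 h2 h4 h5.
have -> : (bvol A * n.+1%:R * 2 + bvol A + 2 * C * Y) * X =
  bvol A * (n.+1%:R * 2 * X) + bvol A * X + 2 * (C * Y * X) by ring.
by move: h5; rewrite mulrBr => h5; lra.
Qed.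

(** Grouping by the integer part of |Ak| turns a radially bounded lattice sum into a one-dimensional
    sum with density (1+j)^n. *)
Lemma shell_sum n (A : 'M[R]_n.+1) : A \in unitmx ->
  exists C K : R, [/\ 0 < C, 0 < K & forall N (J : nat) (w : nat -> R) (g : 'cV[int]_n.+1 -> R),
    K * (J%:R + 2) <= N%:R -> (forall j, 0 <= w j) ->
    (forall k, g k <= if (nrad A k <= J)%N then w (nrad A k) else 0) ->
    \sum_(k <- bxs n.+1 N) g k <= C * \sum_(j < J.+1) (1 + j%:R) ^+ n * w j].
Proof.
move=> uA; have [C [K [C0 K0 hC]]] := shell_count uA.
exists C, K; split=> // N J w g hN w0 hg.
apply: (@le_trans _ _ (\sum_(k <- bxs n.+1 N) \sum_(j < J.+1) (nrad A k == j)%:R * w j)).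
  apply: ler_sum => k _; apply: le_trans (hg k) _.
  case: leqP => kJ; last by rewrite sumr_ge0 // => j _; rewrite mulr_ge0.
  have kJ' : (nrad A k < J.+1)%N by [].
  rewrite (bigD1 (Ordinal kJ')) //= eqxx mul1r lerDl sumr_ge0 // => j _.
  by rewrite mulr_ge0.
rewrite exchange_big /= mulr_sumr; apply: ler_sum => j _.
rewrite -mulr_suml mulrA ler_wpM2r //; apply: hC.
apply: le_trans hN; rewrite ler_pM2l // lerD2r ler_nat -ltnS; exact: ltn_ord.
Qed.

End Shells.

(** * Derivative rules and a third order Taylor bound *)

Section Taylor.
Context {R : realType}.

Lemma isD_cst (c t : R) : is_derive t 1 (fun _ : R => c) 0.
Proof. exact: is_derive_cst. Qed.

Lemma isD_id (t : R) : is_derive t 1 (fun s : R => s) 1.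
Proof. exact: is_derive_id. Qed.

Lemma isD_D (f g : R -> R) (t a b : R) : is_derive t 1 f a -> is_derive t 1 g b ->
  is_derive t 1 (fun s => f s + g s) (a + b).
Proof. by move=> hf hg; exact: is_deriveD. Qed.

Lemma isD_B (f g : R -> R) (t a b : R) : is_derive t 1 f a -> is_derive t 1 g b ->
  is_derive t 1 (fun s => f s - g s) (a - b).
Proof. by move=> hf hg; exact: is_deriveB. Qed.

Lemma isD_M (f g : R -> R) (t a b : R) : is_derive t 1 f a -> is_derive t 1 g b ->
  is_derive t 1 (fun s => f s * g s) (f t * b + g t * a).
Proof. by move=> hf hg; exact: is_deriveM. Qed.

Lemma isD_Z (f : R -> R) (c t a : R) : is_derive t 1 f a ->
  is_derive t 1 (fun s => c * f s) (c * a).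
Proof. by move=> hf; exact: is_deriveZ. Qed.

Lemma isD_comp (f g : R -> R) (t a b : R) : is_derive (g t) 1 f a -> is_derive t 1 g b ->
  is_derive t 1 (fun s => f (g s)) (a * b).
Proof. by move=> hf hg; exact: (@is_derive1_comp _ f g t a b). Qed.

Lemma isD_eq (f : R -> R) (t a b : R) : is_derive t 1 f a -> a = b -> is_derive t 1 f b.
Proof. by move=> ? <-. Qed.

(** The derivative bound is required only within distance |x - x0| of x0. This lets remainder
    estimates that grow with the distance be integrated in [taylor3]. *)
Lemma mean_value_ineq (F F' : R -> R) (a b x0 x B : R) :
  a <= x0 <= b -> a <= x <= b ->
  (forall t, a <= t <= b -> is_derive t 1 F (F' t)) ->
  (forall t, a <= t <= b -> `|t - x0| <= `|x - x0| -> `|F' t| <= B) ->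
  `|F x - F x0| <= B * `|x - x0|.
Proof.
move=> /andP[ax0 x0b] /andP[ax xb] dF hB.
have main (y z : R) : a <= y -> y <= z -> z <= b ->
    exists2 c, y <= c <= z & F z - F y = F' c * (z - y).
  move=> ay yz zb.
  have dF' t : t \in `[y, z] -> is_derive t 1 F (F' t).
    by rewrite in_itv /= => /andP[h1 h2]; apply: dF; rewrite (le_trans ay) //= (le_trans h2).
  have dF2 t : t \in `]y, z[ -> is_derive t 1 F (F' t).
    by move=> ht; apply: dF'; move: ht; rewrite !in_itv /= => /andP[h1 h2]; rewrite !ltW.
  have cF : {within `[y, z], continuous F}.
    by apply: derivable_within_continuous => t ht; case: (dF' t ht).
  have [c hc E] := MVT_segment yz dF2 cF.
  by move: hc; rewrite in_itv /= => hc; exists c.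
have [xx|xx] := leP x0 x.
  have [c /andP[h1 h2] ->] := main x0 x ax0 xx xb.
  rewrite normrM ler_wpM2r //; apply: hB; first by rewrite (le_trans ax0) //= (le_trans h2).
  by rewrite !ger0_norm ?subr_ge0 // lerD2r.
have [c /andP[h1 h2] E] := main x x0 ax (ltW xx) x0b.
rewrite distrC E normrM (distrC x0) ler_wpM2r //; apply: hB.
  by rewrite (le_trans ax) //= (le_trans h2).
by rewrite [leLHS]ler0_norm ?subr_le0 // [leRHS]ler0_norm ?subr_le0 ?(ltW xx) // !opprB lerD2l lerN2.
Qed.

(** Three successive integrations by [mean_value_ineq], from the second derivative down to f; the
    factor 1/6 of the sharp constant is given up. *)
Lemma taylor3 (f f1 f2 f3 : R -> R) (a b x0 x M : R) :
  a <= x0 <= b -> a <= x <= b ->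
  (forall t, a <= t <= b -> is_derive t 1 f (f1 t)) ->
  (forall t, a <= t <= b -> is_derive t 1 f1 (f2 t)) ->
  (forall t, a <= t <= b -> is_derive t 1 f2 (f3 t)) ->
  (forall t, a <= t <= b -> `|f3 t| <= M) ->
  `|f x - f x0 - f1 x0 * (x - x0) - f2 x0 / 2 * (x - x0) ^+ 2| <= M * `|x - x0| ^+ 3.
Proof.
move=> hx0 hx d1 d2 d3 hM.
have M0 : 0 <= M by exact: le_trans (normr_ge0 _) (hM x0 hx0).
have b2 t : a <= t <= b -> `|f2 t - f2 x0| <= M * `|t - x0|.
  by move=> ht; apply: (mean_value_ineq hx0 ht d3) => s hs _; exact: hM.
have b1 t : a <= t <= b -> `|f1 t - f1 x0 - f2 x0 * (t - x0)| <= M * `|t - x0| ^+ 2.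
  move=> ht.
  have := @mean_value_ineq (fun s => f1 s - f2 x0 * (s - x0)) (fun s => f2 s - f2 x0)
    a b x0 t (M * `|t - x0|) hx0 ht.
  rewrite subrr mulr0 subr0 -addrA (addrC (- _)) addrA -mulrA -expr2; apply.
    move=> s hs; apply: isD_eq (isD_B (d2 s hs) (isD_Z _ (isD_B (isD_id s) (isD_cst x0 s)))) _.
    by rewrite subr0 mulr1.
  move=> s hs ss; apply: le_trans (b2 s hs) _; exact: ler_wpM2l.
have := @mean_value_ineq (fun s => f s - f1 x0 * (s - x0) - f2 x0 / 2 * (s - x0) ^+ 2)
   (fun s => f1 s - f1 x0 - f2 x0 * (s - x0)) a b x0 x (M * `|x - x0| ^+ 2) hx0 hx.
have -> : M * `|x - x0| ^+ 2 * `|x - x0| = M * `|x - x0| ^+ 3 by ring.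
have -> : f x - f1 x0 * (x - x0) - f2 x0 / 2 * (x - x0) ^+ 2 -
   (f x0 - f1 x0 * (x0 - x0) - f2 x0 / 2 * (x0 - x0) ^+ 2) =
  f x - f x0 - f1 x0 * (x - x0) - f2 x0 / 2 * (x - x0) ^+ 2 by ring.
apply.
  move=> s hs.
  have dx := isD_B (isD_id s) (isD_cst x0 s).
  have := isD_B (isD_B (d1 s hs) (isD_Z (f1 x0) dx)) (isD_Z (f2 x0 / 2) (isD_M dx dx)).
  by move=> /isD_eq; apply; field.
move=> s hs ss; apply: le_trans (b1 s hs) _; rewrite ler_wpM2l //.
by rewrite lerXn2r ?nnegrE.
Qed.

End Taylor.

(** * Fourth differences of radial functions *)

Section RadialDifferences.
Context {R : realType}.

(** Along the line |A(x+sy)|^2 = r^2 + 2sb + s^2 a. Insert this into the Taylor expansion of mu at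
    r^2: the fourth difference removes every term in s, s^2 and s^3. The s^4 term of the quadratic
    part leaves 2 a^2 mu''(r^2), and the remainder involves mu''' times (rc)^3. *)
Lemma radial_diff n p (A : 'M[R]_(p, n)) (mu G1 G2 G3 : R -> R) x y (c M : R) :
  0 < c -> enorm (A *m y) <= c -> 4 * c <= enorm (A *m x) ->
  (forall t, (enorm (A *m x) - 2 * c) ^+ 2 <= t <= (enorm (A *m x) + 2 * c) ^+ 2 ->
    [/\ is_derive t 1 mu (G1 t), is_derive t 1 G1 (G2 t), is_derive t 1 G2 (G3 t) &
        `|G3 t| <= M]) ->
  `|fourth_diff (fun z => mu (enorm (A *m z) ^+ 2)) x y| <=
    2 * c ^+ 4 * `|G2 (enorm (A *m x) ^+ 2)| + 210 * c ^+ 3 * (M * enorm (A *m x) ^+ 3).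
Proof.
move=> c0 hy hx hG.
set r := enorm (A *m x) in hx hG *.
pose b := dotv (A *m x) (A *m y); pose a := dotv (A *m y) (A *m y).
have r0 : 0 < r by lra.
have a0 : 0 <= a by exact: dotv_ge0.
have ac : a <= c ^+ 2 by rewrite /a -enorm_sqr lerXn2r ?nnegrE ?enorm_ge0 // ltW.
have bc : `|b| <= r * c.
  by apply: le_trans (dotv_CS _ _) _; rewrite ler_wpM2l // ltW.
have E (s : R) : enorm (A *m (x + s *: y)) ^+ 2 = r ^+ 2 + (2 * s * b + s ^+ 2 * a).
  rewrite /r !enorm_sqr mulmxDr -scalemxAr dotvDl !dotvDr !dotvZl !dotvZr.
  rewrite -/a (dotvC (A *m y)) -/b; ring.
have rng (s : R) : `|s| <= 2 ->
   (r - 2 * c) ^+ 2 <= r ^+ 2 + (2 * s * b + s ^+ 2 * a) <= (r + 2 * c) ^+ 2.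
  move=> s2; rewrite -E.
  have h : enorm (A *m (s *: y)) <= 2 * c.
    by rewrite -scalemxAr enormZ ler_pM // enorm_ge0.
  have := enormD (A *m x) (A *m (s *: y)); have := enorm_revB (A *m x) (A *m (s *: y)).
  rewrite -mulmxDr -/r => h1 h2.
  by apply/andP; split; rewrite lerXn2r ?nnegrE ?enorm_ge0 //; lra.
have r2 : (r - 2 * c) ^+ 2 <= r ^+ 2 <= (r + 2 * c) ^+ 2.
  by have := rng 0; rewrite normr0 !(mulr0, mul0r) expr0n mul0r !addr0; apply; lra.
have M0 : 0 <= M by case: (hG _ r2) => _ _ _; exact: le_trans (normr_ge0 _).
have T (s : R) : `|s| <= 2 ->
  `|mu (enorm (A *m (x + s *: y)) ^+ 2) - mu (r ^+ 2) - G1 (r ^+ 2) * (2 * s * b + s ^+ 2 * a)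
    - G2 (r ^+ 2) / 2 * (2 * s * b + s ^+ 2 * a) ^+ 2| <= M * (125 * (r * c) ^+ 3).
  move=> s2; rewrite E.
  have := @taylor3 _ mu G1 G2 G3 ((r - 2 * c) ^+ 2) ((r + 2 * c) ^+ 2) (r ^+ 2)
     (r ^+ 2 + (2 * s * b + s ^+ 2 * a)) M r2 (rng s s2).
  rewrite (addrC (r ^+ 2) (_ + _)) addrK => h.
  apply: le_trans (h _ _ _ _) _ => [t|t|t|t|]; try by case/hG.
  (* Since 4c <= r, the increment 2sb + s^2 a is at most 4rc + 4c^2 <= 5rc, whence 125 = 5^3. *)
  rewrite ler_wpM2l // (_ : 125 * (r * c) ^+ 3 = (5 * (r * c)) ^+ 3); last by ring.
  rewrite lerXn2r ?nnegrE //; first by nra.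
  have e1 : `|2 * s * b| = 2 * `|s| * `|b| by rewrite !normrM [ `|2| ]ger0_norm.
  have e2 : `|s ^+ 2 * a| = `|s| ^+ 2 * a by rewrite (normrM (s ^+ 2) a) normrX (ger0_norm a0).
  apply: le_trans (ler_normD _ _) _; rewrite e1 e2.
  have h1 : 2 * `|s| * `|b| <= 4 * (r * c) by have := normr_ge0 s; have := normr_ge0 b; nra.
  have h2 : `|s| ^+ 2 * a <= 4 * c ^+ 2.
    apply: ler_pM => //; rewrite (_ : 4 = 2 ^+ 2); last by ring.
    by rewrite lerXn2r ?nnegrE.
  by nra.
have T1 : `|1 : R| <= 2 by rewrite normr1; lra.
have T2 : `|2 : R| <= 2 by rewrite ger0_norm.
have T1' : `|-1 : R| <= 2 by rewrite normrN normr1; lra.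
have T2' : `|-2 : R| <= 2 by rewrite normrN ger0_norm.
move: (T _ T1) (T _ T2) (T _ T1') (T _ T2'); rewrite /fourth_diff -/r.
rewrite !scaleNr !scale1r.
set m1 := mu _ => {}T1; move: T1.
move: (G1 (r ^+ 2)) (G2 (r ^+ 2)) => g1 g2.
set m0 := mu (r ^+ 2).
set m2 := mu (enorm (A *m (x + 2 *: y)) ^+ 2).
set m3 := mu (enorm (A *m (x - y)) ^+ 2).
set m4 := mu (enorm (A *m (x - 2 *: y)) ^+ 2).
set B := M * (125 * (r * c) ^+ 3).
have B0 : 0 <= B by rewrite mulr_ge0 // mulr_ge0 // exprn_ge0 // mulr_ge0 // ltW.
(* The weights of the four translates add up to 5/3 in absolute value, and 5/3 * 125 <= 210. *)
have -> : 210 * c ^+ 3 * (M * r ^+ 3) = 210 / 125 * B by rewrite /B; field.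
have h : `|2 * g2 * a ^+ 2| <= 2 * c ^+ 4 * `|g2|.
  rewrite (normrM _ (a ^+ 2)) normrX (ger0_norm a0) (normrM 2) [ `|2| ]ger0_norm //.
  rewrite -mulrA (mulrC `|g2|) mulrA ler_wpM2r //.
  rewrite ler_wpM2l // (_ : c ^+ 4 = (c ^+ 2) ^+ 2); last by ring.
  by rewrite lerXn2r ?nnegrE // exprn_ge0 // ltW.
rewrite !ler_norml => /andP[p1 p1'] /andP[p2 p2'] /andP[p3 p3'] /andP[p4 p4'].
move: h; rewrite ler_norml => /andP[h h'].
by apply/andP; split; lra.
Qed.

(** The common shape of the first derivative of both radial functions used below, the lens volume
    and the fibre profile, as functions of t = |Az|^2. *)
Definition Pf (e X a b t : R) : R := t `^ a * (X - t `^ e) `^ b.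

Lemma Pf_ge0 e X a b t : 0 <= Pf e X a b t.
Proof. by rewrite mulr_ge0 // powR_ge0. Qed.

Lemma powRDp (t r s : R) : 0 < t -> t `^ (r + s) = t `^ r * t `^ s.
Proof. by move=> t0; rewrite powRD // (gt_eqF t0) implybT. Qed.

Lemma powR_le0 (x y s : R) : 0 < x -> x <= y -> s <= 0 -> y `^ s <= x `^ s.
Proof.
move=> x0 xy s0; have y0 := lt_le_trans x0 xy.
have [u -> u0] : exists2 u, s = - u & 0 <= u by exists (- s); rewrite ?opprK ?oppr_ge0.
rewrite !powRN lef_pV2 ?posrE ?powR_gt0 //.
by rewrite ge0_ler_powR ?nnegrE ?(ltW x0) ?(ltW y0).
Qed.

Lemma isD_Pf (e X a b t : R) : 0 < t -> t `^ e < X ->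
  is_derive t 1 (Pf e X a b) (a * Pf e X (a - 1) b t - b * e * Pf e X (a + e - 1) (b - 1) t).
Proof.
move=> t0 tX.
have d1 := is_derive1_powR a t0.
have d2 := is_derive1_powR e t0.
have d3 := isD_B (isD_cst X t) d2.
have u0 : 0 < X - t `^ e by rewrite subr_gt0.
have d4 := @isD_comp R (fun u => u `^ b) (fun s => X - s `^ e) t _ _ (is_derive1_powR b u0) d3.
apply: isD_eq (isD_M d1 d4) _.
rewrite /Pf (_ : t `^ (a + e - 1) = t `^ a * t `^ (e - 1)); first by ring.
by rewrite -addrA (@powRDp t a (e - 1)).
Qed.

(** [Pf2] and [Pf3] are the first and second derivatives of [Pf], hence up to a constant the second
    and third derivatives of mu. *)
Definition Pf2 (e X a b t : R) : R :=
  a * Pf e X (a - 1) b t - b * e * Pf e X (a + e - 1) (b - 1) t.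

Definition Pf3 (e X a b t : R) : R :=
  a * Pf2 e X (a - 1) b t - b * e * Pf2 e X (a + e - 1) (b - 1) t.

Lemma isD_Pf2 (e X a b t : R) : 0 < t -> t `^ e < X ->
  is_derive t 1 (Pf2 e X a b) (Pf3 e X a b t).
Proof. by move=> t0 tX; exact: isD_B (isD_Z _ (isD_Pf _ _ t0 tX)) (isD_Z _ (isD_Pf _ _ t0 tX)). Qed.

Lemma Pf_bound (e X a b t : R) : 0 < t -> t `^ e < X -> 0 <= b ->
  Pf e X a b t <= t `^ a * X `^ b.
Proof.
move=> t0 tX b0; rewrite ler_wpM2l ?powR_ge0 // ge0_ler_powR ?nnegrE ?subr_ge0 //.
- exact: ltW.
- by apply: le_trans (ltW tX); rewrite powR_ge0.
- by rewrite gerBl powR_ge0.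
Qed.

(** The extra factor t^e is traded for one of the b factors of X, as t^e < X. So differentiating the
    second factor costs no more than differentiating the first. *)
Lemma Pf_bound1 (e X a b t : R) : 0 < t -> t `^ e < X -> 1 <= b ->
  Pf e X (a + e) (b - 1) t <= t `^ a * X `^ b.
Proof.
move=> t0 tX b1.
have X0 : 0 < X by apply: le_lt_trans tX; rewrite powR_ge0.
apply: le_trans (Pf_bound _ t0 tX _) _; first by rewrite subr_ge0.
rewrite powRDp //.
rewrite -mulrA ler_wpM2l ?powR_ge0 // -(@mulr_powRB1 _ X b (ltW X0)); last by lra.
by rewrite ler_wpM2r ?powR_ge0 // ltW.
Qed.

(** Collects the absolute values of all coefficients in the estimates of [Pf2] and [Pf3]. *)
Definition Pfc (e a b : R) : R :=
  1 + `|a| + `|b * e| + `|a * (a - 1)| + `|a * (b * e)| + `|b * e * (a + e - 1)|.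

Lemma Pf2_bound (e X a b t : R) : 0 < t -> t `^ e < X -> 1 <= b ->
  `|Pf2 e X a b t| <= Pfc e a b * (t `^ (a - 1) * X `^ b).
Proof.
move=> t0 tX b1.
set Z := t `^ (a - 1) * X `^ b.
have Z0 : 0 <= Z by rewrite mulr_ge0 ?powR_ge0.
have h1 : Pf e X (a - 1) b t <= Z by apply: Pf_bound => //; lra.
have h2 : Pf e X (a + e - 1) (b - 1) t <= Z.
  by rewrite (_ : a + e - 1 = a - 1 + e); [exact: Pf_bound1 | ring].
apply: le_trans (ler_normB _ _) _; rewrite !(normrM _ (Pf _ _ _ _ _)).
rewrite !(ger0_norm (Pf_ge0 _ _ _ _ _)).
apply: le_trans (lerD (ler_wpM2l (normr_ge0 _) h1) (ler_wpM2l (normr_ge0 _) h2)) _.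
rewrite -mulrDl ler_wpM2r // /Pfc.
have := normr_ge0 (a * (a - 1)); have := normr_ge0 (a * (b * e)).
have := normr_ge0 (b * e * (a + e - 1)); lra.
Qed.

(** The term with exponent b - 2 is kept apart: for b < 2 it blows up as t^e approaches X and has to
    be estimated in each application. *)
Lemma Pf3_bound (e X a b t : R) : 0 < t -> t `^ e < X -> 1 <= b ->
  `|Pf3 e X a b t| <= Pfc e a b * (t `^ (a - 2) * X `^ b) +
     `|b * (b - 1)| * e ^+ 2 * Pf e X (a + e + e - 2) (b - 2) t.
Proof.
move=> t0 tX b1.
set Z := t `^ (a - 2) * X `^ b.
have Z0 : 0 <= Z by rewrite mulr_ge0 ?powR_ge0.
have h1 : Pf e X (a - 2) b t <= Z by apply: Pf_bound => //; lra.
have h2 : Pf e X (a - 2 + e) (b - 1) t <= Z by exact: Pf_bound1.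
rewrite /Pf3 /Pf2.
rewrite (_ : a - 1 - 1 = a - 2); last by ring.
rewrite (_ : a - 1 + e - 1 = a - 2 + e); last by ring.
rewrite (_ : a + e - 1 - 1 = a - 2 + e); last by ring.
rewrite (_ : a + e - 1 + e - 1 = a + e + e - 2); last by ring.
rewrite (_ : b - 1 - 1 = b - 2); last by ring.
set p1 := Pf e X (a - 2) b t in h1 *; set p2 := Pf e X (a - 2 + e) (b - 1) t in h2 *.
set p3 := Pf e X (a + e + e - 2) (b - 2) t.
have p10 : 0 <= p1 by exact: Pf_ge0.
have p20 : 0 <= p2 by exact: Pf_ge0.
have p30 : 0 <= p3 by exact: Pf_ge0.
rewrite (_ : a * ((a - 1) * p1 - b * e * p2) -
   b * e * ((a + e - 1) * p2 - (b - 1) * e * p3) =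
   a * (a - 1) * p1 - a * (b * e) * p2 - b * e * (a + e - 1) * p2 + b * (b - 1) * e ^+ 2 * p3); last by ring.
apply: le_trans (ler_normD _ _) _; apply: lerD; last first.
  by rewrite (normrM _ p3) (normrM _ (e ^+ 2)) (ger0_norm p30) [ `|e ^+ 2| ]ger0_norm ?sqr_ge0.
apply: le_trans (ler_normB _ _) _; apply: le_trans (lerD (ler_normB _ _) (lexx _)) _.
rewrite !(normrM _ p1) !(normrM _ p2) (ger0_norm p10) (ger0_norm p20).
have q1 := ler_wpM2l (normr_ge0 (a * (a - 1))) h1.
have q2 := ler_wpM2l (normr_ge0 (a * (b * e))) h2.
have q3 := ler_wpM2l (normr_ge0 (b * e * (a + e - 1))) h2.
have q4 : 0 <= (1 + `|a| + `|b * e|) * Z by rewrite mulr_ge0 // !addr_ge0.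
rewrite /Pfc; lra.
Qed.

(* [e] and [X] are such that [mu' = kappa * t `^ a * (X - t `^ e) `^ b] *)
Lemma radial_Pf_diff (e a b c : R) : 0 < c -> a <= 0 -> 1 <= b ->
  exists2 C : R, 0 < C & forall n p (A : 'M[R]_(p, n)) mu (X kappa S : R) x y,
    let r := enorm (A *m x) in
    enorm (A *m y) <= c -> 4 * c <= r -> 1 <= r ->
    (forall t, (r - 2 * c) ^+ 2 <= t <= (r + 2 * c) ^+ 2 ->
      [/\ t `^ e < X, is_derive t 1 mu (kappa * Pf e X a b t) &
          `|b * (b - 1)| * Pf e X (a + e + e - 2) (b - 2) t <= S]) ->
    `|fourth_diff (fun z => mu (enorm (A *m z) ^+ 2)) x y| <=
      C * (`|kappa| * (r `^ (2 * a - 1) * X `^ b + S * r ^+ 3)).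
Proof.
move=> c0 a0 b1.
have K0 : 0 < Pfc e a b by rewrite /Pfc !ltr_wpDr.
exists (2 * c ^+ 4 * Pfc e a b + 210 * c ^+ 3 * (Pfc e a b * 4^-1 `^ (a - 2) + e ^+ 2)).
  apply: ltr_pwDl.
    by apply: mulr_gt0 => //; apply: mulr_gt0 => //; exact: exprn_gt0.
  apply: mulr_ge0; first by apply: mulr_ge0 => //; apply: exprn_ge0; exact: ltW.
  by apply: addr_ge0; rewrite ?sqr_ge0 // mulr_ge0 ?powR_ge0 // ltW.
move=> n p A mu X kappa S x y r hy hr r1 hyp.
have r0 : 0 < r by lra.
set Q := r `^ (2 * a - 1) * X `^ b.
have X0 : 0 <= X `^ b by rewrite powR_ge0.
pose M := `|kappa| * (Pfc e a b * (4^-1 `^ (a - 2) * (r ^+ 2) `^ (a - 2) * X `^ b) + e ^+ 2 * S).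
have r2 : (r - 2 * c) ^+ 2 <= r ^+ 2 <= (r + 2 * c) ^+ 2.
  by apply/andP; split; rewrite lerXn2r ?nnegrE; lra.
have S0 : 0 <= S.
  case: (hyp _ r2) => _ _; apply: le_trans; by rewrite mulr_ge0 ?Pf_ge0.
(* As 4c <= r, the window stays above r^2 / 4; this is the source of the powers of 1/4 in the
   constant. *)
have pos t : (r - 2 * c) ^+ 2 <= t <= (r + 2 * c) ^+ 2 -> 0 < t /\ 4^-1 * r ^+ 2 <= t.
  move=> /andP[h _]; have : 4^-1 * r ^+ 2 <= (r - 2 * c) ^+ 2 by nra.
  by move=> h'; have := exprn_gt0 2 r0; lra.
have hM t : (r - 2 * c) ^+ 2 <= t <= (r + 2 * c) ^+ 2 -> `|kappa * Pf3 e X a b t| <= M.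
  move=> ht; have [t0 t1] := pos t ht; have [tX _ hS] := hyp t ht.
  rewrite normrM ler_wpM2l //; apply: le_trans (Pf3_bound _ t0 tX b1) _.
  apply: lerD; last by rewrite mulrAC (mulrC _ (e ^+ 2)) ler_wpM2l ?sqr_ge0.
  rewrite ler_wpM2l ?(ltW K0) // ler_wpM2r // -powRM ?invr_ge0 ?exprn_ge0 ?(ltW r0) //.
  by apply: powR_le0; [rewrite mulr_gt0 ?exprn_gt0 ?invr_gt0 | | lra].
apply: le_trans (@radial_diff _ _ _ mu (fun t => kappa * Pf e X a b t)
  (fun t => kappa * Pf2 e X a b t) (fun t => kappa * Pf3 e X a b t) x y c M c0 hy hr _) _.
  move=> t ht; have [t0 t1] := pos t ht; have [tX dm hS] := hyp t ht.
  split=> //; last exact: hM.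
  - by apply: isD_Z; exact: isD_Pf.
  - by apply: isD_Z; exact: isD_Pf2.
have E s : (r ^+ 2) `^ s = r `^ (2 * s) by rewrite -powR_mulrn ?(ltW r0) // -powRrM.
have Q0 : 0 <= Q by rewrite mulr_ge0 // powR_ge0.
have [tX _ _] := hyp _ r2.
have h1 : `|kappa * Pf2 e X a b (r ^+ 2)| <= `|kappa| * (Pfc e a b * Q).
  rewrite normrM ler_wpM2l //; apply: le_trans (Pf2_bound _ _ tX b1) _.
    by rewrite exprn_gt0.
  rewrite ler_wpM2l ?(ltW K0) // E /Q ler_wpM2r //.
  by rewrite ler_powR //; lra.
have h2 : M * r ^+ 3 = `|kappa| * (Pfc e a b * 4^-1 `^ (a - 2) * Q + e ^+ 2 * (S * r ^+ 3)).
  rewrite /M /Q E.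
  have -> : r `^ (2 * a - 1) = r `^ (2 * (a - 2)) * r ^+ 3.
    rewrite -powR_mulrn ?(ltW r0) // -powRDp //.
    by congr (_ `^ _); ring.
  ring.
rewrite h2.
have c40 : 0 <= 2 * c ^+ 4 by rewrite mulr_ge0 // exprn_ge0 // ltW.
apply: le_trans (lerD (ler_wpM2l c40 h1) (lexx _)) _.
have c30 : 0 <= 210 * c ^+ 3 by rewrite mulr_ge0 // exprn_ge0 // ltW.
have SR : 0 <= S * r ^+ 3 by rewrite mulr_ge0 // exprn_ge0 // ltW.
set P4 := 4^-1 `^ (a - 2).
have P40 : 0 <= P4 by rewrite powR_ge0.
rewrite -subr_ge0.
have -> : (2 * c ^+ 4 * Pfc e a b + 210 * c ^+ 3 * (Pfc e a b * P4 + e ^+ 2)) *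
   (`|kappa| * (Q + S * r ^+ 3)) - (2 * c ^+ 4 * (`|kappa| * (Pfc e a b * Q)) +
   210 * c ^+ 3 * (`|kappa| * (Pfc e a b * P4 * Q + e ^+ 2 * (S * r ^+ 3)))) =
  `|kappa| * (2 * c ^+ 4 * Pfc e a b * (S * r ^+ 3) + 210 * c ^+ 3 * (Pfc e a b * P4 * (S * r ^+ 3) + e ^+ 2 * Q)).
  by ring.
have K1 := ltW K0.
apply: mulr_ge0 => //; apply: addr_ge0; first by apply: mulr_ge0 => //; exact: mulr_ge0.
by apply: mulr_ge0 => //; apply: addr_ge0; apply: mulr_ge0 => //;
  [exact: mulr_ge0 | exact: sqr_ge0].
Qed.

End RadialDifferences.

(** * The volume of the intersection of two equal balls *)

Section Lens.
Context {R : realType}.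
Local Notation leb := (@lebesgue_measure R).

Lemma dotv_mx n (u v : 'cV[R]_n) : dotv u v = (u^T *m v) 0 0.
Proof. by rewrite mxE; apply: eq_bigr => i _; rewrite mxE. Qed.

Lemma enorm_orth n (O : 'M[R]_n) u : O^T *m O = 1%:M -> enorm (O *m u) = enorm u.
Proof.
by move=> hO; rewrite /enorm !dotv_mx trmx_mul mulmxA -(mulmxA u^T) hO mulmx1.
Qed.

Definition e0 n : 'cV[R]_(1 + n) := col_mx 1%:M 0.

Lemma dotv_e0 n (z : 'cV[R]_(1 + n)) : dotv z (e0 n) = z 0 0.
Proof.
rewrite /dotv (bigD1 0) //= big1 => [|i i0].
  rewrite addr0 /e0 (_ : (0 : 'I_(1 + n)) = lshift n (0 : 'I_1)); last exact: val_inj.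
  by rewrite col_mxEu mxE mulr1.
rewrite /e0 mxE; case: splitP => j; last by rewrite mxE mulr0.
by rewrite ord1 => ij; case/eqP: i0; exact: val_inj.
Qed.

Lemma dotv_e00 n : dotv (e0 n) (e0 n) = 1.
Proof.
rewrite dotv_e0 /e0 (_ : (0 : 'I_(1 + n)) = lshift n (0 : 'I_1)); last exact: val_inj.
by rewrite col_mxEu mxE.
Qed.

(* Householder reflection *)
Lemma rotate_e0 n (z : 'cV[R]_(1 + n)) :
  exists2 H : 'M[R]_(1 + n), H^T *m H = 1%:M & H *m z = enorm z *: e0 n.
Proof.
set r := enorm z; pose v := z - r *: e0 n.
have [vv0|vv0] := eqVneq (dotv v v) 0.
  exists 1%:M; first by rewrite trmx1 mulmx1.
  by rewrite mul1mx; apply/eqP; rewrite -subr_eq0; apply/eqP; exact: (dotv_eq0 vv0).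
pose H : 'M[R]_(1 + n) := 1%:M - (2 / dotv v v) *: (v *m v^T).
have vvv : v *m v^T *m (v *m v^T) = dotv v v *: (v *m v^T).
  rewrite mulmxA -(mulmxA v) [v^T *m v]mx11_scalar -dotv_mx.
  by rewrite mul_mx_scalar -scalemxAl.
have HT : H^T = H.
  by rewrite /H linearB linearZ /= trmx1 trmx_mul trmxK.
exists H.
  rewrite HT /H mulmxBl mul1mx mulmxBr mulmx1 -scalemxAl -scalemxAr vvv !scalerA.
  move: (v *m v^T) vv0 => W vv0; apply/matrixP => i j; rewrite !mxE.
  by field.
have zz : dotv z z = r ^+ 2 by rewrite enorm_sqr.
have vz : dotv v v = 2 * dotv v z.
  rewrite /v !dotvDl !dotvDr !dotvNl !dotvNr !dotvZl !dotvZr dotv_e00 zz (dotvC (e0 n)); ring.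
rewrite /H mulmxBl mul1mx -scalemxAl -mulmxA [v^T *m z]mx11_scalar -dotv_mx mul_mx_scalar.
rewrite scalerA (_ : 2 / dotv v v * dotv v z = 1); last first.
  by rewrite mulrAC -vz divff.
by rewrite scale1r /v opprB addrC subrK.
Qed.

Variables (n : nat) (T : R).
Hypotheses (n0 : (0 < n)%N) (T0 : 0 < T).

(** The n-th power of the radius of the slice at height s of the ball of radius T in dimension 1 +
    n. The square root of a negative number being 0, it vanishes outside the ball. *)
Definition hgt (s : R) : R := Num.sqrt (T ^+ 2 - s ^+ 2) ^+ n.

Lemma hgt_ge0 s : 0 <= hgt s.
Proof. by rewrite exprn_ge0 // sqrtr_ge0. Qed.

Lemma hgt_cont : continuous hgt.
Proof.
rewrite (_ : hgt = (fun y : R => y ^+ n) \o ((@Num.sqrt R) \o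
  ((fun=> T ^+ 2) - (fun s : R => s ^+ 2)))) // => s.
apply: continuous_comp; last exact: exprn_continuous.
apply: continuous_comp; last exact: sqrt_continuous.
by apply: continuousB; [exact: cvg_cst | exact: exprn_continuous].
Qed.

Lemma hgt_out s : T <= `|s| -> hgt s = 0.
Proof.
move=> Ts; rewrite /hgt ler0_sqrtr ?expr0n ?(gtn_eqF n0) //.
by rewrite subr_le0 -(real_normK (num_real s)) lerXn2r ?nnegrE // ltW.
Qed.

Lemma hgt_even s : hgt (- s) = hgt s.
Proof. by rewrite /hgt sqrrN. Qed.

Lemma hgt_norm s : hgt `|s| = hgt s.
Proof. by rewrite /hgt real_normK ?num_real. Qed.

Lemma hgt_le s t : 0 <= s -> s <= t -> hgt t <= hgt s.
Proof.
move=> s0 st; rewrite lerXn2r ?nnegrE ?sqrtr_ge0 // ler_wsqrtr // lerB //.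
by rewrite lerXn2r ?nnegrE // (le_trans s0).
Qed.

(** Starting the primitive at -1 makes every s >= 0 an interior point, so the derivative at 0 is
    two-sided. *)
Definition F0 (x : R) : R := \int[leb]_(s in `[-1, x]) hgt s.

Lemma isD_F0 (x : R) : -1 < x -> is_derive x 1 F0 (hgt x).
Proof.
move=> x1.
have [] := @continuous_FTC1_closed R hgt (-1) x (x + 1) _ _ x1 _.
- by rewrite ltrDl.
- apply: continuous_compact_integrable; first exact: segment_compact.
  by apply: continuous_subspaceT; exact: hgt_cont.
- exact: hgt_cont.
by move=> h1 h2; apply: DeriveDef => //; rewrite -derive1E.
Qed.

Lemma mhgt : measurable_fun setT hgt.
Proof. by apply: continuous_measurable_fun; exact: hgt_cont. Qed.

Lemma int_F0 x : (\int[leb]_s ((-1 <= s < x)%R%:R * hgt s)%:E)%E = (F0 x)%:E.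
Proof.
have -> : (\int[leb]_s ((-1 <= s < x)%R%:R * hgt s)%:E =
    \int[leb]_(s in `[(-1)%R, x[) (hgt s)%:E)%E.
  rewrite [RHS]integral_mkcond; apply: eq_integral => s _.
  rewrite patchE mem_setE in_itv /=.
  by case: (_ <= _ < _); rewrite ?mul1r ?mul0r.
rewrite integral_itv_bndo_bndc; last first.
  by apply/measurable_EFinP; apply: measurable_funTS; exact: mhgt.
rewrite /F0 /Rintegral fineK //; apply: integrable_fin_num => //.
apply: continuous_compact_integrable; first exact: segment_compact.
by apply: continuous_subspaceT; exact: hgt_cont.
Qed.

(** The volume of the lens of two balls of radius T with centres at distance r, divided by the
    volume of the unit n-ball. *)
Definition V (r : R) : R := if r <= 2 * T then 2 * (F0 T - F0 (r / 2)) else 0.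

(** The integrand is even, so its integral is twice the one over s >= 0, and a shift by r / 2 turns
    that into the integral of [hgt] from r / 2 to T. *)
Lemma int_V (r : R) : 0 <= r -> (\int[leb]_s (hgt (`|s| + r / 2))%:E)%E = (V r)%:E.
Proof.
move=> r0.
rewrite (@ge0_symfun_integralT R (fun s => hgt (`|s| + r / 2))); last 3 first.
- by move=> s; exact: hgt_ge0.
- rewrite (_ : (fun _ => _) = hgt \o ((@Num.norm R R) + (fun=> r / 2))) // => s.
  apply: continuous_comp; last exact: hgt_cont.
  by apply: continuousD; [exact: norm_continuous | exact: cvg_cst].
- by move=> s /=; rewrite normrN.
have -> : (\int[leb]_(s in [set s | (0 <= s)%R]) (hgt (`|s| + r / 2))%:E =
   \int[leb]_s ((r / 2 <= s)%R%:R * hgt s)%:E)%E.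
  rewrite integral_mkcond.
  have := @leb_affine R (fun s => ((r / 2 <= s)%R%:R * hgt s)%:E) 1 (r / 2) (oner_neq0 _).
  rewrite normr1 invr1 mul1e => <-.
  - apply: eq_integral => s _; rewrite patchE mul1r lerDr.
    case: (boolP (0 <= s)) => s0.
      by rewrite mem_set ?ger0_norm ?mul1r.
    by rewrite memNset ?mul0r //; exact/negP.
  - apply/measurable_EFinP; apply: measurable_funM; last exact: mhgt.
    apply: (@measurableT_comp _ _ _ _ _ _ (fun c : bool => c%:R : R) _ (fun s => r / 2 <= s)) => //.
    by apply: measurable_fun_ler => //; exact: measurable_cst.
  - by move=> s; rewrite lee_fin mulr_ge0 // hgt_ge0.
have mb (P : R -> bool) : measurable_fun setT P -> measurable_fun setT (fun s => ((P s)%:R * hgt s)%:E).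
  move=> mP; apply/measurable_EFinP; apply: measurable_funM; last exact: mhgt.
  exact: (@measurableT_comp _ _ _ _ _ _ (fun c : bool => c%:R : R) _ P).
have m1 : measurable_fun setT (fun s : R => r / 2 <= s).
  by apply: measurable_fun_ler => //; exact: measurable_cst.
rewrite /V; case: ifPn => [rT|]; last first.
  rewrite -ltNge => rT.
  rewrite (_ : (fun s => _) = cst 0%E) ?integral_cst ?mul0e ?mule0 //.
  apply/funext => s /=; case: (boolP (r / 2 <= s)) => h; last by rewrite mul0r.
  by rewrite hgt_out ?mulr0 // ger0_norm; lra.
have E : (\int[leb]_s ((r / 2 <= s)%R%:R * hgt s)%:E + (F0 (r / 2))%:E = (F0 T)%:E)%E.
  rewrite -!int_F0 -ge0_integralD //.
  - apply: eq_integral => s _; rewrite -EFinD; congr EFin.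
    have [sT|sT] := ltP s T; last first.
      by rewrite hgt_out ?mulr0 ?addr0 // ger0_norm // (le_trans (ltW T0)).
    rewrite andbT -mulrDl; congr (_ * _).
    case: (leP (r / 2) s) => h /=.
      by rewrite andbF addr0 (_ : -1 <= s) //; lra.
    by rewrite andbT add0r.
  - by move=> s _; rewrite lee_fin mulr_ge0 // hgt_ge0.
  - exact: mb.
  - by move=> s _; rewrite lee_fin mulr_ge0 // hgt_ge0.
  - apply: mb; apply: measurable_and; first by apply: measurable_fun_ler => //; exact: measurable_cst.
    by apply: measurable_fun_ltr => //; exact: measurable_cst.
move: E; case: (integral _ _ _) => [a| |] //=.
rewrite -EFinD => -[aE]; rewrite -EFinM; congr EFin; rewrite -aE; ring.
Qed.

Lemma enorm_col (s : R) (v : 'cV[R]_n) :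
  enorm (col_mx s%:M v : 'cV[R]_(1 + n)) ^+ 2 = s ^+ 2 + enorm v ^+ 2.
Proof.
rewrite !enorm_sqr /dotv (big_split_ord (R := R)) /= big_ord1 !col_mxEu mxE eqxx mulr1n expr2.
by congr (_ + _); apply: eq_bigr => i _; rewrite !col_mxEd.
Qed.

Lemma enorm_leE p (w : 'cV[R]_p) (t : R) : 0 <= t -> (enorm w <= t) = (enorm w ^+ 2 <= t ^+ 2).
Proof. by move=> t0; rewrite ler_pXn2r ?nnegrE ?enorm_ge0. Qed.

(** Moving the origin to the midpoint of the two centres makes the lens symmetric. *)
Lemma max_shift (s r : R) : 0 <= r ->
  Num.max `|s - r / 2| `|s - r / 2 + r| = `|s| + r / 2.
Proof.
move=> r0; rewrite (_ : s - r / 2 + r = s + r / 2); last by field.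
have [s0|s0] := leP 0 s.
  rewrite (ger0_norm s0) max_r; first by rewrite ger0_norm //; lra.
  by rewrite [leRHS]ger0_norm; [rewrite ler_norml; apply/andP; split; lra | lra].
rewrite (ltr0_norm s0) max_l; first by rewrite ltr0_norm; lra.
by rewrite [leRHS]ltr0_norm; [rewrite ler_norml; apply/andP; split; lra | lra].
Qed.

(** Slice orthogonally to the line of centres: at height s both conditions together say that the
    remaining coordinates lie in the ball whose squared radius is T^2 minus the larger of s^2 and
    (s+r)^2. *)
Lemma lens_std (r : R) : 0 <= r ->
  I (fun u : 'cV[R]_(1 + n) => (enorm u <= T)%R%:R * (enorm (u + r *: e0 n) <= T)%R%:R) =
  (bvol (1%:M : 'M[R]_n) * V r)%:E.
Proof.
move=> r0; set f := fun u : 'cV[R]_(1 + n) => _.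
have f0 u : 0 <= f u by rewrite mulr_ge0.
have mf : mfv f.
  apply: mfvM; apply: mfv_natb; apply: mfv_le; try exact: mfv_cst; first exact: mfv_enorm.
  rewrite (_ : (fun _ => _) = fun u => enorm (1%:M *m u + r *: e0 n)).
    exact: mfv_enorm_aff.
  by apply/funext => u; rewrite mul1mx.
rewrite /I Int_cons; last 2 first.
- exact: (mfvE mf).
- by move=> u; rewrite lee_fin.
pose F (s : R) := hgt (Num.max `|s| `|s + r|).
have b0 := bvol_ge0 (1%:M : 'M[R]_n).
have E s : Int (fun v : 'cV[R]_n => (f (col_mx s%:M v))%:E) = ((bvol (1%:M : 'M[R]_n) * F s))%:E.
  have fE v : f (col_mx s%:M v) =
     (enorm v ^+ 2 <= T ^+ 2 - (Num.max `|s| `|s + r|) ^+ 2)%R%:R.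
    rewrite /f scale_col_mx scaler0 add_col_mx addr0 scale_scalar_mx mulr1 -raddfD.
    rewrite !enorm_leE ?(ltW T0) // !enorm_col -natrM mulnb.
    congr ((nat_of_bool _)%:R); rewrite lerBrDl.
    have [h|h] := leP `|s| `|s + r|; rewrite real_normK ?num_real //.
      have : s ^+ 2 <= (s + r) ^+ 2.
        by rewrite -(real_normK (num_real s)) -(real_normK (num_real (s + r))) lerXn2r ?nnegrE.
      by move=> h2; apply/andP/idP => [[//]|h3]; split=> //; apply: le_trans h3; rewrite lerD2r.
    have : (s + r) ^+ 2 <= s ^+ 2.
      by rewrite -(real_normK (num_real s)) -(real_normK (num_real (s + r))) lerXn2r ?nnegrE // ltW.
    by move=> h2; apply/andP/idP => [[//]|h3]; split=> //; apply: le_trans h3; rewrite lerD2r.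
  have [MT|MT] := leP (Num.max `|s| `|s + r|) T.
    have M0 : 0 <= Num.max `|s| `|s + r| by rewrite le_max normr_ge0.
    have TM : 0 <= T ^+ 2 - (Num.max `|s| `|s + r|) ^+ 2.
      by rewrite subr_ge0 lerXn2r ?nnegrE // ltW.
    rewrite /F /hgt -I_ball ?sqrtr_ge0 ?unitmx1 //.
    congr Int; apply/funext => v; 
    by rewrite fE /ballf mul1mx (enorm_leE v (sqrtr_ge0 _)) (sqr_sqrtr TM).
  rewrite /F hgt_out; last by rewrite ger0_norm ?(ltW MT) // le_max normr_ge0.
  rewrite mulr0 (_ : (fun _ => _) = fun=> 0%E); first by rewrite /Int integral0.
  apply/funext => v; rewrite fE; congr EFin; apply/eqP; rewrite pnatr_eq0 eqb0 -ltNge.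
  apply: lt_le_trans (sqr_ge0 _); rewrite subr_lt0.
  by rewrite ltr_pXn2r ?nnegrE ?(ltW T0) // le_max normr_ge0.
under eq_integral do rewrite E EFinM.
have mF : measurable_fun setT F.
  rewrite (_ : F = hgt \o (fun s : R => Num.max `|s| `|s + r|)) //.
  apply: measurableT_comp; first exact: mhgt.
  have mn : measurable_fun setT (fun s : R => `|s|) by exact: normr_measurable.
  apply: measurable_maxr => //.
  by apply: (measurableT_comp mn); exact: (@measurable_funD _ _ _ setT id (fun=> r)).
have mFE : measurable_fun setT (fun s => (F s)%:E) by apply/measurable_EFinP.
rewrite ge0_integralZl //; last first.
- by move=> s _; rewrite lee_fin hgt_ge0.
rewrite EFinM; congr (_ * _)%E.
have F00 s : (0 <= (F s)%:E)%E by rewrite lee_fin hgt_ge0.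
have := @leb_affine R (fun s => (F s)%:E) 1 (- (r / 2)) (oner_neq0 _) mFE F00.
rewrite normr1 invr1 mul1e => <-; rewrite -int_V //.
by apply: eq_integral => s _; rewrite /F mul1r max_shift.
Qed.

(** The substitution w = Bu turns the ellipsoids into balls with factor 1/|det B|, and a reflection
    takes the displacement [B *m x] to the first axis. *)
Lemma lens (B : 'M[R]_(1 + n)) x : B \in unitmx ->
  I (fun u => ballf B T u * ballf B T (u + x)) =
  (`|\det B|^-1 * (bvol (1%:M : 'M[R]_n) * V (enorm (B *m x))))%:E.
Proof.
move=> uB; set z := B *m x.
have [H HH Hz] := rotate_e0 z.
have HH' : H *m H^T = 1%:M by exact: mulmx1C.
pose g (w : 'cV[R]_(1 + n)) : R := (enorm w <= T)%R%:R * (enorm (w + z) <= T)%R%:R.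
have mg : mfv g.
  apply: mfvM; apply: mfv_natb; apply: mfv_le; try exact: mfv_cst; first exact: mfv_enorm.
  rewrite (_ : (fun _ => _) = fun u => enorm (1%:M *m u + z)).
    exact: mfv_enorm_aff.
  by apply/funext => u; rewrite mul1mx.
have g0 w : 0 <= g w by rewrite mulr_ge0.
rewrite (@I_ext _ _ _ (fun u => g (B *m u))); last first.
  by move=> u; rewrite /g /ballf -mulmxDr.
rewrite I_linear // EFinM; congr (_ * _)%E.
have uH : H^T \in unitmx by rewrite unitmx_tr; case/mulmx1_unit: HH'.
have dH : `|\det H^T| = 1.
  apply/eqP; rewrite -(@eqrXn2 _ 2) // ?expr1n -normrX det_tr expr2 -{1}det_tr -det_mulmx HH det1 normr1 //.
have -> : I g = I (fun u => g (H^T *m u)).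
  by rewrite I_linear // dH invr1 mul1e.
rewrite -lens_std ?enorm_ge0 //; apply: I_ext => u.
have zE : z = H^T *m (enorm z *: e0 n) by rewrite -Hz mulmxA HH mul1mx.
have hT : (H^T)^T *m H^T = 1%:M by rewrite trmxK.
by rewrite /g {1}zE -mulmxDr !(enorm_orth _ hT).
Qed.

End Lens.

(** * The autocorrelation of an ellipsoid *)

Section Autocorrelation.
Context {R : realType}.
Local Notation tR n := (n.-tuple (measurableTypeR R)).

Section Fixed.
Variables (n : nat) (T : R) (B : 'M[R]_(1 + n)).
Hypotheses (n0 : (0 < n)%N) (T0 : 0 < T) (uB : B \in unitmx).

Definition lensc : R := `|\det B|^-1 * bvol (1%:M : 'M[R]_n).

(** The autocorrelation at x of the indicator of {|Bu| <= T}, given by its lens formula; [psiE] is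
    the identification. *)
Definition psi (x : 'cV[R]_(1 + n)) : R := lensc * V n T (enorm (B *m x)).

Lemma psiE x : I (fun u => ballf B T u * ballf B T (u + x)) = (psi x)%:E.
Proof. by rewrite lens // /psi /lensc mulrA. Qed.

Lemma psi_ge0 x : 0 <= psi x.
Proof. by rewrite -lee_fin -psiE I_ge0 // => u; rewrite mulr_ge0. Qed.

Lemma lensc_ge0 : 0 <= lensc.
Proof. by rewrite mulr_ge0 ?invr_ge0 // bvol_ge0. Qed.

Let mjoint : measurable_fun setT (fun z : tR (1 + n) * tR (1 + n) =>
  (ballf B T (vec z.2) * ballf B T (vec z.2 + vec z.1))%:E).
Proof.
apply/measurable_EFinP; apply: measurable_funM.
  by apply: (mfv_comp (mfv_ballf B T)); exact: (mcv_comp (@mcv_vec R (1 + n))).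
apply: (mfv_comp (mfv_ballf B T) (g := fun z : tR (1 + n) * tR (1 + n) => vec z.2 + vec z.1)).
by apply: mcvD; exact: (mcv_comp (@mcv_vec R (1 + n))).
Qed.

Lemma mfv_psi : mfv psi.
Proof.
apply/measurable_EFinP.
rewrite (_ : EFin \o _ = fubini_F (mu (1 + n)) (fun z : tR (1 + n) * tR (1 + n) =>
  (ballf B T (vec z.2) * ballf B T (vec z.2 + vec z.1))%:E)).
  by apply: measurable_fun_fubini_tonelli_F => // z; rewrite lee_fin mulr_ge0.
by apply/funext => x; rewrite /= -psiE.
Qed.

(** Tonelli: for fixed u the inner integral over x is the full volume, so the total is the volume
    squared. *)
Lemma I_psi : I psi = ((bvol B * T ^+ (1 + n)) ^+ 2)%:E.
Proof.
transitivity (Int (fun x => Int (fun u => (ballf B T u * ballf B T (u + x))%:E))).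
  by congr Int; apply/funext => x; rewrite -psiE.
rewrite Int_swap //; last by move=> x u; rewrite lee_fin mulr_ge0.
have vE := I_ball (ltn0Sn n) uB (ltW T0).
transitivity (I (fun u => bvol B * T ^+ (1 + n) * ballf B T u)).
  congr Int; apply/funext => u.
  transitivity (I (fun x => ballf B T u * ballf B T (u + x))); first by [].
  rewrite I_Z //; last by apply: mfv_shift; exact: mfv_ballf.
  by rewrite I_shift // ?vE ?EFinM 1?muleC //; exact: mfv_ballf.
rewrite I_Z //; [by rewrite vE -EFinM expr2 | exact: mfv_ballf |].
by rewrite mulr_ge0 ?bvol_ge0 // exprn_ge0 // ltW.
Qed.

Lemma psi_even x : psi (- x) = psi x.
Proof. by rewrite /psi mulmxN enormN. Qed.

Lemma V_out r : 2 * T <= r -> V n T r = 0.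
Proof.
rewrite /V le_eqVlt => /orP[/eqP <-|h]; last by rewrite leNgt h.
by rewrite lexx mulrAC divff ?mul1r ?subrr ?mulr0.
Qed.

(** Truncating r / 2 at T merges the two cases of [V] into one formula, from which the Lipschitz
    bound follows. *)
Lemma V_min r : V n T r = 2 * (F0 n T T - F0 n T (Num.min (r / 2) T)).
Proof.
rewrite /V; case: ifPn => h.
  by rewrite min_l //; lra.
by rewrite min_r ?subrr ?mulr0 //; move: h; rewrite -ltNge; lra.
Qed.

Lemma F0_lip (a b s : R) : 0 <= s -> s <= a -> s <= b ->
  `|F0 n T a - F0 n T b| <= hgt n T s * `|a - b|.
Proof.
move=> s0 sa sb.
apply: (@mean_value_ineq R (F0 n T) (hgt n T) s (Num.max a b)).
- by rewrite sb le_max lexx orbT.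
- by rewrite sa le_max lexx.
- by move=> t /andP[st _]; apply: isD_F0; lra.
- by move=> t /andP[st _] _; rewrite ger0_norm ?hgt_ge0 // hgt_le.
Qed.

Lemma hgt_leT s : hgt n T s <= T ^+ n.
Proof.
rewrite lerXn2r ?nnegrE ?sqrtr_ge0 ?(ltW T0) // -[leRHS]ger0_norm ?(ltW T0) // -sqrtr_sqr.
by rewrite ler_wsqrtr // lerBlDr lerDl sqr_ge0.
Qed.

Lemma V_lip r r' : 0 <= r -> 0 <= r' -> `|V n T r - V n T r'| <= T ^+ n * `|r - r'|.
Proof.
move=> r0 r0'; rewrite !V_min.
rewrite (_ : _ - _ = 2 * (F0 n T (Num.min (r' / 2) T) - F0 n T (Num.min (r / 2) T))); last by ring.
rewrite normrM [ `|2| ]ger0_norm //.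
have := @F0_lip (Num.min (r' / 2) T) (Num.min (r / 2) T) 0 (lexx _).
rewrite !le_min (ltW T0) !divr_ge0 // => /(_ isT isT) h.
have h2 : 2 * `|Num.min (r' / 2) T - Num.min (r / 2) T| <= `|r - r'|.
  have h3 : r - r' <= `|r - r'| by exact: ler_norm.
  have h4 : r' - r <= `|r - r'| by rewrite distrC ler_norm.
  rewrite mulrC -ler_pdivlMr // ler_norml.
  by case: (leP (r' / 2) T) => a1; case: (leP (r / 2) T) => a2; apply/andP; split; lra.
have := hgt_leT 0; have := hgt_ge0 n T 0; have := normr_ge0 (Num.min (r' / 2) T - Num.min (r / 2) T); nra.
Qed.

(** Within c of tangency each half of the lens has thickness at most c / 2, and its slices have
    squared radius (T - r/2)(T + r/2) <= cT. *)
Lemma V_edge r (c : R) : 0 <= c -> 0 <= r -> 2 * T - c <= r ->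
  V n T r <= c * Num.sqrt (c * T) ^+ n.
Proof.
move=> c0 r0 rc.
have R0 : 0 <= c * Num.sqrt (c * T) ^+ n by rewrite mulr_ge0 // exprn_ge0 // sqrtr_ge0.
have [rT|rT] := leP (2 * T) r; first by rewrite V_out.
rewrite /V (ltW rT).
have rr : 0 <= r / 2 by rewrite divr_ge0.
have rT2 : r / 2 <= T by lra.
have := F0_lip rr rT2 (lexx _); rewrite [ `|T - _| ]ger0_norm ?subr_ge0 // => h.
have h1 : hgt n T (r / 2) <= Num.sqrt (c * T) ^+ n.
  rewrite lerXn2r ?nnegrE ?sqrtr_ge0 // ler_wsqrtr //; nra.
have := le_trans (ler_norm _) h; have := hgt_ge0 n T (r / 2); nra.
Qed.

End Fixed.

End Autocorrelation.

(** * Fourth differences of the autocorrelation *)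

Section PsiDifferences.
Context {R : realType}.

Lemma sqrt_powR (a : R) n : 0 <= a -> Num.sqrt a ^+ n = a `^ (n%:R / 2).
Proof.
by move=> a0; rewrite -powR12_sqrt // -powR_mulrn ?powR_ge0 // -powRrM mulrC.
Qed.

(** The weights of the four translates sum to 5/3 <= 2 in absolute value, and the fourth difference
    is unchanged when the constant f x is subtracted. *)
Lemma fourth_diff_lip n (f : 'cV[R]_n -> R) x y (L : R) :
  (forall s : R, `|s| <= 2 -> `|f (x + s *: y) - f x| <= L) ->
  `|fourth_diff f x y| <= 2 * L.
Proof.
move=> h; have L0 : 0 <= L by apply: le_trans (h 0 _); rewrite ?normr0.
have h1 : `|f (x + y) - f x| <= L by have := h 1; rewrite scale1r normr1; apply; lra.
have h2 : `|f (x - y) - f x| <= L.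
  by have := h (-1); rewrite scaleNr scale1r normrN normr1; apply; lra.
have h3 : `|f (x + 2 *: y) - f x| <= L by apply: h; rewrite ger0_norm.
have h4 : `|f (x - 2 *: y) - f x| <= L.
  by have := h (-2); rewrite scaleNr normrN; apply; rewrite ger0_norm.
move: h1 h2 h3 h4; rewrite /fourth_diff !ler_norml.
by move=> /andP[? ?] /andP[? ?] /andP[? ?] /andP[? ?]; apply/andP; split; lra.
Qed.

Lemma fourth_diff_small n (f : 'cV[R]_n -> R) x y (L : R) :
  (forall s : R, `|s| <= 2 -> `|f (x + s *: y)| <= L) ->
  `|fourth_diff f x y| <= 4 * L.
Proof.
move=> h; have h0 : `|f x| <= L by have := h 0; rewrite scale0r addr0 normr0; apply.
have -> : 4 * L = 2 * (L + L) by ring.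
apply: fourth_diff_lip => s hs; apply: le_trans (ler_normB _ _) _.
by rewrite lerD // h.
Qed.

Lemma fourth_diff_eq n (f g : 'cV[R]_n -> R) x y :
  (forall s : R, `|s| <= 2 -> f (x + s *: y) = g (x + s *: y)) ->
  fourth_diff f x y = fourth_diff g x y.
Proof.
move=> h; rewrite /fourth_diff.
have -> : f x = g x by have := h 0; rewrite scale0r addr0 normr0; apply.
have -> : f (x + y) = g (x + y) by have := h 1; rewrite scale1r normr1; apply; lra.
have -> : f (x - y) = g (x - y).
  by have := h (-1); rewrite scaleNr scale1r normrN normr1; apply; lra.
have -> : f (x + 2 *: y) = g (x + 2 *: y) by apply: h; rewrite ger0_norm.
have -> // : f (x - 2 *: y) = g (x - 2 *: y).
by have := h (-2); rewrite scaleNr normrN; apply; rewrite ger0_norm.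
Qed.

Lemma enorm_line n p (A : 'M[R]_(p, n)) x y (c s : R) :
  enorm (A *m y) <= c -> `|s| <= 2 ->
  enorm (A *m x) - 2 * c <= enorm (A *m (x + s *: y)) <= enorm (A *m x) + 2 * c.
Proof.
move=> hy hs; have h : enorm (A *m (s *: y)) <= 2 * c.
  by rewrite -scalemxAr enormZ ler_pM // enorm_ge0.
have := enormD (A *m x) (A *m (s *: y)); have := enorm_revB (A *m x) (A *m (s *: y)).
by rewrite -mulmxDr => h1 h2; apply/andP; split; lra.
Qed.

Variables (n : nat) (B : 'M[R]_(1 + n)) (c : R).
Hypotheses (n2 : (1 < n)%N) (c0 : 0 < c) (uB : B \in unitmx).

Let K0 : 0 <= lensc B := lensc_ge0 B.

(** The radial formula for [psi] is not smooth at the origin, so only its Lipschitz constant, of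
    order T^n, is used there. *)
Lemma psi_diff_near T x y : 0 < T -> enorm (B *m y) <= c ->
  `|fourth_diff (psi T B) x y| <= 4 * c * lensc B * T ^+ n.
Proof.
move=> T0 hy; have -> : 4 * c * lensc B * T ^+ n = 2 * (lensc B * (T ^+ n * (2 * c))) by ring.
apply: fourth_diff_lip => s hs; rewrite /psi -mulrBr normrM (ger0_norm K0) ler_wpM2l //.
apply: le_trans (V_lip _ T0 (enorm_ge0 _) (enorm_ge0 _)) _.
rewrite ler_wpM2l ?exprn_ge0 ?(ltW T0) //.
have /andP[h1 h2] := enorm_line x hy hs.
by rewrite ler_norml; apply/andP; split; lra.
Qed.

(** At bounded distance from the edge |Bx| = 2T of the support, [psi] itself is small by
    [V_edge]. *)
Lemma psi_diff_edge (c1 : R) : 0 <= c1 -> exists2 C : R, 0 < C & forall T x y, 1 <= T ->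
  enorm (B *m y) <= c -> 2 * T - c1 <= enorm (B *m x) ->
  `|fourth_diff (psi T B) x y| <= C * T ^+ n.-1.
Proof.
move=> c10; pose c2 := c1 + 2 * c + 1.
have cc := c0; have c20 : 0 <= c2 by rewrite /c2; lra.
exists (4 * (lensc B * (c2 * Num.sqrt c2 ^+ n)) + 1).
  apply: ltr_pwDr => //; apply: mulr_ge0 => //; apply: mulr_ge0 => //.
  by apply: mulr_ge0 => //; exact: exprn_ge0 (sqrtr_ge0 _).
move=> T x y T1 hy hx; have T0 : 0 < T by lra.
apply: (@le_trans _ _ (4 * (lensc B * (c2 * Num.sqrt c2 ^+ n) * T ^+ n.-1))); last first.
  rewrite -subr_ge0 [X in 0 <= X](_ : _ = T ^+ n.-1); last by ring.
  by rewrite exprn_ge0 // ltW.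
apply: fourth_diff_small => s hs.
rewrite ger0_norm; last exact: psi_ge0 (ltnW n2) T0 uB _.
rewrite /psi -mulrA ler_wpM2l //.
have /andP[h1 h2] := enorm_line x hy hs.
apply: le_trans (V_edge n c20 (enorm_ge0 _) _) _; first by rewrite /c2; lra.
rewrite -mulrA ler_wpM2l // sqrtrM // exprMn ler_wpM2l ?exprn_ge0 ?sqrtr_ge0 //.
have sT : 1 <= Num.sqrt T by rewrite -[leLHS]sqrtr1 ler_wsqrtr.
rewrite -[X in _ <= X ^+ _](sqr_sqrtr (ltW T0)) -exprM.
(* For n >= 2 the power T^(n/2) is at most T^(n-1). *)
by rewrite ler_weXn2l //; lia.
Qed.

Lemma psi_diff_far T x y : 0 < T -> enorm (B *m y) <= c ->
  2 * T + 2 * c <= enorm (B *m x) -> fourth_diff (psi T B) x y = 0.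
Proof.
have cc := c0; move=> T0 hy hx; apply/eqP; rewrite -normr_le0 -(mulr0 4).
apply: fourth_diff_small => s hs; have /andP[h1 h2] := enorm_line x hy hs.
by rewrite /psi V_out ?mulr0 ?normr0 //; lra.
Qed.

(** The lens volume as a function of the squared distance t, the form required by
    [radial_Pf_diff]. *)
Definition lens_mu (T t : R) : R := lensc B * (2 * (F0 n T T - F0 n T (2^-1 * t `^ 2^-1))).

(** The derivative of [F0] at sqrt(t)/2 is (T^2 - t/4)^(n/2); the chain rule adds t^(-1/2). This is
    [Pf] with e = 1, X = 4T^2, a = -1/2, b = n/2. *)
Lemma lens_deriv (T t : R) : 0 < t -> t `^ 1 < 4 * T ^+ 2 ->
  is_derive t 1 (lens_mu T)
    (- (lensc B / 2 * 4^-1 `^ (n%:R / 2)) * Pf 1 (4 * T ^+ 2) (- 2^-1) (n%:R / 2) t).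
Proof.
move=> t0 tX'.
have d1 := is_derive1_powR 2^-1 t0.
have st0 : -1 < 2^-1 * t `^ 2^-1.
      by apply: lt_le_trans (mulr_ge0 _ (powR_ge0 _ _)) => //; rewrite ?ltrN10 // invr_ge0.
have d2 := @isD_comp R (F0 n T) (fun t => 2^-1 * t `^ 2^-1) t _ _ (isD_F0 n T st0) (isD_Z 2^-1 d1).
apply: isD_eq (isD_Z (lensc B) (isD_Z 2 (isD_B (isD_cst (F0 n T T) t) d2))) _.
have tt : (2^-1 * t `^ 2^-1) ^+ 2 = t / 4.
  rewrite exprMn powR12_sqrt ?(ltW t0) // sqr_sqrtr ?(ltW t0) // mulrC; congr (_ * _).
  by field.
have e1 : 4^-1 * (4 * T ^+ 2 - t `^ 1) = T ^+ 2 - t / 4.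
  by rewrite (powRr1 (ltW t0)); field.
rewrite /hgt /= tt sqrt_powR; last by rewrite -e1 mulr_ge0 ?invr_ge0 // subr_ge0 ltW.
rewrite -e1 powRM ?invr_ge0 //; last by rewrite subr_ge0 ltW.
rewrite /Pf (_ : 2^-1 - 1 = - 2^-1 :> R); last by field.
by field.
Qed.

(** The singular part of the third derivative. For n >= 3 write b - 2 = (n-3)/2 - 1/2: the first
    exponent is nonnegative and harmless, and a single inverse square root of the distance to the
    edge remains. For n = 2 the coefficient b(b-1) vanishes. *)
Lemma edge_power (T t r : R) : 1 <= T -> 0 < r -> 0 < 2 * T - r -> 0 < t ->
  (r / 2) ^+ 2 <= t -> t <= 4 * T ^+ 2 - T * (2 * T - r) ->
  forall b, b = n%:R / 2 ->
  `|b * (b - 1)| * Pf 1 (4 * T ^+ 2) (- 2^-1 + 1 + 1 - 2) (b - 2) t <=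
  `|b * (b - 1)| * 2 * 4 `^ ((n%:R - 3) / 2) *
    (T ^+ n.-1 * T ^- 2 / Num.sqrt (T * (2 * T - r))) * r^-1.
Proof.
move=> T1 r0 Tr0 t0 tlo tX b bE; have T0 : 0 < T by lra.
have Tr : 0 < T * (2 * T - r) by rewrite mulr_gt0.
set q := Num.sqrt _; have q0 : 0 < q by rewrite sqrtr_gt0.
rewrite /Pf (_ : - 2^-1 + 1 + 1 - 2 = - 2^-1 :> R); last by field.
rewrite powRr1 ?(ltW t0) //.
have [n3|n3] := ltnP 2 n; last first.
  have -> : b = 1.
    have n2' := n2; have -> : b = 2%:R / 2 by rewrite bE; congr (_%:R / 2); lia.
    by rewrite divff.
  by rewrite subrr mulr0 normr0 mul0r !mul0r ?invr_ge0 ?exprn_ge0 ?(ltW T0) ?(ltW r0) ?(ltW q0).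
have u0 : T * (2 * T - r) <= 4 * T ^+ 2 - t by lra.
have u1 : 0 < 4 * T ^+ 2 - t by lra.
have f1 : t `^ (- 2^-1) <= 2 / r.
  rewrite powRN powR12_sqrt ?(ltW t0) // -[leRHS]invrK invf_div.
  rewrite lef_pV2 ?posrE ?sqrtr_gt0 ?divr_gt0 //.
  by rewrite -(@ger0_norm _ (r / 2)) ?divr_ge0 ?(ltW r0) // -sqrtr_sqr ler_wsqrtr.
have f2 : (4 * T ^+ 2 - t) `^ (b - 2) <= (4 * T ^+ 2) `^ ((n%:R - 3) / 2) / q.
  rewrite (_ : b - 2 = (n%:R - 3) / 2 + - 2^-1); last by rewrite bE; field.
  rewrite powRDp // ler_pM ?powR_ge0 //.
    apply: ge0_ler_powR.
    - by rewrite divr_ge0 // subr_ge0 ler_nat.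
    - by rewrite nnegrE ltW.
    - by rewrite nnegrE mulr_ge0 // sqr_ge0.
    - by rewrite gerBl ltW.
  rewrite powRN powR12_sqrt ?(ltW u1) // lef_pV2 ?posrE ?sqrtr_gt0 //.
  by rewrite ler_wsqrtr.
have f3 : (4 * T ^+ 2) `^ ((n%:R - 3) / 2) = 4 `^ ((n%:R - 3) / 2) * (T ^+ n.-1 * T ^- 2).
  rewrite powRM ?sqr_ge0 //; congr (_ * _).
  have nE : n%:R = n.-1%:R + 1 :> R by rewrite natr1 (prednK (ltnW n2)).
  rewrite -!(powR_mulrn _ (ltW T0)) -powRrM -powRN -powRDp //; congr (_ `^ _).
  by rewrite nE; field.
have f4 := ler_pM (powR_ge0 _ _) (powR_ge0 _ _) f1 f2.
apply: le_trans (ler_wpM2l (normr_ge0 _) f4) _.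
rewrite f3.
set A := `|_|; set p := 4 `^ _; set w := T ^+ n.-1 * T ^- 2.
have -> : A * (2 / r * (p * w / q)) = A * 2 * p * (w / q) * r^-1.
  by field; rewrite ?gt_eqF.
by [].
Qed.

Lemma psi_diff_mid : exists2 C : R, 0 < C & forall T x y, 1 <= T ->
  enorm (B *m y) <= c -> 4 * c + 1 <= enorm (B *m x) -> enorm (B *m x) <= 2 * T - (4 * c + 1) ->
  `|fourth_diff (psi T B) x y| <=
    C * (T ^+ n / enorm (B *m x) ^+ 2 + T ^+ n.-1 / Num.sqrt (T * (2 * T - enorm (B *m x)))).
Proof.
have cc := c0; pose b : R := n%:R / 2.
have b1 : 1 <= b by rewrite /b ler_pdivlMr // mul1r ler_nat.
have a0 : - 2^-1 <= 0 :> R by rewrite oppr_le0 invr_ge0.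
have [C C0 hC] := radial_Pf_diff 1 c0 a0 b1.
pose kap : R := lensc B / 2 * 4^-1 `^ b.
have kap0 : 0 <= kap by rewrite mulr_ge0 ?powR_ge0 // divr_ge0.
pose S0 : R := `|b * (b - 1)| * 2 * 4 `^ ((n%:R - 3) / 2).
have S00 : 0 <= S0 by rewrite mulr_ge0 ?powR_ge0 // mulr_ge0.
have p4 : 0 <= 4 `^ b :> R by rewrite powR_ge0.
exists (C * kap * (4 `^ b + 4 * S0) + 1).
  apply: ltr_pwDr => //; apply: mulr_ge0; first by apply: mulr_ge0 => //; exact: ltW.
  by apply: addr_ge0 => //; apply: mulr_ge0.
move=> T x y T1 hy hx1 hx2; set r := enorm (B *m x) in hx1 hx2 *.
have T0 : 0 < T by lra.
have r0 : 0 < r by lra.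
pose mu := lens_mu T.
have E : fourth_diff (psi T B) x y = fourth_diff (fun z => mu (enorm (B *m z) ^+ 2)) x y.
  apply: fourth_diff_eq => s hs; have /andP[h1 h2] := enorm_line x hy hs.
  rewrite /psi /mu /lens_mu /V ifT; last by rewrite -/r in h1 h2; lra.
  by rewrite powR12_sqrt ?sqr_ge0 // sqrtr_sqr ger0_norm ?enorm_ge0 // (mulrC 2^-1).
set q := Num.sqrt (T * (2 * T - r)).
have q0 : 0 < q by rewrite sqrtr_gt0 mulr_gt0 //; lra.
pose S := S0 * (T ^+ n.-1 * T ^- 2 / q) * r^-1.
have hyp t : (r - 2 * c) ^+ 2 <= t <= (r + 2 * c) ^+ 2 ->
    [/\ t `^ 1 < 4 * T ^+ 2, is_derive t 1 mu (- kap * Pf 1 (4 * T ^+ 2) (- 2^-1) b t) &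
      `|b * (b - 1)| * Pf 1 (4 * T ^+ 2) (- 2^-1 + 1 + 1 - 2) (b - 2) t <= S].
  move=> /andP[t1 t2].
  have tlo : (r / 2) ^+ 2 <= t by apply: le_trans t1; rewrite lerXn2r ?nnegrE; lra.
  have t0 : 0 < t by apply: lt_le_trans tlo; rewrite exprn_gt0 // divr_gt0.
  (* Since 2c <= T - r/2, one has t <= (T + r/2)^2, which for r <= 2T is at most 4T^2 - T(2T -
     r). *)
  have tX : t <= 4 * T ^+ 2 - T * (2 * T - r).
    apply: le_trans t2 _; have : r + 2 * c <= T + r / 2 by lra.
    move=> h; apply: (@le_trans _ _ ((T + r / 2) ^+ 2)); first by rewrite lerXn2r ?nnegrE; lra.
    nra.
  have Tr : 0 < T * (2 * T - r) by rewrite mulr_gt0 //; lra.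
  have tX' : t `^ 1 < 4 * T ^+ 2 by rewrite powRr1 ?(ltW t0) //; lra.
  split; [exact: tX' | exact: lens_deriv | ].
  by apply: edge_power => //; lra.
have := hC _ _ B mu (4 * T ^+ 2) (- kap) S x y hy; rewrite -/r => /(_ _ _ hyp).
rewrite -E normrN (ger0_norm kap0) => h.
apply: le_trans (h _ _) _; [lra|lra|].
have e1 : r `^ (2 * - 2^-1 - 1) * (4 * T ^+ 2) `^ b = 4 `^ b * (T ^+ n / r ^+ 2).
  rewrite powRM ?sqr_ge0 // (_ : 2 * - 2^-1 - 1 = - 2%:R :> R); last by field.
  rewrite powR_invn ?(ltW r0) // -[T ^+ 2]powR_mulrn ?(ltW T0) // -powRrM.
  rewrite /b (_ : 2%:R * (n%:R / 2) = n%:R :> R); last by field.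
  by rewrite powR_mulrn ?(ltW T0) //; ring.
have e2 : S * r ^+ 3 <= 4 * S0 * (T ^+ n.-1 / q).
  rewrite /S -subr_ge0.
  have -> : 4 * S0 * (T ^+ n.-1 / q) - S0 * (T ^+ n.-1 * T ^- 2 / q) * r^-1 * r ^+ 3 =
    S0 * (T ^+ n.-1 / q) * T ^- 2 * (4 * T ^+ 2 - r ^+ 2).
    by field; rewrite ?gt_eqF.
  rewrite !mulr_ge0 ?invr_ge0 ?exprn_ge0 ?(ltW T0) ?(ltW q0) // subr_ge0.
  rewrite (_ : 4 * T ^+ 2 = (2 * T) ^+ 2); last by ring.
  by rewrite lerXn2r ?nnegrE; lra.
rewrite e1.
set P := T ^+ n / r ^+ 2; set P' := T ^+ n.-1 / q in e2 *.
have P0 : 0 <= P by rewrite mulr_ge0 ?invr_ge0 ?exprn_ge0 ?(ltW T0) ?(ltW r0).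
have P0' : 0 <= P' by rewrite mulr_ge0 ?invr_ge0 ?exprn_ge0 ?(ltW T0) ?(ltW q0).
have CK : 0 <= C * kap by rewrite mulr_ge0 // ltW.
have h1 : 4 `^ b * P + S * r ^+ 3 <= 4 `^ b * P + 4 * S0 * P' by rewrite lerD2l.
have h2 := ler_wpM2l CK h1; rewrite mulrA; apply: le_trans h2 _.
rewrite -subr_ge0.
have -> : (C * kap * (4 `^ b + 4 * S0) + 1) * (P + P') - C * kap * (4 `^ b * P + 4 * S0 * P') =
  C * kap * (4 `^ b * P' + 4 * S0 * P) + (P + P') by ring.
by rewrite addr_ge0 ?addr_ge0 // mulr_ge0 // addr_ge0 // mulr_ge0 // mulr_ge0.
Qed.

End PsiDifferences.

(** * The lattice sum of the autocorrelation *)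

Section PsiSum.
Context {R : realType}.

(** Telescoping: 1/sqrt(x) <= 2 (sqrt(x) - sqrt(x-1)) for x >= 1. *)
Lemma sum_inv_sqrt (X : R) (J : nat) :
  \sum_(j < J) ((j%:R + 1 <= X)%R%:R / Num.sqrt (X - j%:R)) <=
    2 * (Num.sqrt X - Num.sqrt (X - J%:R)).
Proof.
elim: J => [|J IHJ]; first by rewrite big_ord0 subr0 subrr mulr0.
rewrite big_ord_recr /=; apply: le_trans (lerD IHJ (lexx _)) _.
case: (boolP (J%:R + 1 <= X)) => h; last first.
  rewrite mul0r addr0 ler_wpM2l // lerB // ler_wsqrtr // lerB // ler_nat; lia.
rewrite mul1r -[J.+1%:R]natr1; set a := Num.sqrt (X - J%:R); set b := Num.sqrt (X - (J%:R + 1)).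
have a0 : 0 < a by rewrite sqrtr_gt0; lra.
have b0 : 0 <= b by exact: sqrtr_ge0.
have ab : b <= a by rewrite ler_wsqrtr //; lra.
have E : a ^+ 2 - b ^+ 2 = 1 by rewrite !sqr_sqrtr; lra.
have : a^-1 <= 2 * (a - b).
  rewrite -(ler_pM2r a0) mulVf ?gt_eqF //; nra.
lra.
Qed.

Lemma sum_count_ge (L : R) (J : nat) :
  \sum_(j < J) (L <= j%:R)%R%:R <= Num.max 0 (J%:R - L).
Proof.
elim: J => [|J IHJ]; first by rewrite big_ord0 le_max lexx.
rewrite big_ord_recr /=; apply: le_trans (lerD IHJ (lexx _)) _.
rewrite -[J.+1%:R]natr1; case: (leP L J%:R) => h.
  by rewrite -[true%:R]/1 max_r ?subr_ge0 // max_r; lra.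
by rewrite addr0 max_l ?le_max ?lexx // subr_le0 ltW.
Qed.

Variables (n : nat) (B : 'M[R]_(1 + n)).
Hypotheses (n2 : (1 < n)%N) (uB : B \in unitmx).

(** The first term sums to T^n times O(T^(n-1)). In the second, T^(n-1) (1+j)^n is O(T^(2n-1)), and
    what multiplies it sums to O(1): there are boundedly many edge shells, and the inverse square
    roots are summed by [sum_inv_sqrt]. *)
Lemma psi_weights (c : R) : 0 < c -> exists2 C : R, 0 < C & forall T, 1 <= T ->
  \sum_(j < (Num.truncn (2 * T + 2 * c)).+1) (1 + j%:R) ^+ n *
     (T ^+ n / (1 + j%:R) ^+ 2 + T ^+ n.-1 *
       ((2 * T - (4 * c + 2) <= j%:R)%R%:R + (j%:R + 1 <= 2 * T)%R%:R / Num.sqrt (T * (2 * T - j%:R))))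
  <= C * T ^+ (2 * n).-1.
Proof.
move=> c0; pose E := 3 + 2 * c.
have E0 : 0 < E by rewrite /E; lra.
exists (E ^+ n.-1 + E ^+ n * (6 * c + 7)).
  by rewrite ltr_wpDr ?exprn_gt0 // mulr_ge0 ?exprn_ge0 //; lra.
move=> T T1; set J := Num.truncn _; have T0 : 0 < T by lra.
have JT : J%:R <= 2 * T + 2 * c by rewrite truncn_le; lra.
have J1 : 1 + J%:R <= E * T by rewrite /E; nra.
have jE (j : 'I_J.+1) : 1 + j%:R <= E * T.
  by apply: le_trans J1; rewrite lerD2l ler_nat -ltnS.
have j1 (j : 'I_J.+1) : 0 < 1 + j%:R :> R by rewrite ltr_pwDl.
pose g (j : nat) : R := (2 * T - (4 * c + 2) <= j%:R)%R%:R +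
   (j%:R + 1 <= 2 * T)%R%:R / Num.sqrt (T * (2 * T - j%:R)).
have g0 j : 0 <= g j by rewrite addr_ge0 // mulr_ge0 ?invr_ge0 ?sqrtr_ge0.
apply: (@le_trans _ _ (\sum_(j < J.+1) (T ^+ n * (E * T) ^+ n.-2 + T ^+ n.-1 * (E * T) ^+ n * g j))).
  apply: ler_sum => j _; rewrite mulrDr; apply: lerD.
    rewrite mulrCA ler_wpM2l ?exprn_ge0 ?(ltW T0) //.
    have -> : n = (n.-2 + 2)%N by have := n2; lia.
    rewrite exprD mulfK ?expf_neq0 ?gt_eqF // addn2 /=.
    by rewrite lerXn2r ?nnegrE ?(ltW (j1 j)) // (le_trans (ltW (j1 j))).
  rewrite mulrCA -[leRHS]mulrA ler_wpM2l ?exprn_ge0 ?(ltW T0) // //; apply: ler_wpM2r; first exact: g0.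
  by rewrite lerXn2r ?nnegrE ?(ltW (j1 j)) // (le_trans (ltW (j1 j))).
rewrite big_split /= sumr_const card_ord -[_ *+ J.+1]mulr_natr -mulr_sumr.
have G : \sum_(j < J.+1) g j <= 6 * c + 7.
  rewrite big_split /=.
  have h1 := sum_count_ge (2 * T - (4 * c + 2)) J.+1.
  have h2 : Num.max 0 (J.+1%:R - (2 * T - (4 * c + 2))) <= 6 * c + 3.
    by rewrite ge_max -[J.+1%:R]natr1; apply/andP; split; lra.
  have h3 : \sum_(j < J.+1) ((j%:R + 1 <= 2 * T)%R%:R / Num.sqrt (T * (2 * T - j%:R))) <= 4.
    have sT : 0 < Num.sqrt T by rewrite sqrtr_gt0.
    apply: (@le_trans _ _ ((Num.sqrt T)^-1 * (2 * Num.sqrt (2 * T)))).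
      have := sum_inv_sqrt (2 * T) J.+1; have := sqrtr_ge0 (2 * T - J.+1%:R) => h4 h5.
      apply: (@le_trans _ _ ((Num.sqrt T)^-1 *
         \sum_(j < J.+1) ((j%:R + 1 <= 2 * T)%R%:R / Num.sqrt (2 * T - j%:R)))); last first.
        by rewrite ler_wpM2l ?invr_ge0 ?(ltW sT) //; lra.
      rewrite mulr_sumr; apply: ler_sum => j _.
      by rewrite sqrtrM ?(ltW T0) // invfM mulrCA.
    have -> : (Num.sqrt T)^-1 * (2 * Num.sqrt (2 * T)) = 2 * Num.sqrt 2.
      by rewrite sqrtrM //; field; rewrite gt_eqF.
    have : Num.sqrt 2 <= 2 :> R.
      rewrite -[leRHS]ger0_norm // -sqrtr_sqr ler_wsqrtr //; lra.
    lra.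
  lra.
have e1 : (E * T) ^+ n.-2 * J.+1%:R <= (E * T) ^+ n.-1.
  have -> : n.-1 = n.-2.+1 by have := n2; lia.
  by rewrite exprSr ler_wpM2l ?exprn_ge0 ?mulr_ge0 ?(ltW E0) ?(ltW T0) // -[J.+1%:R]natr1 addrC.
have e2 : T ^+ n * T ^+ n.-1 = T ^+ (2 * n).-1 by rewrite -exprD; congr (_ ^+ _); have := n2; lia.
rewrite [leRHS]mulrDl; apply: lerD.
  rewrite -mulrA; apply: le_trans (ler_wpM2l _ e1) _; first by rewrite exprn_ge0 // ltW.
  by rewrite exprMn mulrCA e2.
have e3 : 0 <= T ^+ n.-1 * (E * T) ^+ n by rewrite mulr_ge0 ?exprn_ge0 ?mulr_ge0 ?(ltW E0) ?(ltW T0).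
apply: le_trans (ler_wpM2l e3 G) _.
by rewrite -e2 exprMn le_eqVlt; apply/orP; left; apply/eqP; ring.
Qed.

(** [riemann_sum] applied to [psi], whose integral is the squared volume. The weight of k depends
    only on its shell and combines the regimes near the origin, intermediate and near the edge;
    beyond the edge it is 0. *)
Lemma psi_riemann : exists C K : R, [/\ 0 < C, 0 < K & forall T N, 1 <= T -> K * T <= N%:R ->
  `| \sum_(p <- bxs (1 + n) N) psi T B (zpt p) - (bvol B * T ^+ (1 + n)) ^+ 2 | <= C * T ^+ (2 * n).-1].
Proof.
have [c c0 hc] := mulmx_bound B.
have [K K0 hK] := unitmx_bound uB.
have [Cs [Ks [Cs0 Ks0 hS]]] := shell_sum uB.
have [Cw Cw0 hw] := psi_weights c0.
have c10 : 0 <= 4 * c + 1 by lra.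
have [C2 C20 h2] := psi_diff_edge n2 c0 uB c10.
have [C3 C30 h3] := psi_diff_mid n2 c0 uB.
have L0 := lensc_ge0 B.
pose C1 := 4 * c * lensc B.
have C10 : 0 <= C1 by rewrite mulr_ge0 // mulr_ge0 // ltW.
(* Near the origin 1 + j <= 4c + 2, so the bound C1 T^n is absorbed into T^n / (1+j)^2. The factor 4
   pays for replacing |Bk| by its integer part in the intermediate range. *)
pose CC := C1 * (4 * c + 2) ^+ 2 + C2 + 4 * C3.
have CC0 : 0 < CC.
  have := mulr_ge0 C10 (sqr_ge0 (4 * c + 2)); rewrite /CC; lra.
exists (Cs * (CC * Cw)), (2 * K + 1 + Ks * (2 * c + 4)); split.
- by rewrite !mulr_gt0.
- have : 0 <= Ks * (2 * c + 4) by apply: mulr_ge0; lra.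
  lra.
move=> T N T1 hN; have T0 : 0 < T by lra.
set J := Num.truncn (2 * T + 2 * c).
have JT : J%:R <= 2 * T + 2 * c by rewrite truncn_le; lra.
pose w (j : nat) : R := CC * (T ^+ n / (1 + j%:R) ^+ 2 + T ^+ n.-1 *
   ((2 * T - (4 * c + 2) <= j%:R)%R%:R + (j%:R + 1 <= 2 * T)%R%:R / Num.sqrt (T * (2 * T - j%:R)))).
have wa j : 0 <= T ^+ n / (1 + j%:R) ^+ 2 :> R by rewrite mulr_ge0 ?invr_ge0 ?exprn_ge0 ?addr_ge0 ?(ltW T0).
have wb j : 0 <= (j%:R + 1 <= 2 * T)%R%:R / Num.sqrt (T * (2 * T - j%:R)) :> R.
  by rewrite mulr_ge0 ?invr_ge0 ?sqrtr_ge0.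
have Tn : 0 <= T ^+ n.-1 by rewrite exprn_ge0 // ltW.
have w0 j : 0 <= w j.
  by rewrite mulr_ge0 ?(ltW CC0) // addr_ge0 // mulr_ge0 // addr_ge0.
have n0 : (0 < n)%N by exact: ltnW.
have tt1 (b : bool) : b -> b%:R = 1 :> R by case: b.
pose wk (k : 'cV[int]_(1 + n)) : R := if (nrad B k <= J)%N then w (nrad B k) else 0.
apply: (@le_trans _ _ (\sum_(k <- bxs (1 + n) N) wk k)).
  apply: riemann_sum.
  - exact: mfv_psi.
  - exact: psi_ge0.
  - exact: psi_even.
  - move=> x; rewrite /psi mulf_eq0 negb_or => /andP[_ Vx] i.
    have : enorm (B *m x) <= 2 * T by apply: contraNT Vx; rewrite -ltNge => /ltW /V_out ->.
    move=> hx; apply: le_trans (hK x i) _; apply: le_trans (ler_wpM2l (ltW K0) hx) _.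
    have : 0 <= Ks * (2 * c + 4) * T by rewrite !mulr_ge0 ?(ltW Ks0) ?(ltW T0) //; lra.
    by move: hN; nra.
  - move=> k _ y cy.
    have hy : enorm (B *m y) <= c.
      by rewrite -[leRHS]mulr1; apply: hc => // i; exact: cube_coord.
    have /andP[r1 r2] := nrad_itv B k.
    set j := nrad B k in r1 r2 *; set r := enorm (B *m zpt k) in r1 r2 *.
    rewrite /wk -/j; case: leqP => jJ; last first.
      rewrite (psi_diff_far c0 T0 hy) ?normr0 // -/r.
      have h0 : 0 <= 2 * T + 2 * c by lra.
      have /andP[_ h] := truncn_itv h0.
      by apply: le_trans (ltW h) _; apply: le_trans r1; rewrite ler_nat.
    have j0 : 0 <= j%:R :> R by [].
    have [rs|rs] := ltP r (4 * c + 1).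
      apply: le_trans (psi_diff_near _ T0 hy) _; rewrite -/C1.
       have h4 : C1 * T ^+ n <= C1 * (4 * c + 2) ^+ 2 * (T ^+ n / (1 + j%:R) ^+ 2).
         rewrite -mulrA ler_wpM2l // mulrCA ler_peMr ?exprn_ge0 ?(ltW T0) //.
        have jp : 0 < (1 + j%:R) ^+ 2 :> R by apply: exprn_gt0; lra.
        rewrite ler_pdivlMr // mul1r.
         by rewrite lerXn2r ?nnegrE; lra.
      apply: le_trans h4 _; rewrite /w mulrDr -[leLHS]addr0 lerD //; last first.
        by rewrite mulr_ge0 ?(ltW CC0) // mulr_ge0 // addr_ge0.
      by rewrite ler_wpM2r // /CC -addrA lerDl; lra.
    have [re|re] := leP r (2 * T - (4 * c + 1)); last first.
      apply: le_trans (h2 T _ y T1 hy (ltW re)) _.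
      rewrite /w (tt1 (2 * T - (4 * c + 2) <= j%:R)); last by lra.
      have h4 : C2 * T ^+ n.-1 <= CC * T ^+ n.-1.
        rewrite ler_wpM2r // /CC; have : 0 <= C1 * (4 * c + 2) ^+ 2 by rewrite mulr_ge0 ?sqr_ge0.
        by lra.
      apply: le_trans h4 _; rewrite ler_pM2l //.
      have h5 := mulr_ge0 Tn (wb j).
      by rewrite [X in _ + X]mulrDr mulr1; have := wa j; lra.
    apply: le_trans (h3 T _ y T1 hy rs re) _; rewrite -/r.
    have rp : 0 < r by lra.
    have h4 : T ^+ n / r ^+ 2 <= 4 * (T ^+ n / (1 + j%:R) ^+ 2).
      rewrite mulrCA ler_wpM2l ?exprn_ge0 ?(ltW T0) //.
      have jp : 0 < (1 + j%:R) ^+ 2 :> R by apply: exprn_gt0; lra.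
      rewrite ler_pdivlMr // mulrC ler_pdivrMr ?exprn_gt0 //.
      rewrite (_ : 4 * r ^+ 2 = (2 * r) ^+ 2); last by ring.
      by rewrite lerXn2r ?nnegrE; lra.
    have h5 : (Num.sqrt (T * (2 * T - r)))^-1 <=
       4 * ((j%:R + 1 <= 2 * T)%R%:R / Num.sqrt (T * (2 * T - j%:R))).
      rewrite (tt1 (j%:R + 1 <= 2 * T)) ?mul1r; last by lra.
      have p1 : 0 < T * (2 * T - r) by rewrite mulr_gt0 //; lra.
      have p2 : 0 < T * (2 * T - j%:R) by rewrite mulr_gt0 //; lra.
      have q1 : 0 < Num.sqrt (T * (2 * T - r)) by rewrite sqrtr_gt0.
      have q2 : 0 < Num.sqrt (T * (2 * T - j%:R)) by rewrite sqrtr_gt0.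
      rewrite ler_pdivlMr // mulrC ler_pdivrMr //.
      have -> : 4 = Num.sqrt (4 ^+ 2) :> R by rewrite sqrtr_sqr ger0_norm.
      by rewrite -sqrtrM ?sqr_ge0 // ler_wsqrtr // mulrCA ler_pM2l //; lra.
    have h6 := ler_wpM2l Tn h5.
    have h7 : T ^+ n / r ^+ 2 + T ^+ n.-1 / Num.sqrt (T * (2 * T - r)) <= 4 *
      (T ^+ n / (1 + j%:R) ^+ 2 + T ^+ n.-1 *
        ((2 * T - (4 * c + 2) <= j%:R)%R%:R + (j%:R + 1 <= 2 * T)%R%:R / Num.sqrt (T * (2 * T - j%:R)))).
      have : 0 <= T ^+ n.-1 * (2 * T - (4 * c + 2) <= j%:R)%R%:R by rewrite mulr_ge0.
      by move: h4 h6; rewrite !mulrDr !mulrA; lra.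
    apply: le_trans (ler_wpM2l (ltW C30) h7) _; rewrite mulrA /w ler_wpM2r //.
      by rewrite addr_ge0 // mulr_ge0 // addr_ge0.
    have hC1 : 0 <= C1 * (4 * c + 2) ^+ 2 by rewrite mulr_ge0 ?sqr_ge0.
    by rewrite /CC; lra.
  - exact: I_psi.
apply: le_trans (hS N J w _ _ w0 _) _ => //.
  have : 0 <= 2 * K * T by rewrite !mulr_ge0 // ltW.
  have h4 : Ks * (J%:R + 2) <= Ks * (2 * T + 2 * c + 2) by rewrite ler_pM2l //; lra.
  have h5 : Ks * (2 * T + 2 * c + 2) <= Ks * ((2 * c + 4) * T) by rewrite ler_pM2l //; nra.
  by move: hN; lra.
rewrite -!mulrA ler_pM2l //.
under eq_bigr do rewrite /w mulrCA.
by rewrite -mulr_sumr ler_pM2l //; exact: hw.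
Qed.

End PsiSum.

(** * Second moment of the count in translated ellipsoids *)

Section LatticeCount.
Context {R : realType}.

Lemma sub_sum_le (T : eqType) (s1 s2 : seq T) (a : T -> R) : uniq s1 -> uniq s2 ->
  {subset s1 <= s2} -> (forall x, 0 <= a x) -> \sum_(x <- s1) a x <= \sum_(x <- s2) a x.
Proof.
move=> u1 u2 s12 a0.
apply: (@le_trans _ _ (\sum_(x <- s2) (x \in s1)%:R * a x)); last first.
  by apply: ler_sum => x _; case: (x \in s1); rewrite ?mul1r ?mul0r.
rewrite -(@eq_supp_sum _ _ s1 s2 (fun x => (x \in s1)%:R * a x)) //.
  by rewrite big_seq [leRHS]big_seq; apply: ler_sum => x ->; rewrite mul1r.
by move=> x; case: (boolP (x \in s1)) => [/s12 -> //|_]; rewrite mul0r eqxx.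
Qed.

Lemma bxs_sub n N (l l' : 'cV[int]_n) : l \in bxs n N -> l' \in bxs n N ->
  l' - l \in bxs n (2 * N).
Proof.
rewrite !mem_bxs => /forallP hl /forallP hl'; apply/forallP => i; rewrite !mxE.
apply: le_trans (ler_normB _ _) _; apply: le_trans (lerD (hl' i) (hl i)) _.
by rewrite -PoszD addnn mul2n.
Qed.

Variables (n : nat) (B : 'M[R]_(1 + n)).
Hypotheses (n0 : (0 < n)%N) (uB : B \in unitmx).

Definition shifted_count N T y : R := \sum_(l <- bxs (1 + n) N) ballf B T (zpt l + y).

Lemma mfv_shifted_count N T : mfv (shifted_count N T).
Proof. by apply: mfv_sum => l; apply: mfv_shift; exact: mfv_ballf. Qed.

Lemma shifted_count_ge0 N T y : 0 <= shifted_count N T y.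
Proof. by rewrite sumr_ge0. Qed.

Let vol T : R := bvol B * T ^+ (1 + n).

Lemma second_moment N T : 0 < T ->
  (forall x, ballf B T x != 0 -> forall i, `|x i 0| <= N%:R - 1) ->
  (I (fun y => ((cube y)%:R * (shifted_count N T y - vol T) ^+ 2)%R) <=
    (\sum_(p <- bxs (1 + n) (2 * N)) psi T B (zpt p) - vol T ^+ 2)%:E)%E.
Proof.
move=> T0 supp; pose ch (y : 'cV[R]_(1 + n)) : R := (cube y)%:R.
have mch : mfv ch by exact: mfv_cube.
have ch0 y : 0 <= ch y by [].
set S := shifted_count N T; have mS : mfv S := mfv_shifted_count N T.
have S0 y : 0 <= S y := shifted_count_ge0 N T y.
have v0 : 0 <= vol T by rewrite mulr_ge0 ?bvol_ge0 // exprn_ge0 // ltW.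
have mb := mfv_ballf B T.
have I1 : I (fun y => ch y * S y) = (vol T)%:E.
  rewrite -(I_ball (ltn0Sn n) uB (ltW T0)) -(@tiling _ _ N 1 (ballf B T)) // -I_sum.
  - by apply: I_ext => y; rewrite /S /shifted_count mulr_sumr; apply: eq_bigr => k _; rewrite scale1r.
  - by move=> k; apply: mfvM => //; exact: mfv_aff1.
  - by move=> k y; rewrite mulr_ge0.
pose g (p : 'cV[int]_(1 + n)) x := ballf B T x * ballf B T (x + zpt p).
have mg p : mfv (g p).
  apply: mfvM => //; rewrite (_ : (fun _ => _) = fun x => ballf B T (zpt p + x)).
    exact: mfv_shift.
  by apply/funext => x; rewrite addrC.
have g0 p x : 0 <= g p x by rewrite mulr_ge0.
have gN p x : g p x != 0 -> forall i, `|x i 0| <= N%:R - 1.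
  by rewrite /g mulf_eq0 negb_or => /andP[h _]; exact: supp.
have mgk k p : mfv (fun y => ch y * g p (zpt k + y)).
  by apply: mfvM => //; apply: mfv_shift.
have I2 : (I (fun y => (ch y * S y ^+ 2)%R) <= (\sum_(p <- bxs (1 + n) (2 * N)) psi T B (zpt p))%:E)%E.
  apply: (@le_trans _ _ (I (fun y => \sum_(p <- bxs (1 + n) (2 * N))
     \sum_(l <- bxs (1 + n) N) ch y * g p (zpt l + y)))).
    apply: I_le.
    - by apply: mfvM => //; rewrite (_ : (fun _ => _) = fun x => S x * S x) //; exact: mfvM.
    - by apply: mfv_sum => p; exact: mfv_sum.
    - by move=> y; rewrite mulr_ge0 // sqr_ge0.
    - move=> y; rewrite exchange_big /=.
      rewrite expr2 {1}/S /shifted_count mulr_suml mulr_sumr big_seq [leRHS]big_seq.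
      apply: ler_sum => l lN; rewrite -mulr_sumr ler_wpM2l // /g -mulr_sumr ler_wpM2l //.
      rewrite /S /shifted_count.
      (* For fixed l the map from l' to the difference is injective into the doubled box. *)
      apply: (@le_trans _ _ (\sum_(p <- [seq l' - l | l' <- bxs (1 + n) N]) ballf B T (zpt l + y + zpt p))).
        rewrite [leRHS]big_map le_eqVlt; apply/orP; left; apply/eqP; apply: eq_bigr => l' _.
        by congr ballf; rewrite zptD zptN addrA addrAC (addrC (zpt l)) addrK addrC.
      apply: sub_sum_le => //.
      - by rewrite map_inj_uniq ?bxs_uniq //; exact: addIr.
      - exact: bxs_uniq.
      - by move=> _ /mapP[l' l'N ->]; exact: bxs_sub.
  rewrite I_sum; last by move=> p y; rewrite sumr_ge0 // => l _; rewrite mulr_ge0.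
    rewrite -sumEFin; apply: lee_sum => p _; rewrite -psiE //.
    rewrite I_sum; [|by move=> l; exact: mgk|by move=> l y; rewrite mulr_ge0].
    rewrite -[leRHS](@tiling _ _ N 1 (g p)) //; last exact: gN.
    by apply: lee_sum => l _; rewrite le_eqVlt; apply/orP; left; apply/eqP;
      apply: I_ext => y; rewrite scale1r.
  by move=> p; exact: mfv_sum.
set P := \sum_(p <- _) _ in I2 *.
set X := I _.
have mD : mfv (fun y => ch y * (S y - vol T) ^+ 2).
  apply: mfvM => //; rewrite (_ : (fun _ => _) = fun y => (S y - vol T) * (S y - vol T)) //.
  by apply: mfvM; apply: mfvB => //; exact: mfv_cst.
have D0 y : 0 <= ch y * (S y - vol T) ^+ 2 by rewrite mulr_ge0 // sqr_ge0.
(* The variance expansion, with the cross term on the left so that only nonnegative integrals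
   occur. *)
have E : (X + (2 * vol T ^+ 2)%:E <= (P + vol T ^+ 2)%:E)%E.
  have -> : (2 * vol T ^+ 2)%:E = I (fun y => 2 * vol T * (ch y * S y)).
    rewrite I_Z //; [by rewrite I1 -EFinM; congr EFin; ring | exact: mfvM | |].
    - by move=> y; rewrite mulr_ge0.
    - by rewrite mulr_ge0.
  rewrite -I_D //; last 2 first.
  - by apply: mfvM; [exact: mfv_cst | exact: mfvM].
  - by move=> y; rewrite mulr_ge0 // mulr_ge0.
  rewrite (@I_ext _ _ _ (fun y => ch y * S y ^+ 2 + vol T ^+ 2 * ch y)); last first.
    by move=> y; ring.
  rewrite I_D.
  - rewrite I_Z ?sqr_ge0 // /ch I_cube mule1 EFinD.
    by apply: leeD => //; exact: I2.
  - by apply: mfvM => //; rewrite (_ : (fun _ => _) = fun x => S x * S x) //; exact: mfvM.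
  - by apply: mfvM => //; exact: mfv_cst.
  - by move=> y; rewrite mulr_ge0 // sqr_ge0.
  - by move=> y; rewrite mulr_ge0 // sqr_ge0.
move: E; have : (0 <= X)%E by exact: I_ge0.
case: X => [x| |] //= _; rewrite -EFinD !lee_fin; lra.
Qed.

(** Chebyshev: a deviation of at least a throughout a box of volume (2h)^(1+n) inside the unit cube
    forces that much variance. *)
Lemma chebyshev_count N T a h : 0 < T -> 0 <= a -> 0 <= h <= 2^-1 ->
  (forall x, ballf B T x != 0 -> forall i, `|x i 0| <= N%:R - 1) ->
  (forall y, inbox (- h) h y -> a <= `|shifted_count N T y - vol T|) ->
  a ^+ 2 * (2 * h) ^+ (1 + n) <=
    \sum_(p <- bxs (1 + n) (2 * N)) psi T B (zpt p) - vol T ^+ 2.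
Proof.
move=> T0 a0 /andP[h0 h1] supp ha; rewrite -lee_fin.
apply: le_trans (second_moment T0 supp).
have -> : 2 * h = h - - h by ring.
rewrite EFinM -(I_inbox (1 + n)); last by lra.
rewrite -I_Z ?sqr_ge0 //; last exact: mfv_inbox.
apply: I_le.
- by apply: mfvM; [exact: mfv_cst | exact: mfv_inbox].
- apply: mfvM; first exact: mfv_cube.
  rewrite (_ : (fun _ => _) = fun y => (shifted_count N T y - vol T) * (shifted_count N T y - vol T)) //.
  by apply: mfvM; apply: mfvB; [exact: mfv_shifted_count | exact: mfv_cst | exact: mfv_shifted_count | exact: mfv_cst].
- by move=> y; rewrite mulr_ge0 // sqr_ge0.
move=> y; case: (boolP (inbox _ _ y)) => hy; last by rewrite mulr0 mulr_ge0 // sqr_ge0.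
have -> : cube y.
  apply/forallP => i; move/forallP: hy => /(_ i) /andP[y1 y2].
  by apply/andP; split; lra.
by rewrite mulr1 mul1r -[leRHS]real_normK ?num_real // lerXn2r ?nnegrE // ha.
Qed.

End LatticeCount.

(** * Improved ellipsoid count in dimension at least three *)

Section EllipsoidCount.
Context {R : realType}.
Variables (n : nat) (B : 'M[R]_(1 + n)).
Hypotheses (n2 : (1 < n)%N) (uB : B \in unitmx).

(** Solves 2n - 1 + eta (n+1) = 2 (n - eta): the Chebyshev bound and the volume lost by changing the
    radius are then both of order T^(n - eta). [powR_eta] records this balance. *)
Let eta : R := (n.+3)%:R^-1.

Lemma powR_eta (T : R) : 0 < T ->
  T ^+ (2 * n).-1 * T `^ (eta * (1 + n)%:R) = (T `^ (n%:R - eta)) ^+ 2.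
Proof.
move=> T0; rewrite -[RHS]powR_mulrn ?powR_ge0 // -powRrM -[T ^+ _]powR_mulrn ?(ltW T0) //.
rewrite -powRDp //; congr (_ `^ _).
have -> : ((2 * n).-1)%:R = 2 * n%:R - 1 :> R.
  have : ((2 * n).-1.+1)%:R = 2 * n%:R :> R.
    by rewrite -natrM; congr (_%:R); have := n2; lia.
  by rewrite -[(2 * n).-1.+1%:R]natr1 => <-; rewrite addrK.
have e1 : eta * (n%:R + 3) = 1.
  by rewrite /eta -natrD addn3 mulVf // pnatr_eq0.
by rewrite natrD; move: e1; lra.
Qed.

Lemma expXX_bound (T d : R) : 0 <= d -> d <= T ->
  (T + d) ^+ (1 + n) - (T - d) ^+ (1 + n) <= n.+1%:R * (2 * d) * (2 ^+ n * T ^+ n).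
Proof.
move=> d0 dT; apply: le_trans (subXX_le n _ _) _; [lra|lra|].
rewrite (_ : T + d - (T - d) = 2 * d); last by ring.
rewrite ler_wpM2l ?mulr_ge0 // -exprMn lerXn2r ?nnegrE; lra.
Qed.

(** An excess of lattice points at radius T survives at radius T + ch for every translation in a box
    of half-side h, and a deficit survives at T - ch. Chebyshev with the variance from [psi_riemann]
    bounds the part that survives; the rest is the volume between the two radii. *)
Lemma ellipsoid_count : exists C K : R, [/\ 0 < C, 0 < K &
  forall N T, 0 <= T -> K * (T + 1) <= N%:R ->
    `|cnt N B T - bvol B * T ^+ (1 + n)| <= C * (1 + T) `^ (n%:R - eta)].
Proof.
have n0 : (0 < n)%N := ltnW n2.
have [Ct [Kt [Ct0 Kt0 hCt]]] := cnt_trivial uB.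
have [Cv [Kv [Cv0 Kv0 hCv]]] := psi_riemann n2 uB.
have [c c0 hc] := mulmx_bound B.
have [K K0 hK] := unitmx_bound uB.
have v0 := bvol_ge0 B.
have eta0 : 0 < eta by rewrite invr_gt0.
have eta1 : eta <= 1 by rewrite invf_le1 // ler1n.
pose s : R := n%:R - eta.
have s0 : 0 <= s by rewrite subr_ge0 (le_trans eta1) // ler1n.
pose T0 : R := c + 1.
pose Cm := Num.sqrt (Cv * 2 ^+ (2 * n).-1).
pose C1 := bvol B * (n.+1%:R * c * 2 ^+ n) + Cm.
have C10 : 0 <= C1 by rewrite addr_ge0 ?sqrtr_ge0 // !mulr_ge0 // ?exprn_ge0 // ltW.
exists (Ct * (1 + T0) + C1), (Kt + Kv * (1 + c) + K * (1 + c) + 1); split.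
- by rewrite ltr_wpDr // mulr_gt0 // /T0; lra.
- have : 0 < Kv * (1 + c) by apply: mulr_gt0; lra.
  have : 0 < K * (1 + c) by apply: mulr_gt0; lra.
  by lra.
move=> N T Tge hN.
have s1 : 0 <= (1 + T) `^ s by exact: powR_ge0.
(* For bounded T the boundary-order bound suffices. From T0 = c + 1 on, the shrunken radius T - ch
   stays at least 1. *)
have [TT|TT] := ltP T T0.
  have h1 := hCt N T Tge; apply: le_trans (h1 _) _.
    have : 0 <= (Kv * (1 + c) + K * (1 + c) + 1) * (T + 1).
      by rewrite mulr_ge0 ?addr_ge0 ?mulr_ge0 ?addr_ge0 // ltW.
    by move: hN; lra.
  rewrite mulrDl -[leLHS]addr0 lerD ?mulr_ge0 // -mulrA ler_wpM2l ?(ltW Ct0) //.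
  have T1 : 1 <= 1 + T by lra.
  have e : (1 + T) ^+ n = (1 + T) `^ eta * (1 + T) `^ s.
    have -> : (1 + T) `^ eta * (1 + T) `^ s = (1 + T) `^ n%:R.
      by rewrite -powRDp; [congr (_ `^ _); rewrite /s; ring | lra].
    by rewrite powR_mulrn //; lra.
  rewrite e -/s ler_wpM2r //.
  apply: (@le_trans _ _ ((1 + T) `^ 1)); first exact: ler_powR.
  by rewrite powRr1; rewrite /T0 in TT *; lra.
have T1 : 1 <= T by rewrite /T0 in TT; lra.
have Tp : 0 < T by lra.
pose h := T `^ (- eta) / 2.
have p0 : 0 < T `^ (- eta) by rewrite powR_gt0.
have p1 : T `^ (- eta) <= 1.
  by rewrite -(powRr0 T) ler_powR // oppr_le0 ltW.
have h0 : 0 < h by rewrite divr_gt0.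
have h1 : h <= 2^-1 by rewrite /h; lra.
have ch : 0 <= c * h <= c by apply/andP; split; nra.
have hh : 0 <= h <= 2^-1 by rewrite (ltW h0).
have move y : inbox (- h) h y -> enorm (B *m y) <= c * h.
  move=> /forallP hy; apply: hc => [|i]; first exact: ltW.
  by have /andP[y1 y2] := hy i; rewrite ler_norml; apply/andP; split; lra.
(* the discrepancy [a] at a nearby radius persists on a box of side [2 h] *)
have key a T' : 1 <= T' -> T' <= 2 * T -> T' <= T + c -> 0 <= a ->
    (forall y, inbox (- h) h y -> a <= `|shifted_count B N T' y - bvol B * T' ^+ (1 + n)|) ->
    a <= Cm * T `^ s.
  move=> T'1 T'2 T'c a0 ha.
  have supp x : ballf B T' x != 0 -> forall i, `|x i 0| <= N%:R - 1.
    rewrite /ballf pnatr_eq0 eqb0 negbK => hx i; apply: le_trans (hK x i) _.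
    apply: le_trans (ler_wpM2l (ltW K0) (le_trans hx T'c)) _.
    have e1 : 0 <= (Kt + Kv * (1 + c)) * (T + 1).
      by rewrite mulr_ge0 ?addr_ge0 ?mulr_ge0 ?addr_ge0 // ltW.
    have e2 : K * (T + c) <= K * (1 + c) * (T + 1) by rewrite -mulrA ler_pM2l //; nra.
    by move: hN; lra.
  have := chebyshev_count n0 uB (lt_le_trans ltr01 T'1) a0 hh supp ha.
  have e3 : Kv * T' <= (2 * N)%:R.
    rewrite natrM; apply: le_trans (ler_wpM2l (ltW Kv0) T'c) _.
    have e1 : 0 <= (Kt + K * (1 + c)) * (T + 1).
      by rewrite mulr_ge0 ?addr_ge0 ?mulr_ge0 ?addr_ge0 // ltW.
    have e2 : Kv * (T + c) <= Kv * (1 + c) * (T + 1) by rewrite -mulrA ler_pM2l //; nra.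
    by have N0 : 0 <= N%:R :> R by []; move: hN; lra.
  move=> e4; have e5 := le_trans e4 (le_trans (ler_norm _) (hCv T' (2 * N)%N T'1 e3)).
  have e6 : T' ^+ (2 * n).-1 <= 2 ^+ (2 * n).-1 * T ^+ (2 * n).-1.
    by rewrite -exprMn lerXn2r ?nnegrE //; lra.
  have hE : (2 * h) ^+ (1 + n) = (T `^ (eta * (1 + n)%:R))^-1.
    rewrite /h mulrCA divff // mulr1 -powR_mulrn ?powR_ge0 // -powRrM mulNr powRN.
    by [].
  have q0 : 0 < T `^ (eta * (1 + n)%:R) by rewrite powR_gt0.
  have e7 : a ^+ 2 <= Cv * 2 ^+ (2 * n).-1 * (T `^ s) ^+ 2.
    move: e5; rewrite hE ler_pdivrMr // => e5; apply: le_trans e5 _.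
    by rewrite -(powR_eta Tp) mulrA ler_wpM2r ?(ltW q0) // -mulrA ler_pM2l.
  rewrite -(@ler_pXn2r _ 2) ?nnegrE ?mulr_ge0 ?sqrtr_ge0 ?powR_ge0 //.
  by rewrite exprMn sqr_sqrtr // mulr_ge0 ?exprn_ge0 // ltW.
have Ts : T `^ s <= (1 + T) `^ s by rewrite ge0_ler_powR ?nnegrE; lra.
have vol1 : bvol B * ((T + c * h) ^+ (1 + n) - (T - c * h) ^+ (1 + n)) <=
    bvol B * (n.+1%:R * c * 2 ^+ n) * T `^ s.
  rewrite -mulrA ler_wpM2l //; apply: le_trans (expXX_bound _ _) _; [lra|by rewrite /T0 in TT; lra|].
  have -> : T `^ s = T ^+ n * T `^ (- eta) by rewrite /s powRDp // powR_mulrn // ltW.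
  by rewrite /h le_eqVlt; apply/orP; left; apply/eqP; field.
have C1s : C1 * T `^ s <= (Ct * (1 + T0) + C1) * (1 + T) `^ s.
  apply: (@le_trans _ _ (C1 * (1 + T) `^ s)); first by rewrite ler_wpM2l.
  by rewrite ler_wpM2r // lerDr mulr_ge0 ?(ltW Ct0) // /T0; lra.
have monoV (t t' : R) : 0 <= t -> t <= t' -> bvol B * t ^+ (1 + n) <= bvol B * t' ^+ (1 + n).
  by move=> t0 tt; rewrite ler_wpM2l // lerXn2r ?nnegrE //; lra.
rewrite /T0 in TT.
have /andP[ch0 chc] := ch.
have m1 := monoV (T - c * h) T; have m2 := monoV T (T + c * h).
have {m1} m1 : bvol B * (T - c * h) ^+ (1 + n) <= bvol B * T ^+ (1 + n) by apply: m1; lra.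
have {m2} m2 : bvol B * T ^+ (1 + n) <= bvol B * (T + c * h) ^+ (1 + n) by apply: m2; lra.
have Cms : 0 <= Cm * T `^ s by rewrite mulr_ge0 ?sqrtr_ge0 ?powR_ge0.
rewrite mulrBr in vol1.
apply: le_trans C1s; rewrite /C1 mulrDl ler_norml; apply/andP; split.
  (* Lower bound: any translate by y of the smaller ellipsoid contains at most as many lattice
     points as the original, so its deficit is uniform in y. The upper bound is symmetric. *)
  have [ca|ca] := leP (bvol B * (T - c * h) ^+ (1 + n)) (cnt N B T); first by lra.
  suff : bvol B * (T - c * h) ^+ (1 + n) - cnt N B T <= Cm * T `^ s by lra.
  apply: (@key _ (T - c * h)); [lra|lra|lra|lra|move=> y hy].
  rewrite distrC; apply: le_trans _ (ler_norm _); rewrite lerD2l lerN2.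
  apply: ler_sum => l _; rewrite /ballf ler_nat.
  case: (boolP (enorm (B *m (zpt l + y)) <= T - c * h)) => // hl.
  suff -> : enorm (B *m zpt l) <= T by [].
  have := enorm_revB (B *m zpt l) (B *m y); rewrite -mulmxDr.
  by have := move y hy; lra.
have [ca|ca] := leP (cnt N B T) (bvol B * (T + c * h) ^+ (1 + n)); first by lra.
suff : cnt N B T - bvol B * (T + c * h) ^+ (1 + n) <= Cm * T `^ s by lra.
apply: (@key _ (T + c * h)); [lra|lra|lra|lra|move=> y hy].
apply: le_trans _ (ler_norm _); rewrite lerD2r.
apply: ler_sum => l _; rewrite /ballf ler_nat.
case: (boolP (enorm (B *m zpt l) <= T)) => // hl.
suff -> : enorm (B *m (zpt l + y)) <= T + c * h by [].
have := enormD (B *m zpt l) (B *m y); rewrite -mulmxDr.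
by have := move y hy; lra.
Qed.

End EllipsoidCount.

(** * The radial profile of the fibre volumes *)

Section Profile.
Context {R : realType}.

Lemma bernoulli_powR (u b : R) : 0 <= u <= 1 -> 1 <= b -> 1 - (1 - u) `^ b <= b * u.
Proof.
move=> /andP[u0 u1] b1; move: u1; rewrite le_eqVlt => /orP[/eqP ->|u1].
  by rewrite subrr powR0 ?gt_eqF //; lra.
have w : 0 < 1 - u by lra.
have := @mean_value_ineq R (fun t => t `^ b) (fun t => b * t `^ (b - 1)) (1 - u) 1 (1 - u) 1 b.
rewrite powR1 => /(_ _ _ _ _) h.
have {h} := h _ _ _ _.
rewrite [ `|1 - (1 - u)| ]ger0_norm; last by lra.
move=> h; apply: le_trans (ler_norm _) _.
have -> : b * u = b * (1 - (1 - u)) by ring.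
apply: h.
- by apply/andP; split; lra.
- by apply/andP; split; lra.
- by move=> t /andP[t1 _]; apply: is_derive1_powR; lra.
- move=> t /andP[t1 t2] _; rewrite ger0_norm ?mulr_ge0 ?powR_ge0 //; last by lra.
  rewrite -[leRHS]mulr1 ler_wpM2l //; first by lra.
  have e1 : 1 `^ (b - 1) = 1 :> R by rewrite powR1.
  by rewrite -[leRHS]e1 ge0_ler_powR ?nnegrE; lra.
Qed.

Lemma powR_subadd (x y a : R) : 0 <= x -> 0 <= y -> 0 < a -> a <= 1 ->
  (x + y) `^ a <= x `^ a + y `^ a.
Proof.
move=> x0 y0 a0 a1; have [xy|xy] := eqVneq (x + y) 0.
  by rewrite xy powR0 ?gt_eqF // addr_ge0 ?powR_ge0.
have s0 : 0 < x + y by rewrite lt0r xy addr_ge0.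
have h z : 0 <= z -> z <= x + y -> z / (x + y) <= (z / (x + y)) `^ a.
  move=> z0 zs; have q0 : 0 <= z / (x + y) by rewrite divr_ge0 // ltW.
  have q1 : z / (x + y) <= 1 by rewrite ler_pdivrMr // mul1r.
  move: q0; rewrite le_eqVlt => /orP[/eqP <-|q0]; first exact: powR_ge0.
  by rewrite -[leLHS]powRr1 ?(ltW q0) // ger_powR // q0.
have E z : 0 <= z -> z `^ a = (z / (x + y)) `^ a * (x + y) `^ a.
  by move=> z0; rewrite -powRM ?divr_ge0 ?(ltW s0) // divfK.
rewrite (E x x0) (E y y0) -mulrDl -[leLHS]mul1r ler_wpM2r ?powR_ge0 //.
have hx : x <= x + y by lra.
have hy : y <= x + y by lra.
apply: le_trans (lerD (h x x0 hx) (h y y0 hy)).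
by rewrite -mulrDl divff.
Qed.

(** The square root replaces the logarithm, which is relevant when q = 2; the resulting exponent 3/2
    + alpha is still sufficient. *)
Lemma sum_harmonic_sqrt (J : nat) : \sum_(j < J) (1 + j%:R : R)^-1 <= 2 * Num.sqrt J%:R.
Proof.
elim: J => [|J IHJ]; first by rewrite big_ord0 sqrtr0 mulr0.
rewrite big_ord_recr /=; apply: le_trans (lerD IHJ (lexx _)) _.
rewrite -[J.+1%:R]natr1 (addrC 1).
have J0 : 0 <= J%:R :> R by [].
set b := Num.sqrt J%:R; set a := Num.sqrt (J%:R + 1).
have b0 : 0 <= b by exact: sqrtr_ge0.
have ba : b <= a by rewrite ler_wsqrtr //; lra.
have a1 : 1 <= a by rewrite -[leLHS]sqrtr1 ler_wsqrtr //; lra.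
have ea : J%:R + 1 = a ^+ 2 by rewrite sqr_sqrtr //; lra.
have eb : J%:R = b ^+ 2 by rewrite sqr_sqrtr.
rewrite ea; have : (a ^+ 2)^-1 <= 2 * (a - b).
  rewrite -(ler_pM2r (_ : 0 < a ^+ 2)); last by rewrite exprn_gt0 //; lra.
  rewrite mulVf; last by rewrite expf_neq0 // gt_eqF //; lra.
  have e : (a - b) * (a + b) = 1 by rewrite eb in ea; lra.
  nra.
lra.
Qed.

Variables (alpha : R) (m : nat).
Hypotheses (al0 : 0 < alpha) (al1 : alpha <= 1) (m2 : (1 < m)%N).

Let b0 : R := 2 * m%:R / alpha.

(** The m-th power of the fibre radius over a point at distance s, extended by 0 beyond r; see
    [trad_prof]. *)
Definition prof (r s : R) : R := (s <= r)%R%:R * (r `^ alpha - s `^ alpha) `^ b0.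

Lemma prof_ge0 r s : 0 <= prof r s.
Proof. by rewrite mulr_ge0 ?powR_ge0. Qed.

Lemma b0_ge4 : 4 <= b0.
Proof.
have a0 := al0; have a1 := al1; rewrite /b0 ler_pdivlMr //.
have : 2 <= m%:R :> R by rewrite ler_nat.
by move=> h; nra.
Qed.

Lemma prof_out r s : r < s -> prof r s = 0.
Proof. by move=> rs; rewrite /prof leNgt rs mul0r. Qed.

Lemma prof_le r s t : 0 <= s -> s <= t -> prof r t <= prof r s.
Proof.
move=> s0 st; have [tr|tr] := leP t r; last by rewrite prof_out ?prof_ge0.
have b4 := b0_ge4; have a0 := al0.
rewrite /prof tr (le_trans st tr) !mul1r.
have h u v : 0 <= u -> u <= v -> u `^ alpha <= v `^ alpha.
  by move=> u0 uv; rewrite ge0_ler_powR ?nnegrE //; lra.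
have h1 := h s t s0 st; have h2 := h t r (le_trans s0 st) tr.
by rewrite ge0_ler_powR ?nnegrE //; lra.
Qed.

(** Bernoulli applied to 1 - (1 - (s/r)^alpha)^b0, after factoring out r^(2m). *)
Lemma prof_near r s : 1 <= r -> 0 <= s ->
  prof r 0 - prof r s <= b0 * s `^ alpha * r `^ (2 * m%:R - alpha).
Proof.
have an : alpha != 0 by rewrite gt_eqF.
move=> r1 s0; have b4 := b0_ge4; have a0 := al0.
have r0 : 0 < r by lra.
have p0 : prof r 0 = r `^ (2 * m%:R).
  rewrite /prof (ltW r0) mul1r (powR0 an) subr0 -powRrM.
  by congr (_ `^ _); rewrite /b0; field.
have e : r `^ (2 * m%:R - alpha) = r `^ (2 * m%:R) / r `^ alpha.
  by rewrite powRDp // powRN.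
have ra : 0 < r `^ alpha by rewrite powR_gt0.
have rm : 0 < r `^ (2 * m%:R) by rewrite powR_gt0.
have sa : 0 <= s `^ alpha by exact: powR_ge0.
have -> : b0 * s `^ alpha * r `^ (2 * m%:R - alpha) = r `^ (2 * m%:R) * (b0 * (s `^ alpha / r `^ alpha)).
  by rewrite e; ring.
have [sr|sr] := leP s r; last first.
  rewrite (prof_out sr) subr0 p0 -[leLHS]mulr1 ler_pM2l //.
  have : 1 <= s `^ alpha / r `^ alpha.
    by rewrite ler_pdivlMr // mul1r ge0_ler_powR ?nnegrE; lra.
  by nra.
have q1 : 0 <= s `^ alpha / r `^ alpha <= 1.
  rewrite divr_ge0 ?(ltW ra) //= ler_pdivrMr // mul1r.
  by rewrite ge0_ler_powR ?nnegrE; lra.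
have -> : prof r s = r `^ (2 * m%:R) * (1 - s `^ alpha / r `^ alpha) `^ b0.
  rewrite /prof sr mul1r (_ : r `^ alpha - s `^ alpha = r `^ alpha * (1 - s `^ alpha / r `^ alpha)).
    rewrite powRM ?(ltW ra) //; last by case/andP: q1; lra.
    by rewrite -powRrM; congr (_ `^ _ * _); rewrite /b0; field; rewrite gt_eqF.
  by field; rewrite gt_eqF.
rewrite p0 -[X in X - _]mulr1 -mulrBr ler_pM2l //.
apply: bernoulli_powR => //; lra.
Qed.

(** Subadditivity of t^alpha for alpha <= 1 gives r^alpha - s^alpha <= (r-s)^alpha, so the profile
    is bounded near the edge independently of r. *)
Lemma prof_edge r s d : 0 <= s -> 0 <= d -> r - d <= s -> prof r s <= d `^ (2 * m%:R).
Proof.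
move=> s0 d0 rd; have b4 := b0_ge4; have a0 := al0; have a1 := al1.
have [sr|sr] := leP s r; last by rewrite prof_out ?powR_ge0.
rewrite /prof sr mul1r.
have -> : d `^ (2 * m%:R) = (d `^ alpha) `^ b0.
  by rewrite -powRrM; congr (_ `^ _); rewrite /b0; field; rewrite gt_eqF.
have h : s `^ alpha <= r `^ alpha by rewrite ge0_ler_powR ?nnegrE; lra.
have h2 : r `^ alpha <= s `^ alpha + (r - s) `^ alpha.
  have -> : r = s + (r - s) by ring.
  rewrite {2}(_ : s + (r - s) = r); last by ring.
  by apply: powR_subadd; lra.
have h3 : (r - s) `^ alpha <= d `^ alpha by rewrite ge0_ler_powR ?nnegrE; lra.
by rewrite ge0_ler_powR ?nnegrE; lra.
Qed.

End Profile.

(** * The lattice sum of the profile *)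

Lemma norm_sub_itv (R : realDomainType) (p q u v : R) :
  u <= p -> v <= p -> q <= u -> q <= v -> `|u - v| <= p - q.
Proof. by move=> *; rewrite ler_norml; apply/andP; split; lra. Qed.

Section ProfileSum.
Context {R : realType}.
Variables (alpha : R) (m n : nat) (A : 'M[R]_(1 + n)).
Hypotheses (al0 : 0 < alpha) (al1 : alpha <= 1) (m2 : (1 < m)%N) (n0 : (0 < n)%N).
Hypothesis uA : A \in unitmx.

Let b0 : R := 2 * m%:R / alpha.

Definition radial_prof (r : R) (x : 'cV[R]_(1 + n)) : R := prof alpha m r (enorm (A *m x)).

Lemma mfv_radial_prof r : mfv (radial_prof r).
Proof.
apply: (@mfvM _ _ (fun x => (enorm (A *m x) <= r)%R%:R) (fun x => (r `^ alpha - enorm (A *m x) `^ alpha) `^ b0)).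
  by apply: mfv_natb; apply: mfv_le; [exact: mfv_enorm_mul | exact: mfv_cst].
apply: (@mfv_fun _ _ (fun x => r `^ alpha - enorm (A *m x) `^ alpha) (fun t => t `^ b0)).
  exact: measurable_powR.
apply: mfvB; first exact: mfv_cst.
apply: (@mfv_fun _ _ (fun x => enorm (A *m x)) (fun t => t `^ alpha)).
  exact: measurable_powR.
exact: mfv_enorm_mul.
Qed.

Lemma powR_2m (r : R) : 1 <= r -> r ^+ 2 <= r `^ (2 * m%:R - alpha).
Proof.
move=> r1; have a1 := al1; have r0 : 0 <= r by lra.
rewrite -powR_mulrn // ler_powR //.
have : 2 <= m%:R :> R by rewrite ler_nat.
lra.
Qed.

(** Here mu(t) = (r^alpha - t^(alpha/2))^b0, so e = alpha/2, a = e - 1, b = b0 - 1. As b0 >= 4, the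
    exponent b - 2 is positive and there is no blow-up at the edge. The exponent 2a - 1 = alpha - 3
    is at most -2, which yields the decay. *)
Lemma prof_diff_mid (c : R) : 0 < c -> exists2 C : R, 0 < C & forall r x y, 1 <= r ->
  enorm (A *m y) <= c -> 4 * c + 1 <= enorm (A *m x) -> enorm (A *m x) <= r - (4 * c + 1) ->
  `|fourth_diff (radial_prof r) x y| <= C * r `^ (2 * m%:R - alpha) / enorm (A *m x) ^+ 2.
Proof.
move=> c0; have a0 := al0; have a1 := al1; have b4 := b0_ge4 al0 al1 m2.
rewrite -/b0 in b4; have an : alpha != 0 by rewrite gt_eqF.
pose e : R := alpha / 2; pose a : R := e - 1; pose b : R := b0 - 1.
have ale0 : a <= 0 by rewrite /a /e; lra.
have b1 : 1 <= b by rewrite /b; lra.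
have [C C0 hC] := radial_Pf_diff e c0 ale0 b1.
pose D : R := `|b * (b - 1)| * 4^-1 `^ (a - 2).
have D0 : 0 <= D by rewrite mulr_ge0 ?powR_ge0.
exists (C * (b0 * e * (1 + D))).
  rewrite mulr_gt0 // mulr_gt0 //; last by lra.
  by rewrite mulr_gt0 // /e; lra.
move=> r x y r1 hy hx1 hx2; set s := enorm (A *m x) in hx1 hx2 *.
have r0 : 0 < r by lra.
have s0 : 0 < s by lra.
pose X := r `^ alpha.
have X0 : 0 < X by rewrite powR_gt0.
pose mu (t : R) := (X - t `^ e) `^ b0.
have E : fourth_diff (radial_prof r) x y = fourth_diff (fun z => mu (enorm (A *m z) ^+ 2)) x y.
  apply: fourth_diff_eq => u hu; have /andP[h1 h2] := enorm_line x hy hu.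
  rewrite /radial_prof /prof /mu -/b0.
  have -> : (enorm (A *m (x + u *: y)) <= r) = true by rewrite -/s in h1 h2; lra.
  rewrite mul1r; congr ((_ - _) `^ _).
  rewrite -powR_mulrn ?enorm_ge0 // -powRrM; congr (_ `^ _).
  by rewrite /e; field.
pose S : R := `|b * (b - 1)| * ((4^-1 * s ^+ 2) `^ (a - 2) * X `^ b).
have hyp t : (s - 2 * c) ^+ 2 <= t <= (s + 2 * c) ^+ 2 ->
    [/\ t `^ e < X, is_derive t 1 mu (- (b0 * e) * Pf e X a b t) &
      `|b * (b - 1)| * Pf e X (a + e + e - 2) (b - 2) t <= S].
  move=> /andP[t1 t2].
  have tlo : 4^-1 * s ^+ 2 <= t by apply: le_trans t1; nra.
  have t0 : 0 < t by apply: lt_le_trans tlo; rewrite mulr_gt0 ?exprn_gt0 ?invr_gt0.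
  have tr : t < r ^+ 2.
    by apply: le_lt_trans t2 _; rewrite ltr_pXn2r ?nnegrE //; lra.
  have tX : t `^ e < X.
    rewrite /X (_ : r `^ alpha = (r ^+ 2) `^ e).
      by apply: gt0_ltr_powR; rewrite ?nnegrE ?sqr_ge0 ?(ltW t0) // /e; lra.
    by rewrite -powR_mulrn ?(ltW r0) // -powRrM; congr (_ `^ _); rewrite /e; field.
  split; first exact: tX.
    have u0 : 0 < X - t `^ e by rewrite subr_gt0.
    have d1 := isD_B (isD_cst X t) (is_derive1_powR e t0).
    have d2 := @isD_comp R (fun u => u `^ b0) (fun t => X - t `^ e) t _ _ (is_derive1_powR b0 u0) d1.
    by apply: isD_eq d2 _; rewrite /Pf; ring.
  apply: ler_wpM2l => //.
  apply: le_trans (Pf_bound _ t0 tX _) _; first by rewrite /b; lra.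
  have -> : a + e + e - 2 = a - 2 + (e + e) by ring.
  have -> : X `^ b = X * X * X `^ (b - 2).
    have eb : b = 1 + (1 + (b - 2)) by ring.
    by rewrite [in LHS]eb !(powRDp _ _ X0) !powRr1 ?(ltW X0) // -mulrA; ring.
  rewrite (powRDp (a - 2) (e + e) t0) (powRDp e e t0) -mulrA ler_pM ?powR_ge0 ?mulr_ge0 ?powR_ge0 //.
    by apply: powR_le0 => //; [rewrite mulr_gt0 ?exprn_gt0 ?invr_gt0 | lra].
  rewrite ler_wpM2r ?powR_ge0 //.
  by rewrite ler_pM ?powR_ge0 // ltW.
have := hC _ _ A mu X (- (b0 * e)) S x y hy; rewrite -/s => /(_ _ _ hyp).
have be0 : 0 <= b0 * e by apply: mulr_ge0; rewrite /e; lra.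
rewrite -E normrN (ger0_norm be0).
move=> h; apply: le_trans (h _ _) _; [lra|lra|].
rewrite (_ : C * (b0 * e * (1 + D)) * r `^ (2 * m%:R - alpha) / s ^+ 2 =
  C * (b0 * e * ((1 + D) * (r `^ (2 * m%:R - alpha) / s ^+ 2)))); last by rewrite !mulrA.
rewrite ler_pM2l //; apply: ler_wpM2l => //.
have XE : X `^ b = r `^ (2 * m%:R - alpha).
  by rewrite /X -powRrM; congr (_ `^ _); rewrite /b /b0; field.
have e1 : S * s ^+ 3 = D * (s `^ (2 * a - 1) * X `^ b).
  rewrite /S powRM ?invr_ge0 ?sqr_ge0 // -[s ^+ 2]powR_mulrn ?(ltW s0) // -powRrM.
  have -> : s `^ (2 * a - 1) = s `^ (2%:R * (a - 2)) * s ^+ 3.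
    by rewrite -powR_mulrn ?(ltW s0) // -powRDp //; congr (_ `^ _); ring.
  rewrite /D; ring.
have e2 : s `^ (2 * a - 1) <= (s ^+ 2)^-1.
  rewrite -powR_invn ?(ltW s0) // ler_powR //; rewrite /a /e; lra.
rewrite e1 XE.
have r2 : 0 <= r `^ (2 * m%:R - alpha) by exact: powR_ge0.
rewrite -[X in X + _]mul1r -mulrDl ler_wpM2l //; first by lra.
by rewrite mulrC ler_wpM2l.
Qed.

(** Three regimes again: the oscillation bound [prof_near] at the origin, where |x|^alpha is
    singular, [prof_diff_mid] in between, and boundedness at the edge. *)
Lemma prof_diff (c : R) : 0 < c -> exists2 C : R, 0 < C & forall r x y, 1 <= r ->
  enorm (A *m y) <= c -> enorm (A *m x) <= r + 2 * c ->
  `|fourth_diff (radial_prof r) x y| <= C * r `^ (2 * m%:R - alpha) / (1 + enorm (A *m x)) ^+ 2.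
Proof.
move=> c0; have a0 := al0; have a1 := al1; have b4 := b0_ge4 al0 al1 m2.
have [C3 C30 h3] := prof_diff_mid c0.
pose s1 := 6 * c + 1; pose C1 := 2 * (b0 * s1 `^ alpha).
pose C2 := 4 * s1 `^ (2 * m%:R).
have C10 : 0 <= C1 by rewrite -/b0 in b4; apply: mulr_ge0 => //; apply: mulr_ge0; [lra | exact: powR_ge0].
have C20 : 0 <= C2 by rewrite mulr_ge0 // powR_ge0.
exists (C1 * (4 * c + 2) ^+ 2 + C2 * (2 * c + 2) ^+ 2 + 4 * C3).
  have h1 := mulr_ge0 C10 (sqr_ge0 (4 * c + 2)); have h2 := mulr_ge0 C20 (sqr_ge0 (2 * c + 2)).
  lra.
move=> r x y r1 hy hx; set s := enorm (A *m x) in hx *.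
have s0 : 0 <= s by exact: enorm_ge0.
have r0 : 0 < r by lra.
set P := r `^ (2 * m%:R - alpha); have P1 : r ^+ 2 <= P := powR_2m r1.
have P0 : 0 <= P by exact: powR_ge0.
have q0 : 0 < (1 + s) ^+ 2 by rewrite exprn_gt0 //; lra.
have p1 : 0 <= C1 * (4 * c + 2) ^+ 2 * P by apply: mulr_ge0 => //; apply: mulr_ge0 => //; exact: sqr_ge0.
have p2 : 0 <= C2 * (2 * c + 2) ^+ 2 * P by apply: mulr_ge0 => //; apply: mulr_ge0 => //; exact: sqr_ge0.
have p3 : 0 <= 4 * C3 * P by rewrite !mulr_ge0 // ltW.
rewrite ler_pdivlMr // !mulrDl.
have [sn|sn] := ltP s (4 * c + 1).
  have : `|fourth_diff (radial_prof r) x y| <= 2 * (b0 * s1 `^ alpha * P).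
    apply: fourth_diff_lip => u hu; have /andP[u1 u2] := enorm_line x hy hu; rewrite -/s in u1 u2.
    have s10 : 0 <= s1 by rewrite /s1; lra.
    apply: le_trans (prof_near al0 al1 m2 r1 s10); rewrite /radial_prof -/s.
    move: u1 u2; move: (enorm_ge0 (A *m (x + u *: y))).
    move: (enorm (A *m (x + u *: y))) => t t0 u1 u2.
    have ts1 : t <= s1 by rewrite /s1; lra.
    have ss1 : s <= s1 by rewrite /s1; lra.
    have g1 := prof_le al0 al1 m2 r (lexx 0) t0.
    have g2 := prof_le al0 al1 m2 r (lexx 0) s0.
    have g3 := prof_le al0 al1 m2 r t0 ts1.
    have g4 := prof_le al0 al1 m2 r s0 ss1.
    exact: norm_sub_itv g1 g2 g3 g4.
  move=> h; have h' : `|fourth_diff (radial_prof r) x y| <= C1 * P by rewrite /C1; lra.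
  have q1 : (1 + s) ^+ 2 <= (4 * c + 2) ^+ 2 by rewrite lerXn2r ?nnegrE; lra.
  have := ler_pM (normr_ge0 _) (ltW q0) h' q1.
  rewrite (_ : C1 * P * (4 * c + 2) ^+ 2 = C1 * (4 * c + 2) ^+ 2 * P); [lra | ring].
have [se|se] := leP s (r - (4 * c + 1)).
  have := h3 r x y r1 hy sn se; rewrite -/s -/P => h.
  have sp : 0 < s by lra.
  have q1 : (1 + s) ^+ 2 <= 4 * s ^+ 2.
    rewrite (_ : 4 * s ^+ 2 = (2 * s) ^+ 2); last by ring.
    by apply: lerXn2r; rewrite ?nnegrE; lra.
  have := ler_pM (normr_ge0 _) (ltW q0) h q1.
  rewrite (_ : C3 * P / s ^+ 2 * (4 * s ^+ 2) = 4 * C3 * P); first by lra.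
  by field; rewrite gt_eqF.
have : `|fourth_diff (radial_prof r) x y| <= 4 * s1 `^ (2 * m%:R).
  apply: fourth_diff_small => u hu; have /andP[u1 u2] := enorm_line x hy hu; rewrite -/s in u1 u2.
  rewrite ger0_norm; last exact: prof_ge0.
  by apply: prof_edge => //; rewrite ?enorm_ge0 // /s1; lra.
rewrite -/C2 => h.
(* At the edge (1+s)^2 is of order r^2, which [powR_2m] bounds by r^(2m - alpha). *)
have q1 : (1 + s) ^+ 2 <= (2 * c + 2) ^+ 2 * P.
  apply: (@le_trans _ _ (((2 * c + 2) * r) ^+ 2)); first by rewrite lerXn2r ?nnegrE; nra.
  by rewrite exprMn ler_wpM2l ?sqr_ge0.
have := ler_pM (normr_ge0 _) (ltW q0) h q1; rewrite mulrA; lra.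
Qed.

(** Shell j holds O((1+j)^(q-1)) points of weight r^(2m-alpha) / (1+j)^2. The sum is at most
    r^(2m-alpha) r^(q-2) times a harmonic sum, estimated by r^(1/2). *)
Lemma prof_riemann : exists C K : R, [/\ 0 < C, 0 < K & forall r N J, 1 <= r -> K * r <= N%:R ->
  I (radial_prof r) = J%:E ->
  `| \sum_(k <- bxs (1 + n) N) radial_prof r (zpt k) - J | <=
     C * r `^ ((1 + n)%:R + 2 * m%:R - 3 / 2 - alpha)].
Proof.
have [c c0 hc] := mulmx_bound A.
have [K K0 hK] := unitmx_bound uA.
have [Cs [Ks [Cs0 Ks0 hS]]] := shell_sum uA.
have [Cd Cd0 hd] := prof_diff c0.
pose E := 2 + 2 * c; have E0 : 0 < E by rewrite /E; lra.
exists (Cs * (4 * Cd * (E ^+ n.-1 * (2 * Num.sqrt E)))), (K + 1 + Ks * (2 * c + 3)); split.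
- by rewrite !mulr_gt0 // ?exprn_gt0 // sqrtr_gt0.
- have : 0 <= Ks * (2 * c + 3) by apply: mulr_ge0; lra.
  by lra.
move=> r N J r1 hN IJ; have r0 : 0 < r by lra.
set j0 := Num.truncn (r + 2 * c).
have h0 : 0 <= r + 2 * c by lra.
have /andP[t1 t2] := truncn_itv h0; rewrite -/j0 in t1 t2.
set P := r `^ (2 * m%:R - alpha); have P0 : 0 <= P by exact: powR_ge0.
pose w (j : nat) : R := 4 * Cd * P / (1 + j%:R) ^+ 2.
have w0 j : 0 <= w j.
  by rewrite mulr_ge0 ?invr_ge0 ?exprn_ge0 ?addr_ge0 // !mulr_ge0 // ltW.
pose wk (k : 'cV[int]_(1 + n)) : R := if (nrad A k <= j0)%N then w (nrad A k) else 0.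
apply: (@le_trans _ _ (\sum_(k <- bxs (1 + n) N) wk k)).
  apply: riemann_sum; last exact: IJ.
  - exact: mfv_radial_prof.
  - by move=> x; exact: prof_ge0.
  - by move=> x; rewrite /radial_prof mulmxN enormN.
  - move=> x hx i.
    have hr : enorm (A *m x) <= r by apply: contraNT hx; rewrite -ltNge => /prof_out; rewrite /radial_prof => ->.
    apply: le_trans (hK x i) _; apply: le_trans (ler_wpM2l (ltW K0) hr) _.
    have : 0 <= Ks * (2 * c + 3) * r by rewrite !mulr_ge0 ?(ltW Ks0) ?(ltW r0) //; lra.
    by move: hN; lra.
  - move=> k _ y cy.
    have hy : enorm (A *m y) <= c.
      by rewrite -[leRHS]mulr1; apply: hc => // i; exact: cube_coord.
    have /andP[r2 r3] := nrad_itv A k; rewrite /wk.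
    set j := nrad A k in r2 r3 *; set s := enorm (A *m zpt k) in r2 r3 *.
    case: leqP => jj; last first.
      have sr : r + 2 * c < s.
        by apply: lt_le_trans t2 _; apply: le_trans r2; rewrite ler_nat.
      have : `|fourth_diff (radial_prof r) (zpt k) y| <= 4 * 0; last by rewrite mulr0.
      apply: fourth_diff_small => u hu; have /andP[u1 u2] := enorm_line (zpt k) hy hu.
      by rewrite /radial_prof prof_out ?normr0 //; rewrite -/s in u1; lra.
    have [sc|sc] := leP s (r + 2 * c); last first.
      have : `|fourth_diff (radial_prof r) (zpt k) y| <= 4 * 0; last first.
        by rewrite mulr0 => /le_trans; apply; exact: w0.
      apply: fourth_diff_small => u hu; have /andP[u1 u2] := enorm_line (zpt k) hy hu.
      by rewrite /radial_prof prof_out ?normr0 //; rewrite -/s in u1; lra.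
    apply: le_trans (hd r _ y r1 hy sc) _; rewrite -/s -/P /w.
    have jp : 0 <= j%:R :> R by [].
    have CP : 0 <= Cd * P by rewrite mulr_ge0 // ltW.
    apply: (@le_trans _ _ (Cd * P / (1 + j%:R) ^+ 2)).
      apply: ler_wpM2l => //.
      have j1 : 0 < 1 + j%:R :> R by lra.
      have s1 : 0 < 1 + s by lra.
      rewrite lef_pV2 ?posrE ?exprn_gt0 //.
      by apply: lerXn2r; rewrite ?nnegrE; lra.
    rewrite ler_wpM2r ?invr_ge0 ?exprn_ge0 ?addr_ge0 //; lra.
apply: le_trans (hS N j0 w _ _ w0 _) _ => //.
  have h4 : Ks * (j0%:R + 2) <= Ks * (r + 2 * c + 2) by rewrite ler_pM2l //; lra.
  have h5 : Ks * (r + 2 * c + 2) <= Ks * ((2 * c + 3) * r) by rewrite ler_pM2l //; nra.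
  have h6 : 0 <= K * r by rewrite mulr_ge0 // ltW.
  by move: hN; lra.
rewrite -!mulrA ler_pM2l //.
have jE : j0%:R + 1 <= E * r by rewrite /E; nra.
have Er : 0 < E * r by rewrite mulr_gt0.
have nE : n = n.-1.+1 by rewrite prednK.
apply: (@le_trans _ _ (4 * Cd * P * ((E * r) ^+ n.-1 * (2 * Num.sqrt (E * r))))).
  apply: (@le_trans _ _ (4 * Cd * P * ((E * r) ^+ n.-1 * \sum_(j < j0.+1) (1 + j%:R)^-1))).
    rewrite !mulr_sumr; apply: ler_sum => j _.
    have jp : 0 < 1 + j%:R :> R by rewrite ltr_pwDl.
    have jq : 1 + j%:R <= E * r.
      by apply: le_trans jE; rewrite addrC lerD2r ler_nat -ltnS.
    rewrite /w {1}nE exprS.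
    have -> : (1 + j%:R) * (1 + j%:R) ^+ n.-1 * (4 * Cd * P / (1 + j%:R) ^+ 2) =
       4 * Cd * P * ((1 + j%:R) ^+ n.-1 * (1 + j%:R)^-1) by field; rewrite gt_eqF.
    rewrite ler_wpM2l ?mulr_ge0 ?(ltW Cd0) // ler_wpM2r ?invr_ge0 ?(ltW jp) //.
    by rewrite lerXn2r ?nnegrE ?(ltW jp) ?(ltW Er).
  rewrite ler_wpM2l ?mulr_ge0 ?(ltW Cd0) // ler_wpM2l ?exprn_ge0 ?(ltW Er) //.
  apply: le_trans (sum_harmonic_sqrt _) _; rewrite ler_wpM2l // ler_wsqrtr //.
  by rewrite -[j0.+1%:R]natr1.
rewrite exprMn sqrtrM ?(ltW E0) // -[Num.sqrt r]powR12_sqrt ?(ltW r0) //.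
have -> : r `^ ((1 + n)%:R + 2 * m%:R - 3 / 2 - alpha) = P * r ^+ n.-1 * r `^ 2^-1.
  rewrite /P -powR_mulrn ?(ltW r0) // -!powRDp //; congr (_ `^ _).
  by rewrite natrD {1}nE -[n.-1.+1%:R]natr1; field.
rewrite le_eqVlt; apply/orP; left; apply/eqP; ring.
Qed.

End ProfileSum.

(** * Slicing the homogeneous ball *)

Section QuasiBall.
Context {R : realType}.
Variables (alpha : R).
Hypothesis al0 : 0 < alpha.

(** The radius in the second layer of the slice of the ball of radius r above a point of norm s. *)
Definition trad (r s : R) : R := (r `^ alpha - s `^ alpha) `^ (2 / alpha).

Lemma quasi_ball (r u t : R) : 0 < r -> 0 <= u -> 0 <= t ->
  ((u `^ alpha + t `^ (alpha / 2)) `^ alpha^-1 <= r) = (u <= r) && (t <= trad r u).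
Proof.
move=> r0 u0 t0; have a0 := al0; have an : alpha != 0 by rewrite gt_eqF.
have S0 : 0 <= u `^ alpha + t `^ (alpha / 2) by rewrite addr_ge0 ?powR_ge0.
have powC (x : R) c : 0 <= x -> 0 < c -> (x `^ c) `^ c^-1 = x.
  by move=> x0 c0; rewrite -powRrM mulfV ?gt_eqF // powRr1.
have mono (c x y : R) : 0 < c -> 0 <= x -> 0 <= y -> (x `^ c <= y `^ c) = (x <= y).
  move=> c0 x0 y0; have [xy|yx] := leP x y; first by rewrite ge0_ler_powR ?nnegrE // ltW.
  by rewrite leNgt gt0_ltr_powR.
have -> : ((u `^ alpha + t `^ (alpha / 2)) `^ alpha^-1 <= r) =
    (u `^ alpha + t `^ (alpha / 2) <= r `^ alpha).
  by rewrite -[X in _ <= X](powC _ alpha) ?(ltW r0) // mono ?powR_ge0 // invr_gt0.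
have [ur|ru] := leP u r; last first.
  apply/negbTE; rewrite -ltNge; apply: (@lt_le_trans _ _ (u `^ alpha)).
    by rewrite gt0_ltr_powR // nnegrE // ltW.
  by rewrite lerDl powR_ge0.
have d0 : 0 <= r `^ alpha - u `^ alpha by rewrite subr_ge0 mono // ltW.
have h2 : 0 < alpha / 2 by rewrite divr_gt0.
rewrite -(mono (alpha / 2) t) ?powR_ge0 //= /trad -powRrM.
by rewrite (_ : 2 / alpha * (alpha / 2) = 1) ?powRr1 // ?lerBrDl //; field.
Qed.

Lemma trad_ge0 r s : 0 <= trad r s. Proof. exact: powR_ge0. Qed.

Lemma trad_le r s : 0 <= s <= r -> trad r s <= r ^+ 2.
Proof.
move=> /andP[s0 sr]; have a0 := al0; have an : alpha != 0 by rewrite gt_eqF.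
have r0 : 0 <= r := le_trans s0 sr.
rewrite -powR_mulrn // (_ : r `^ 2 = (r `^ alpha) `^ (2 / alpha)); last first.
  by rewrite -powRrM; congr (_ `^ _); field.
have sa : s `^ alpha <= r `^ alpha by rewrite ge0_ler_powR ?nnegrE // ltW.
apply: ge0_ler_powR; rewrite ?nnegrE ?powR_ge0 ?subr_ge0 //.
  by rewrite divr_ge0 // ltW.
by rewrite gerBl powR_ge0.
Qed.

Lemma trad_prof m r s : (s <= r)%R%:R * trad r s ^+ m = prof alpha m r s.
Proof.
rewrite /prof -powR_mulrn ?trad_ge0 // -powRrM; congr (_ * _ `^ _).
by rewrite mulrAC.
Qed.

End QuasiBall.

(** * Lattice count and volume as sum and integral over fibres *)

Section Assembly.
Context {R : realType} (q m : nat).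
Variables (alpha : R).
Hypothesis al0 : 0 < alpha.

Lemma NballE (M1 : 'M[R]_q) (M2 : 'M[R]_m) r x y : 0 < r ->
  (Nnorm alpha M1 M2 (x, y) <= r)%R%:R =
  (enorm (M1 *m x) <= r)%R%:R * ballf M2 (trad alpha r (enorm (M1 *m x))) y :> R.
Proof.
by move=> r0; rewrite /Nnorm quasi_ball ?enorm_ge0 // /ballf -natrM mulnb.
Qed.

(** Injectivity of k -> (L1 k, L2 l) in both indices identifies the finite set of lattice points
    with pairs of integer vectors. The box has size of order r^2 because the fibre radii reach
    r^2. *)
Lemma lattice_countE (M1 L1 : 'M[R]_q) (M2 L2 : 'M[R]_m) :
  M1 *m L1 \in unitmx -> M2 *m L2 \in unitmx -> L1 \in unitmx -> L2 \in unitmx ->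
  exists2 K : R, 0 < K & forall r N, 1 <= r -> K * r ^+ 2 <= N%:R ->
  (lattice_count alpha M1 M2 L1 L2 r)%:R =
    \sum_(k <- bxs q N) (enorm (M1 *m L1 *m zpt k) <= r)%R%:R *
       cnt N (M2 *m L2) (trad alpha r (enorm (M1 *m L1 *m zpt k))) :> R.
Proof.
move=> uA uB uL1 uL2.
have [K1 K10 hK1] := unitmx_bound uA; have [K2 K20 hK2] := unitmx_bound uB.
exists (K1 + K2); first by rewrite addr_gt0.
move=> r N r1 hN; have r0 : 0 < r by lra.
pose phi (kl : 'cV[int]_q * 'cV[int]_m) : vspaces R q m := (L1 *m zpt kl.1, L2 *m zpt kl.2).
have zinj n (k l : 'cV[int]_n) : zpt k = zpt l :> 'cV[R]_n -> k = l.
  by move=> /colP h; apply/colP => i; move: (h i); rewrite !mxE => /intr_inj.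
have phi_inj : injective phi.
  move=> [k l] [k' l'] [h1 h2].
  have := f_equal (mulmx (invmx L1)) h1; have := f_equal (mulmx (invmx L2)) h2.
  by rewrite !mulKmx // => /zinj -> /zinj ->.
pose P (g : vspaces R q m) := Nnorm alpha M1 M2 g <= r.
pose s := [seq phi kl | kl <- [seq (k, l) | k <- bxs q N, l <- bxs m N] & P (phi kl)].
have us : uniq s.
  rewrite map_inj_uniq // filter_uniq // allpairs_uniq ?bxs_uniq //.
  by move=> [? ?] [? ?].
have -> : lattice_count alpha M1 M2 L1 L2 r = size s.
  rewrite /lattice_count (_ : _ `&` _ = [set` [fset g in s]%fset]).
    by rewrite set_fsetK card_fseq undup_id.
  apply/seteqP; split => [g [[k [l ->]] gP]|g] /=.
    rewrite inE; apply/mapP; exists (k, l) => //; rewrite mem_filter (_ : P _ = true) //=.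
    have := @NballE M1 M2 r (L1 *m zpt k) (L2 *m zpt l) r0; rewrite (_ : _ <= _ = true) //.
    rewrite /ballf !mulmxA -natrM mulnb => /eqP.
    rewrite eqr_nat eq_sym eqb1 => /andP[h1 h2].
    have sr : 0 <= enorm (M1 *m L1 *m zpt k) <= r by rewrite enorm_ge0.
    have rr : r <= r ^+ 2 by rewrite expr2 ler_peMr // ltW.
    have p1 : 0 <= K1 * r ^+ 2 by rewrite mulr_ge0 ?sqr_ge0 // ltW.
    have p2 : 0 <= K2 * r ^+ 2 by rewrite mulr_ge0 ?sqr_ge0 // ltW.
    apply/allpairsP; exists (k, l); split=> //=; rewrite mem_bxs; apply/forallP => i.
      have := hK1 (zpt k) i; rewrite mxE -intr_norm => h3.
      rewrite -(ler_int R); apply: le_trans h3 _.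
      have := ler_wpM2l (ltW K10) h1; have := ler_wpM2l (ltW K10) rr; lra.
    have := hK2 (zpt l) i; rewrite mxE -intr_norm => h3.
    rewrite -(ler_int R); apply: le_trans h3 _.
    have := ler_wpM2l (ltW K20) h2; have := ler_wpM2l (ltW K20) (trad_le al0 sr); lra.
  rewrite inE => /mapP[[k l]]; rewrite mem_filter => /andP[gP _] ->.
  by split => //; exists k, l.
rewrite size_map size_filter -sum1_count natr_sum big_mkcond /=.
rewrite big_allpairs; apply: eq_bigr => k _; rewrite mulr_sumr; apply: eq_bigr => l _ /=.
have := @NballE M1 M2 r (L1 *m zpt k) (L2 *m zpt l) r0.
by rewrite /ballf !mulmxA => <-; rewrite -/(P (phi (k, l))); case: (P _).
Qed.

Lemma mfv_prof (M1 : 'M[R]_q) r : mfv (fun x => prof alpha m r (enorm (M1 *m x))).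
Proof.
apply: (@mfvM _ _ (fun x => (enorm (M1 *m x) <= r)%R%:R) (fun x => (r `^ alpha - enorm (M1 *m x) `^ alpha) `^ (2 * m%:R / alpha))).
  by apply: mfv_natb; apply: mfv_le; [exact: mfv_enorm_mul | exact: mfv_cst].
apply: (@mfv_fun _ _ (fun x => r `^ alpha - enorm (M1 *m x) `^ alpha) (fun t => t `^ (2 * m%:R / alpha))).
  exact: measurable_powR.
apply: mfvB; first exact: mfv_cst.
apply: (@mfv_fun _ _ (fun x => enorm (M1 *m x)) (fun t => t `^ alpha)).
  exact: measurable_powR.
exact: mfv_enorm_mul.
Qed.

(** Fubini over the two layers: each slice is an ellipsoid of radius [trad], whose volume is
    [bvol M2] times the profile. *)
Lemma volume_Nball (M1 : 'M[R]_q) (M2 : 'M[R]_m) r : (0 < m)%N -> M2 \in unitmx -> 0 < r ->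
  volume (Nball alpha M1 M2 r) = ((bvol M2)%:E * I (fun x => prof alpha m r (enorm (M1 *m x))))%E.
Proof.
move=> m0 uM2 r0.
pose b (z : 'cV[R]_(q + m)) := Nnorm alpha M1 M2 (usubmx z, dsubmx z) <= r.
have mb : mfv b.
  apply: mfv_le; last exact: mfv_cst.
  apply: (@mfv_fun _ _ (fun z : 'cV_(q + m) => enorm (M1 *m usubmx z) `^ alpha + enorm (M2 *m dsubmx z) `^ (alpha / 2)) (fun t => t `^ alpha^-1)).
    exact: measurable_powR.
  apply: mfvD.
    apply: (@mfv_fun _ _ (fun z : 'cV_(q + m) => enorm (M1 *m usubmx z)) (fun t => t `^ alpha)).
      exact: measurable_powR.
    rewrite (_ : (fun _ => _) = fun z => enorm (row_mx M1 0 *m z)); first exact: mfv_enorm_mul.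
    by apply/funext => z; rewrite -{2}[z]vsubmxK mul_row_col mul0mx addr0.
  apply: (@mfv_fun _ _ (fun z : 'cV_(q + m) => enorm (M2 *m dsubmx z)) (fun t => t `^ (alpha / 2))).
    exact: measurable_powR.
  rewrite (_ : (fun _ => _) = fun z => enorm (row_mx 0 M2 *m z)); first exact: mfv_enorm_mul.
  by apply/funext => z; rewrite -{2}[z]vsubmxK mul_row_col mul0mx add0r.
pose S := [set u : (q + m).-tuple (measurableTypeR R) | b (vec u)].
have mS : measurable S.
  rewrite (_ : S = (b \o @vec R _) @^-1` [set true]); last by apply/seteqP; split.
  by rewrite -[X in measurable X]setTI; apply: mb.
have -> : volume (Nball alpha M1 M2 r) = @mu R (q + m) S.
  transitivity (@lebesgue_tuple R (q + m) S); last first.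
    by apply/esym; exact: (f_equal (@^~ S) (@muE R (q + m))).
  refine (f_equal (@lebesgue_tuple R (q + m)) _); apply/seteqP; split => u; rewrite /S /b /Nball /=;
    rewrite (_ : (usubmx _, dsubmx _) = (\col_i tnth u (lshift m i), \col_j tnth u (rshift q j))) //;
    by congr pair; apply/colP => i; rewrite !mxE.
have -> : @mu R (q + m) S = I (fun z => (b z)%:R).
  rewrite /I /Int -[S in LHS]setIT -integral_indic //; apply: eq_integral => u _.
  rewrite indicE (_ : (u \in S) = b (vec u)) //.
  by apply/idP/idP; rewrite inE.
rewrite /I Int_cat; [|by apply: mfvE; exact: mfv_natb|by move=> x; rewrite lee_fin].
rewrite -Int_scal ?bvol_ge0 //; [|by apply: mfvE; exact: mfv_prof|by move=> x; rewrite lee_fin prof_ge0].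
congr Int; apply/funext => x.
transitivity (I (fun y => (enorm (M1 *m x) <= r)%R%:R * ballf M2 (trad alpha r (enorm (M1 *m x))) y)).
  by congr Int; apply/funext => y; rewrite /b col_mxKu col_mxKd NballE.
rewrite I_Z //; last exact: mfv_ballf.
rewrite I_ball ?trad_ge0 // -!EFinM -trad_prof; congr _%:E; ring.
Qed.

End Assembly.

(** * Homogeneity of the profile integral *)

Section Scaling.
Context {R : realType}.
Variables (alpha : R).
Hypothesis al0 : 0 < alpha.

Lemma powR_le1 (z : R) : 0 <= z -> z <= 1 -> z `^ alpha <= 1.
Proof.
move=> z0 z1; rewrite (_ : 1 = 1 `^ alpha); last by rewrite powR1.
by rewrite ge0_ler_powR ?nnegrE // ltW.
Qed.

Lemma prof_scale m r s : 0 < r -> 0 <= s ->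
  prof alpha m r s = r ^+ (2 * m) * prof alpha m 1 (r^-1 * s).
Proof.
move=> r0 s0; have an : alpha != 0 by rewrite gt_eqF.
have V0 : 0 <= r^-1 by rewrite invr_ge0 ltW.
have E : (s <= r) = (r^-1 * s <= 1) by rewrite ler_pdivrMl // mulr1.
rewrite /prof E; case: (boolP (r^-1 * s <= 1)) => sr.
  2: by move: (r ^+ (2 * m)) (_ `^ (_ / _)) (_ `^ (_ / _)) => u v w; rewrite !mul0r mulr0.
rewrite [LHS]mul1r [X in _ = _ * X]mul1r powR1; set z := r^-1 * s in sr *.
have z0 : 0 <= z by rewrite mulr_ge0.
have -> : s = r * z by rewrite /z mulVKf ?gt_eqF.
rewrite powRM ?(ltW r0) // -[X in X - _]mulr1 -mulrBr powRM ?powR_ge0 //; last first.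
  by rewrite subr_ge0; exact: powR_le1.
congr (_ * _); rewrite -powRrM -powR_mulrn ?(ltW r0) // natrM; congr (_ `^ _).
by field.
Qed.

Lemma prof_le1 m s : 0 <= s -> prof alpha m 1 s <= (s <= 1)%R%:R.
Proof.
move=> s0; rewrite /prof; case: (boolP (s <= 1)) => s1; last by rewrite mul0r.
have h := powR_le1 s0 s1; have h' := powR_ge0 s alpha.
rewrite mul1r powR1 (_ : 1%:R = 1 `^ (2 * m%:R / alpha)); last by rewrite powR1.
apply: ge0_ler_powR; rewrite ?nnegrE; [|lra|lra|lra].
by rewrite divr_ge0 ?mulr_ge0 // ltW.
Qed.

Lemma I_prof_fin q m (M1 : 'M[R]_q) : M1 \in unitmx ->
  exists J : R, I (fun x => prof alpha m 1 (enorm (M1 *m x))) = J%:E.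
Proof.
move=> uM; exists (fine (I (fun x => prof alpha m 1 (enorm (M1 *m x))))).
have p0 (x : 'cV[R]_q) : 0 <= prof alpha m 1 (enorm (M1 *m x)) by exact: prof_ge0.
rewrite fineK // ge0_fin_numE; last exact: I_ge0.
apply: (@le_lt_trans _ _ (I (ballf M1 1))); last by rewrite bvolE // ltry.
apply: I_le => //; [exact: mfv_prof | exact: mfv_ballf |].
by move=> x; apply: prof_le1; exact: enorm_ge0.
Qed.

(** The profile is homogeneous of degree 2m under joint dilation of r and x, and the substitution x
    -> L1 x / r contributes r^q / |det L1|. *)
Lemma I_prof_scale q m (M1 L1 : 'M[R]_q) r : L1 \in unitmx -> 0 < r ->
  I (fun x => prof alpha m r (enorm (M1 *m L1 *m x))) =
    ((r ^+ (q + 2 * m) / `|\det L1|)%:E * I (fun x => prof alpha m 1 (enorm (M1 *m x))))%E.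
Proof.
move=> uL r0; have rn : r != 0 by rewrite gt_eqF.
have uS : r^-1 *: L1 \in unitmx.
  by rewrite unitmxZ // unitfE invr_eq0.
set S := r^-1 *: L1 in uS *.
have h : I (fun x => prof alpha m 1 (enorm (M1 *m S *m x))) =
    ((`|\det S|^-1)%:E * I (fun x => prof alpha m 1 (enorm (M1 *m x))))%E.
  apply: etrans (I_linear uS (mfv_prof m alpha M1 1) (fun x => prof_ge0 _ _ _ _)).
  by apply: I_ext => x; rewrite mulmxA.
have r2 : 0 <= r ^+ (2 * m) by rewrite exprn_ge0 // ltW.
transitivity (I (fun x => r ^+ (2 * m) * prof alpha m 1 (enorm (M1 *m S *m x)))).
  apply: I_ext => x; rewrite (prof_scale m r0 (enorm_ge0 _)).
  by rewrite -scalemxAr -scalemxAl enormZ (gtr0_norm (_ : 0 < r^-1)) // invr_gt0.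
apply: etrans (I_Z (mfv_prof m alpha (M1 *m S) 1) (fun x => prof_ge0 _ _ _ _) r2) _.
apply: etrans (f_equal (mule _) h) _.
rewrite muleA -EFinM; congr (_%:E * _)%E.
have V0 : 0 <= r^-1 by rewrite invr_ge0 ltW.
rewrite /S detZ normrM (ger0_norm (exprn_ge0 q V0)) exprVn.
rewrite (invfM (r ^- q)) invrK exprD.
by rewrite mulrA [in RHS](mulrC (r ^+ q)).
Qed.

End Scaling.

(** * The error in the lattice count *)

Section CountError.
Context {R : realType}.

(** The saving in the exponent over the boundary order: none in the plane, 1/(m+2), that is [eta]
    with m = n + 1, in higher dimension. *)
Definition gain (m : nat) : R := if m == 2%N then 0 else (m%:R + 2)^-1.

Lemma bvol_mul n (M L : 'M[R]_n) : M \in unitmx -> L \in unitmx ->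
  bvol (M *m L) = bvol M / `|\det L|.
Proof.
move=> uM uL; have uML : M *m L \in unitmx by rewrite unitmx_mul uM uL.
apply: EFin_inj; rewrite -bvolE // EFinM -bvolE // muleC.
rewrite -(I_linear uL (mfv_ballf M 1) (ballf_ge0 M 1)).
by apply: I_ext => x; rewrite /ballf mulmxA.
Qed.

Lemma fiber_count m (B : 'M[R]_m) : (1 < m)%N -> B \in unitmx ->
  exists C K : R, [/\ 0 < C, 0 < K & forall N T, 0 <= T -> K * (T + 1) <= N%:R ->
    `|cnt N B T - bvol B * T ^+ m| <= C * (1 + T) `^ (m%:R - 1 - gain m)].
Proof.
case: m B => [|[|m]] B // _ uB; case: (posnP m) B uB => [->|m0] B uB.
  have [C [K [C0 K0 h]]] := cnt_trivial uB; exists C, K; split=> // N T T0 hN.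
  rewrite /gain eqxx subr0 (_ : 2%:R - 1 = 1); last by ring.
  by rewrite powRr1; [exact: h | lra].
have [C [K [C0 K0 h]]] := ellipsoid_count (m0 : (1 < m.+1)%N) uB.
exists C, K; split=> // N T T0 hN; apply: le_trans (h N T T0 hN) _.
rewrite le_eqVlt; apply/orP; left; apply/eqP; congr (_ * _ `^ _).
rewrite /gain ifF; last by case: m m0 {B uB h}.
have -> : m.+2%:R + 2 = (m.+1).+3%:R :> R by rewrite -natrD addn2.
by congr (_ - _); rewrite -[m.+2%:R]natr1 addrK.
Qed.

(** The first power is the number O(r^q) of fibres times the largest fibre error, with T <= r^2; the
    second is the error of [prof_riemann]. *)
Lemma count_error q m (alpha : R) (M1 L1 : 'M[R]_q) (M2 L2 : 'M[R]_m) :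
  (1 < q)%N -> (1 < m)%N -> 0 < alpha -> alpha <= 1 ->
  M1 \in unitmx -> L1 \in unitmx -> M2 \in unitmx -> L2 \in unitmx ->
  exists2 C : R, 0 < C & forall r J, 1 <= r ->
    I (fun x => prof alpha m r (enorm (M1 *m L1 *m x))) = J%:E ->
    `|(lattice_count alpha M1 M2 L1 L2 r)%:R - bvol (M2 *m L2) * J| <=
      C * (r `^ (q%:R + 2 * m%:R - 2 - 2 * gain m) + r `^ (q%:R + 2 * m%:R - 3 / 2 - alpha)).
Proof.
case: q M1 L1 => // n M1 L1 n0 m2 al0 al1 uM1 uL1 uM2 uL2.
set A := M1 *m L1; set B := M2 *m L2.
have uA : A \in unitmx by rewrite unitmx_mul uM1.
have uB : B \in unitmx by rewrite unitmx_mul uM2.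
have [K0 K00 hc] := lattice_countE al0 uA uB uL1 uL2.
have [Cf [Kf [Cf0 Kf0 hf]]] := fiber_count m2 uB.
have [Ca [Ka [Ca0 Ka0 ha]]] := cnt_trivial uA.
have [Cp [Kp [Cp0 Kp0 hp]]] := prof_riemann al0 al1 m2 (n0 : (0 < n)%N) uA.
have vA := bvol_ge0 A; have vB := bvol_ge0 B.
pose e : R := m%:R - 1 - gain m.
have mR : 2 <= m%:R :> R by rewrite ler_nat.
have e0 : 0 <= e.
  rewrite /e /gain; case: eqP => _; first by lra.
  have : (m%:R + 2)^-1 <= 1 :> R by rewrite invf_le1; lra.
  by lra.
pose C1 := Cf * 2 `^ e; have C10 : 0 < C1 by rewrite mulr_gt0 // powR_gt0.
pose C2 := bvol A + Ca * 2 ^+ n.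
have C20 : 0 < C2 by rewrite ltr_wpDl // mulr_gt0 // exprn_gt0.
exists (C1 * C2 + bvol B * Cp); first by rewrite ltr_pwDl ?mulr_gt0 // mulr_ge0 // ltW.
move=> r J r1 IJ; have r0 : 0 < r by lra.
have rr : r <= r ^+ 2 by rewrite expr2 ler_peMr // ltW.
have rr1 : 1 <= r ^+ 2 by lra.
pose KK := K0 + 2 * Kf + 2 * Ka + Kp.
pose N := (Num.truncn (KK * r ^+ 2)).+1.
have KK0 : 0 <= KK * r ^+ 2 by rewrite mulr_ge0 ?sqr_ge0 // /KK; lra.
have hN : KK * r ^+ 2 <= N%:R by have /andP[_ /ltW] := truncn_itv KK0.
have Kr (K : R) : 0 < K -> 0 <= K * r ^+ 2 by move=> K'; rewrite mulr_ge0 ?sqr_ge0 // ltW.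
have k0 := Kr _ K00; have k1 := Kr _ Kf0; have k2 := Kr _ Ka0; have k3 := Kr _ Kp0.
rewrite /KK !mulrDl -!mulrA in hN.
rewrite (hc r N r1); last by lra.
rewrite -/A -/B.
pose chi (k : 'cV[int]_(n.+1)) : R := ballf A r (zpt k).
pose T (k : 'cV[int]_(n.+1)) : R := trad alpha r (enorm (A *m zpt k)).
(* Fibre errors plus the lattice sum of the fibre volumes. *)
have -> : \sum_(k <- bxs n.+1 N) (enorm (A *m zpt k) <= r)%R%:R * cnt N B (trad alpha r (enorm (A *m zpt k))) =
   \sum_(k <- bxs n.+1 N) chi k * (cnt N B (T k) - bvol B * T k ^+ m) +
   bvol B * \sum_(k <- bxs n.+1 N) radial_prof alpha m A r (zpt k).
  rewrite mulr_sumr -big_split /=; apply: eq_bigr => k _.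
  by rewrite /radial_prof -trad_prof /chi /ballf -/(T k); ring.
set S1 := \sum_(_ <- _) _; set S2 := \sum_(_ <- _) _.
rewrite (_ : S1 + bvol B * S2 - bvol B * J = S1 + bvol B * (S2 - J)); last by ring.
apply: le_trans (ler_normD _ _) _; rewrite normrM (ger0_norm vB).
set E1 := r `^ _; set E2 := r `^ _.
have E10 : 0 <= E1 by exact: powR_ge0.
have E20 : 0 <= E2 by exact: powR_ge0.
have b2 : `|S2 - J| <= Cp * E2.
  rewrite /E2 (_ : n.+1%:R = (1 + n)%:R) //; apply: hp => //.
  by have := ler_wpM2l (ltW Kp0) rr; lra.
have b1 : `|S1| <= C1 * C2 * E1.
  have rq : 0 <= r ^+ n.+1 by rewrite exprn_ge0 // ltW.
  have cA : \sum_(k <- bxs n.+1 N) chi k <= C2 * r ^+ n.+1.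
    have h1 : Ka * (r + 1) <= N%:R by have := ler_wpM2l (ltW Ka0) rr; have := ler_wpM2l (ltW Ka0) rr1; lra.
    have := ha N r (ltW r0) h1; rewrite ler_norml => /andP[_].
    rewrite lerBlDr => /le_trans; apply.
    rewrite /C2 mulrDl addrC lerD2l -mulrA ler_pM2l //.
    apply: (@le_trans _ _ ((2 * r) ^+ n)); first by apply: lerXn2r; rewrite ?nnegrE; lra.
    by rewrite exprMn ler_wpM2l ?exprn_ge0 // exprS ler_peMl // exprn_ge0 // ltW.
  apply: (@le_trans _ _ (\sum_(k <- bxs n.+1 N) chi k * (C1 * r `^ (2 * e)))).
    apply: le_trans (ler_norm_sum _ _ _) _; apply: ler_sum => k _.
    rewrite normrM ger0_norm ?ballf_ge0 //.
    rewrite /chi /ballf; case: (boolP (enorm _ <= r)) => kr; last by rewrite !mul0r.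
    rewrite !mul1r.
    have T0 : 0 <= T k by exact: trad_ge0.
    have Tr : T k <= r ^+ 2 by apply: trad_le => //; rewrite enorm_ge0.
    have h1 : Kf * (T k + 1) <= N%:R.
      by have := ler_wpM2l (ltW Kf0) Tr; have := ler_wpM2l (ltW Kf0) rr1; lra.
    apply: le_trans (hf N (T k) T0 h1) _; rewrite -/e /C1 -mulrA ler_pM2l //.
    rewrite (_ : r `^ (2 * e) = (r ^+ 2) `^ e); last first.
      by rewrite -powR_mulrn ?(ltW r0) // -powRrM.
    rewrite -powRM ?sqr_ge0 //.
    by apply: ge0_ler_powR; rewrite ?nnegrE //; lra.
  rewrite -mulr_suml.
  have q0 : 0 <= C1 * r `^ (2 * e) by rewrite mulr_ge0 ?powR_ge0 // ltW.
  apply: le_trans (ler_wpM2r q0 cA) _.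
  rewrite /E1 (_ : n.+1%:R + _ - 2 - _ = n.+1%:R + 2 * e); last by rewrite /e; ring.
  rewrite powRDp // powR_mulrn ?(ltW r0) //.
  by rewrite le_eqVlt; apply/orP; left; apply/eqP; ring.
have := ler_wpM2l vB b2.
have : 0 <= C1 * C2 * E2 by rewrite mulr_ge0 // mulr_ge0 // ltW.
have : 0 <= bvol B * Cp * E1 by rewrite mulr_ge0 // mulr_ge0 // ltW.
rewrite !mulrA in b1 *; lra.
Qed.

End CountError.

(** * Comparison of exponents and conclusion *)

Section Exponent.
Context {R : realType}.

(** For m = 2 the first inequality reduces to (1-alpha)(Q-2) >= 0. For m >= 3 the extreme case is
    alpha = 1, where s = 2 + 2/(Q-1), and the gain 1/(m+2) suffices because m + 2 <= Q - 1. The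
    second inequality relies on Q >= 6. *)
Lemma exponent_bounds (q m : nat) (alpha : R) : (1 < q)%N -> (1 < m)%N -> 0 < alpha -> alpha <= 1 ->
  let Q : R := (hdim q m)%:R in
  let s := 2 * Q * alpha / (Q + 2 * alpha - 3 + (m == 2%N)%:R) in
  s <= 2 + 2 * @gain R m /\ s <= 3 / 2 + alpha.
Proof.
move=> q2 m2 a0 a1 Q s.
have qR : 2 <= q%:R :> R by rewrite ler_nat.
have mR : 2 <= m%:R :> R by rewrite ler_nat.
have QE : Q = q%:R + 2 * m%:R by rewrite /Q /hdim natrD natrM.
have b0 : 0 <= (m == 2%N)%:R :> R by [].
have D0 : 0 < Q + 2 * alpha - 3 + (m == 2%N)%:R by lra.
rewrite /s !ler_pdivrMr //; split; last first.
  have h1 : 0 <= (3 / 2 - alpha) * (Q - 6) by apply: mulr_ge0; lra.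
  have h2 : 0 <= (1 - alpha) * (2 - alpha) by apply: mulr_ge0; lra.
  have h3 : 0 <= (3 / 2 + alpha) * (m == 2%N)%:R by apply: mulr_ge0; lra.
  by nra.
rewrite /gain; case: eqP => [_|m3].
  have h1 : 0 <= (1 - alpha) * (Q - 2) by apply: mulr_ge0; lra.
  by rewrite mulr0 addr0 (_ : true%:R = 1) //; lra.
rewrite (_ : false%:R = 0) // addr0; set M : R := m%:R + 2; have M0 : 0 < M by rewrite /M; lra.
rewrite (_ : 2 + 2 * M^-1 = 2 * (M + 1) / M); last by field; rewrite gt_eqF.
rewrite [leRHS]mulrAC ler_pdivlMr //.
have h1 : 0 <= (1 - alpha) * ((M + 1) * (Q - 3)) by rewrite !mulr_ge0 //; lra.
have h2 : 0 <= alpha * (Q - 1 - M) by apply: mulr_ge0; rewrite /M; lra.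
by lra.
Qed.

End Exponent.

Theorem theorem1p4 (R : realType) (q m : nat) (hq : (2 <= q)%N) (hm : (2 <= m)%N)
    (alpha : R) (halpha0 : 0 < alpha) (halpha1 : alpha <= 1)
    (M1 L1 : 'M[R]_q) (M2 L2 : 'M[R]_m)
    (hM1 : M1 \in unitmx) (hM2 : M2 \in unitmx)
    (hL1 : L1 \in unitmx) (hL2 : L2 \in unitmx) :
  exists C : R, 0 < C /\
    forall U : 'I_m -> 'M[R]_q,
      (exists j : 'I_m, (U j)^T != U j) ->
      group_closed (fun g : step2 U => g \in lattice L1 L2) ->
      forall r : R, 10 <= r ->
        discrepancy alpha M1 M2 L1 L2 r <=
          C * r `^ (- (2 * (hdim q m)%:R * alpha /
                       ((hdim q m)%:R + 2 * alpha - 3 + (m == 2%N)%:R))).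
Proof.
have [C C0 hC] := count_error hq hm halpha0 halpha1 hM1 hL1 hM2 hL2.
have [J1 EJ1] := I_prof_fin halpha0 m hM1.
have [s1 s2] := exponent_bounds hq hm halpha0 halpha1; simpl in s1, s2.
set s := 2 * _ * alpha / _ in s1 s2 *.
have EV : volume (Nball alpha M1 M2 1) = (bvol M2 * J1)%:E.
  by rewrite volume_Nball ?ltr01 ?EJ1 // ltnW.
set V := bvol M2 * J1 in EV.
have V0 : 0 <= V.
  rewrite mulr_ge0 ?bvol_ge0 // -lee_fin -EJ1 I_ge0 // => x; exact: prof_ge0.
set dL := `|\det (block_mx L1 0 0 L2)|.
have dLE : dL = `|\det L1| * `|\det L2| by rewrite /dL det_ublock normrM.
have d1 : `|\det L1| != 0 by rewrite normr_eq0 -unitfE -unitmxE.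
have d2 : `|\det L2| != 0 by rewrite normr_eq0 -unitfE -unitmxE.
have dL0 : 0 <= dL by exact: normr_ge0.
(* The summand 1 makes the constant positive even if the quotient is 0; the factor 2 covers the two
   powers in [count_error]. *)
exists (1 + dL / V * (2 * C)); split.
  by rewrite ltr_pwDl // mulr_ge0 ?divr_ge0 // mulr_ge0 // ltW.
move=> U _ _ r r10; have r1 : 1 <= r by lra.
have r0 : 0 < r by lra.
have Q0 : 0 < r ^+ hdim q m by rewrite exprn_gt0.
rewrite /discrepancy -/dL EV /=.
(* If V = 0, the convention 0^-1 = 0 makes the discrepancy vanish, which avoids a proof that the
   volume is positive. *)
have [->|Vn] := eqVneq V 0.
  by rewrite mul0r invr0 !mulr0 !mul0r addr0 mul1r powR_ge0.
(* The volume term in the discrepancy is exactly the main term of [count_error]. *)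
have E : V * r ^+ hdim q m / dL = bvol (M2 *m L2) * (r ^+ (q + 2 * m) / `|\det L1| * J1).
  by rewrite bvol_mul // dLE /V /hdim; field; rewrite d1.
have EJ : I (fun x => prof alpha m r (enorm (M1 *m L1 *m x))) =
    (r ^+ (q + 2 * m) / `|\det L1| * J1)%:E.
  by rewrite I_prof_scale // EJ1 -EFinM.
rewrite E; have := hC r _ r1 EJ.
set err := `|_ - _|; set t := r `^ (- s) => herr.
have t0 : 0 <= t by exact: powR_ge0.
have Qr : q%:R + 2 * m%:R = (hdim q m)%:R :> R by rewrite /hdim natrD natrM.
have hex b : s <= b -> r `^ (q%:R + 2 * m%:R - b) <= r ^+ hdim q m * t.
  move=> sb; rewrite -powR_mulrn ?(ltW r0) // /t -powRDp // ler_powR // Qr; lra.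
have h1 : err <= 2 * C * (r ^+ hdim q m * t).
  apply: le_trans herr _; move: (r ^+ _ * t) hex => X hex.
  rewrite (_ : 2 * C * X = C * (X + X)); last by ring.
  by rewrite ler_pM2l //; apply: lerD; rewrite -addrA -opprD; exact: hex.
have h2 : 0 <= dL / (V * r ^+ hdim q m) by rewrite divr_ge0 // mulr_ge0 // ltW.
apply: le_trans (ler_wpM2l h2 h1) _.
have -> : dL / (V * r ^+ hdim q m) * (2 * C * (r ^+ hdim q m * t)) = dL / V * (2 * C) * t.
  by field; rewrite Vn gt_eqF.
by rewrite [leRHS]mulrDl mul1r lerDr.
Qed.
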